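(* Let $X$ be a rearrangement-invariant space over $\mathbb{R}$ (with Lebesgue measure), let $\ell_X$ be its discretized space over $\mathbb{Z}$, and let $\underline{d}_X,\overline{d}_X$ be its discrete Boyd indices. Then the following are equivalent: (a) the segment multiplier $S$ is bounded on $X$; (b) the truncated Hilbert transform $H_1$ is bounded on $X$; (c) the discrete Hilbert transform $\mathcal{H}$ is bounded on $\ell_X$; (d) $0<\underline{d}_X\le \overline{d}_X<1$.
   Context: **Banach function spaces.** Let $(R,\mu)$ be a $\sigma$-finite measure space, $\mathcal{M}(R)$ the set of measurable scalar-valued functions (real or complex) on $R$, $\mathcal{M}^+(R)$ the non-negative ones. A Banach function norm is a map $\rho:\mathcal{M}^+(R)\to[0,\infty]$ such that: (a) $\rho(f)=0$ iff $f=0$ a.e., $\rho(af)=a\rho(f)$ for $a\ge 0$, $\rho(f+g)\le\rho(f)+\rho(g)$; (b) $f\le g$ a.e. implies $\rho(f)\le\rho(g)$; (c) $f_n\nearrow f$ a.e. implies $\rho(f_n)\nearrow\rho(f)$; (d) $\mu(E)<\infty$ implies $\rho(\chi_E)<\infty$; (e) if $\mu(E)<\infty$ there is $C_E>0$ with $\int_E f\,d\mu\le C_E\rho(f)$ for all $f\in\mathcal{M}^+(R)$. The associated Banach function space is $X=\{f\in\mathcal{M}(R):\rho(|f|)<\infty\}$ with $\|f\|_X=\rho(|f|)$. Its associate space $X'$ is the Banach function space given by $\rho'(f)=\sup\{\int_R fg\,d\mu: g\in\mathcal{M}^+(R),\ \rho(g)\le1\}$. **Rearrangement-invariant spaces.**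 The decreasing rearrangement of $f$ is $f^*(t)=\inf\{s>0:\mu(\{|f|>s\})\le t\}$, $t\ge0$. A Banach function space $X$ is rearrangement-invariant (r.i.) if $f\in X$, $g\in\mathcal{M}(R)$, $f^*=g^*$ imply $g\in X$ and $\|f\|_X=\|g\|_X$. The relevant measure spaces are $\mathbb{R}$ with Lebesgue measure and $\mathbb{Z}$ with counting measure. **Discretized space.** For an r.i. space $X$ over $\mathbb{R}$, $\ell_X=\{(a_n)_{n\in\mathbb{Z}}:\sum_{n\in\mathbb{Z}}a_n\chi_{(n-1,n)}\in X\}$, with $\|(a_n)_n\|_{\ell_X}=\|\sum_{n}a_n\chi_{(n-1,n)}\|_X$. It is an r.i. space over $\mathbb{Z}$. **Boyd indices over $\mathbb{Z}$.** For an r.i. space $Y$ over $\mathbb{Z}$, let $D$ be the set of non-negative, non-increasing sequences $a=(a_n)_{n\ge1}$ (viewed as sequences on $\mathbb{Z}$ by extending by zero), let $(E^d_m a)_n=a_{mn}$, and for integers $m\ge1$ put $h_Y(m)=\sup\{\|E^d_m a\|_Y: a\in D,\ \|a\|_Y\le1\}$. The lower Boyd index is $\underline{\alpha}_Y=\sup_{m\ge2}\left(-\frac{\log h_Y(m)}{\log m}\right)=\lim_{m\to\infty}\left(-\frac{\log h_Y(m)}{\log m}\right)$ and the upper one is $\overline{\alpha}_Y=1-\underline{\alpha}_{Y'}$. The discrete Boyd indices of $X$ are $\underline{d}_X=\underline{\alpha}_{\ell_X}$ and $\overline{d}_X=\overline{\alpha}_{\ell_X}$. **Operators.** $Sf(x)=\int_{\mathbb{R}}\frac{\sin(x-y)}{x-y}f(y)\,dy$;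 $H_1f(x)=\int_{|x-y|\ge1}\frac{f(y)}{x-y}\,dy$; $(\mathcal{H}a)_k=\sum_{j\ne k}\frac{a_j}{k-j}$ for $k\in\mathbb{Z}$. An operator $T$ is bounded on $X$ if $Tf$ is defined for every $f\in X$ (the integral converges for a.e. $x$, respectively the series converges for every $k$), belongs to $X$, and $\|Tf\|_X\le C\|f\|_X$ with $C$ independent of $f$. *)

(* Defs.v *)
From HB Require Import structures.
From mathcomp Require Import all_boot all_order all_algebra complex.
From mathcomp Require Import all_classical all_reals all_analysis.

Set Implicit Arguments.
Unset Strict Implicit.
Unset Printing Implicit Defensive.
Import Order.TTheory GRing.Theory Num.Theory.
Import numFieldNormedType.Exports.

Local Open Scope classical_set_scope.
Local Open Scope ring_scope.
Local Open Scope ereal_scope.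
Local Open Scope complex_scope.

HB.instance Definition _ := isPointed.Build int 0%R.
HB.instance Definition _ := @isMeasurable.Build default_measure_display
  int (@discrete_measurable int) (@discrete_measurable0 int)
  (@discrete_measurableC int) (@discrete_measurableU int).

(* Function spaces are taken over the real or over the complex scalars. In
   both cases functions take values in R[i]; over the real scalars they are
   the ones whose imaginary part vanishes identically. *)
Inductive scalars := RealScalars | ComplexScalars.

Definition cabs (R : realType) (z : R[i]) : R := ComplexField.Normc.normc z.

Section BanachFunctionSpaces.
Context d (T : measurableType d) (R : realType).
Variable mu : {measure set T -> \bar R}.
Implicit Types (rho : (T -> R) -> \bar R) (K : scalars).

Definition Mfun K : set (T -> R[i]) := [set f : T -> R[i] |
  [/\ measurable_fun [set: T] (fun x => complex.Re (f x) : R),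
      measurable_fun [set: T] (fun x => complex.Im (f x) : R) &
      K = RealScalars -> forall x, complex.Im (f x) = 0%R]].

Definition Mplus : set (T -> R) :=
  [set f : T -> R | measurable_fun [set: T] f /\ forall x, (0 <= f x)%R].

(* Only the values of rho on Mplus matter. *)
Record banach_function_norm rho : Prop := BanachFunctionNorm {
  bfn_ge0 : forall f, Mplus f -> 0 <= rho f ;
  bfn_eq0 : forall f, Mplus f ->
    rho f = 0 <-> {ae mu, forall x, f x = 0%R} ;
  bfn_homo : forall (a : R) f, (0 <= a)%R -> Mplus f ->
    rho (fun x => a * f x)%R = a%:E * rho f ;
  bfn_triangle : forall f g, Mplus f -> Mplus g ->
    rho (fun x => f x + g x)%R <= rho f + rho g ;
  bfn_mono : forall f g, Mplus f -> Mplus g ->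
    {ae mu, forall x, (f x <= g x)%R} -> rho f <= rho g ;
  bfn_fatou : forall (f_ : nat -> T -> R) f,
    (forall n, Mplus (f_ n)) -> Mplus f ->
    {ae mu, forall x, nondecreasing_seq (fun n => f_ n x) /\
                      f_ n x @[n --> \oo] --> f x} ->
    nondecreasing_seq (fun n => rho (f_ n)) /\
    rho (f_ n) @[n --> \oo] --> rho f ;
  bfn_indic : forall E, measurable E -> mu E < +oo ->
    rho (\1_E : T -> R) < +oo ;
  bfn_local : forall E, measurable E -> mu E < +oo ->
    exists2 C : R, (0 < C)%R &
      forall f, Mplus f -> \int[mu]_(x in E) (f x)%:E <= C%:E * rho f
}.

Definition bfs_norm rho (f : T -> R[i]) : \bar R := rho (fun x => cabs (f x)).

Definition bfs K rho : set (T -> R[i]) :=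
  [set f | Mfun K f /\ bfs_norm rho f < +oo].

Definition associate_norm rho (f : T -> R) : \bar R :=
  ereal_sup [set \int[mu]_x (f x * g x)%:E |
             g in [set g | Mplus g /\ rho g <= 1]].

Definition decreasing_rearrangement (f : T -> R[i]) (t : R) : \bar R :=
  ereal_inf [set s%:E |
    s in [set s : R | (0 < s)%R /\ mu [set x | (s < cabs (f x))%R] <= t%:E]].

Definition rearrangement_invariant K rho : Prop :=
  banach_function_norm rho /\
  forall f g, bfs K rho f -> Mfun K g ->
    (forall t : R, (0 <= t)%R ->
      decreasing_rearrangement f t = decreasing_rearrangement g t) ->
    bfs K rho g /\ bfs_norm rho f = bfs_norm rho g.

Definition cintegrable (D : set T) (f : T -> R[i]) : Prop :=
  mu.-integrable D (fun x => (complex.Re (f x))%:E) /\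
  mu.-integrable D (fun x => (complex.Im (f x))%:E).

Definition cintegral (D : set T) (f : T -> R[i]) : R[i] :=
  (\int[mu]_(x in D) complex.Re (f x))%R +i*
  (\int[mu]_(x in D) complex.Im (f x))%R.

(* The operator f |-> (x |-> \int_(y in D x) k x y * f y) *)
Definition integral_operator (D : T -> set T) (k : T -> T -> R)
    (f : T -> R[i]) (x : T) : R[i] :=
  cintegral (D x) (fun y => (k x y)%:C * f y)%R.

(* When mu is the counting measure, the integrals are absolutely convergent
   series and "almost everywhere" means "everywhere". *)
Definition bounded_integral_operator K rho (D : T -> set T)
    (k : T -> T -> R) : Prop :=
  exists C : R, forall f, bfs K rho f ->
    [/\ {ae mu, forall x, cintegrable (D x) (fun y => (k x y)%:C * f y)%R},
        bfs K rho (integral_operator D k f) &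
        bfs_norm rho (integral_operator D k f) <= C%:E * bfs_norm rho f].

End BanachFunctionSpaces.

Section BoydIndices.
Variable R : realType.
Implicit Type rho : (int -> R) -> \bar R.

Definition Zcount : {measure set int -> \bar R} := @counting int R.

(* Sequences (a_n)_{n >= 1}, extended by zero to int *)
Definition decreasing_sequences : set (int -> R) := [set a |
  [/\ forall n : int, (n <= 0)%R -> a n = 0%R,
      forall n : int, (0 <= a n)%R &
      forall m n : int, (1 <= m)%R -> (m <= n)%R -> (a n <= a m)%R]].

Definition dilation (m : nat) (a : int -> R) : int -> R :=
  fun n => a (m%:Z * n)%R.

Definition dilation_norm rho (m : nat) : \bar R :=
  ereal_sup [set rho (dilation m a) |
             a in [set a | decreasing_sequences a /\ rho a <= 1]].

Definition lower_boyd rho : \bar R :=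
  ereal_sup [set - (lne (dilation_norm rho m) / (ln m%:R)%:E) |
             m in [set m : nat | (2 <= m)%N]].

Definition upper_boyd rho : \bar R :=
  1 - lower_boyd (associate_norm Zcount rho).

End BoydIndices.

Section Discretization.
Variable R : realType.
Implicit Type rho : (R -> R) -> \bar R.

Definition step_function (a : int -> R) (x : R) : R :=
  (\sum_(n \in [set: int]) a n * \1_(`](n - 1)%:~R, n%:~R[%classic : set R) x)%R.

Definition discretized_norm rho (a : int -> R) : \bar R :=
  rho (step_function a).

Definition lower_discrete_boyd rho : \bar R :=
  lower_boyd (discretized_norm rho).

Definition upper_discrete_boyd rho : \bar R :=
  upper_boyd (discretized_norm rho).

Definition segment_multiplier_bounded K rho : Prop :=
  bounded_integral_operator (@lebesgue_measure R) K rho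
    (fun _ : R => [set: R]) (fun x y : R => sin (x - y) / (x - y))%R.

Definition truncated_hilbert_bounded K rho : Prop :=
  bounded_integral_operator (@lebesgue_measure R) K rho
    (fun x : R => [set y : R | (1 <= `|x - y|)%R]) (fun x y : R => (x - y)^-1)%R.

Definition discrete_hilbert_bounded K (rho : (int -> R) -> \bar R) : Prop :=
  bounded_integral_operator (Zcount R) K rho
    (fun k : int => [set j : int | j <> k]) (fun k j : int => (k - j)%:~R^-1)%R.

End Discretization.

(* Main.v *)
Require Import Defs.
From HB Require Import structures.
From mathcomp Require Import all_boot all_order all_algebra complex.
From mathcomp Require Import all_classical all_reals all_analysis.
From mathcomp Require Import finmap measurable_realfun ring lra zify.

(** Write [sigma] for the norm of the discretized space and [sigma'] for its
associate norm. The whole theorem is about one positive operator on sequences,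
the Hilbert matrix [a |-> (k >= 1 |-> sum_(j >= 1) a_j / (k + j))].

Each of the three operators dominates the Hilbert matrix. Apply it to a
nonnegative function supported on the right of the origin and look at the
result on the left: all the kernel values have the same sign there and are at
least a multiple of [1 / (k + j)], and rearrangement invariance allows one to
reflect the result back ([hilbert_hardy_reflect]). For [S] the kernel
oscillates; the combination [sin x * S (f cos) - cos x * S (f sin)] has kernel
[sin (x - y) ^ 2 / (x - y)], and adding its translate by 1 removes the zeros of
the sine ([hardy_of_segment_multiplier]).

Boundedness of the Hilbert matrix gives the conditions on the indices. For
decreasing [a] the terms with [k <= j < 2 ^ L k] show that the dilation by
[2 ^ L] has norm at most [4 C / L], hence less than 1 for large [L]
([hardy_lower_boyd]); the matrix is symmetric, so the same holds for [sigma']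
([hardy_bounded_dual]). That the lower index is at most the upper one holds in
every rearrangement-invariant space: the indicator of [1, .., N] has
[sigma * sigma' <= 2 N], and dilations that shrink such intervals to the single
point 1 relate this product to both indices ([lower_boyd_le_upper]).

Conversely, let both indices lie strictly between 0 and 1. Some dilation then
contracts [sigma] and some dilation contracts [sigma'], so that the tail sums
[sum_(j >= k) a_j / j] of decreasing sequences are bounded for both norms
([tail_sum_bounded]) and with them the form [sum a_i b_l / (i + l + 1)] on
pairs of decreasing sequences. A kernel on the integers is called
[hilbert_bounded] when its sums over products of finite sets are dominated by
the sums of [1 / (i + l + 1)] over initial segments of the same sizes. By
summation by parts in both variables such a kernel satisfies the same bilinear
estimate as the Hilbert matrix, for arbitrary sequences ([bilinear_bound]).
The kernel [1 / (n - 1/2)] of the discrete Hilbert transform, moved off its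
singularity, has this property ([half_kernel_hilbert_bounded]): on sets it is
of weak type (1,1), by the computation of Boole for finite sums of
[1 / (y - x_i)] ([boole_ineq]), and it is bounded in the mean square.

Two devices transport the estimate to functions. A functional of norm at most
one that attains the norm of a finitely supported sequence is found by a
finite-dimensional Hahn-Banach argument ([norming]), so that no reflexivity
of the associate space is needed; and averaging a function over the unit
intervals costs at most a factor 2 ([rho_average]). Finally, up to bounded
multipliers in [x] and [y], each of the three kernels is [1 / (n - 1/2)] at
the difference [n] of the unit intervals of [x] and [y], with an error of the
order of its square ([transfer]); the square is summable. *)

Set Implicit Arguments.
Unset Strict Implicit.
Unset Printing Implicit Defensive.
Import Order.TTheory GRing.Theory Num.Theory.
Import numFieldNormedType.Exports.

Local Open Scope classical_set_scope.
Local Open Scope ring_scope.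

(** * Hahn-Banach theorem in finite dimension *)

Section HahnBanach.
Context (R : realType) (V : lmodType R).
Implicit Types (p q : V -> R) (v x y : V).

Definition sublinear p :=
  (forall x y, p (x + y) <= p x + p y) /\
  (forall a x, 0 <= a -> p (a *: x) = a * p x).

Lemma sublinear0 p : sublinear p -> p 0 = 0.
Proof. by move=> [_ /(_ 0 0 (lexx _))]; rewrite scale0r mul0r. Qed.

Lemma sublinear_oppr p x : sublinear p -> - p (- x) <= p x.
Proof.
by move=> hp; have := hp.1 x (- x); rewrite subrr sublinear0// => ?; lra.
Qed.

(** The infimum of [p (x + a *: v) - a * p v] over [a >= 0] is again sublinear;
sliding [x] along [v] makes it additive on the line of [v]. *)
Lemma sublinear_flatten p v : sublinear p ->
  exists q, [/\ sublinear q, (forall x, q x <= p x) & q (- v) <= - p v].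
Proof.
move=> hp; have [pD pZ] := hp.
pose A x := [set p (x + a *: v) - a * p v | a in [set a : R | 0 <= a]].
have Alb x : has_inf (A x).
  split; first by exists (p (x + 0 *: v) - 0 * p v); exists 0 => //=.
  exists (- p (- x)) => _ [a a0 <-].
  have := pD (x + a *: v) (- x).
  by rewrite addrAC subrr add0r pZ//; lra.
have Ain x a : 0 <= a -> inf (A x) <= p (x + a *: v) - a * p v.
  by move=> a0; apply: ge_inf; [exact: (Alb x).2 | exists a => //=].
have Aex x e : 0 < e -> exists2 a, 0 <= a & p (x + a *: v) - a * p v < inf (A x) + e.
  by move=> e0; have [_ [a a0 <-] ?] := inf_adherent e0 (Alb x); exists a.
exists (fun x => inf (A x)); split.
- split=> [x y|a x a0].
    apply/ler_addgt0Pr => e e0.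
    have e2 : 0 < e / 2 by lra.
    have [a a0 ha] := Aex x _ e2; have [b b0 hb] := Aex y _ e2.
    apply: le_trans (Ain _ (a + b) (addr_ge0 a0 b0)) _.
    have := pD (x + a *: v) (y + b *: v).
    by rewrite addrACA -scalerDl; lra.
  have half b z : 0 < b -> inf (A (b *: z)) <= b * inf (A z).
    move=> b0; apply/ler_addgt0Pr => e e0.
    have e2 : 0 < e / b by rewrite divr_gt0.
    have [c c0 hc] := Aex z _ e2.
    apply: le_trans (Ain _ (b * c) (mulr_ge0 (ltW b0) c0)) _.
    rewrite -scalerA -scalerDr pZ ?(ltW b0)// -mulrA -mulrBr.
    apply: le_trans (ler_wpM2l (ltW b0) (ltW hc)) _.
    by rewrite mulrDr mulrCA divff ?gt_eqF// mulr1.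
  move: a0; rewrite le_eqVlt => /predU1P[<-|a0].
    rewrite scale0r mul0r; apply/eqP; rewrite eq_le.
    have := Ain 0 0 (lexx _); rewrite scale0r mul0r addr0 subr0 sublinear0// => ->/=.
    apply: lb_le_inf; first exact: (Alb 0).1.
    by move=> _ [b b0 <-]; rewrite add0r pZ// subrr.
  apply/eqP; rewrite eq_le half//= -ler_pdivlMl//.
  have ai : 0 < a^-1 by rewrite invr_gt0.
  by have := half a^-1 (a *: x) ai; rewrite scalerA mulVf ?gt_eqF// scale1r.
- by move=> x; have := Ain x 0 (lexx _); rewrite scale0r mul0r addr0 subr0.
- have := Ain (- v) 1 ler01.
  by rewrite scale1r addNr sublinear0// mul1r sub0r.
Qed.

(** Later flattenings only lower the functional, so they keep the additivity already
gained in the earlier directions. *)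
Lemma sublinear_linearize p (s : seq V) : sublinear p ->
  exists q, [/\ sublinear q, (forall x, q x <= p x) &
    {in s, forall v, q (- v) <= - q v}].
Proof.
move=> hp; elim: s => [|v s [q [hq qp qs]]]; first by exists p; split.
have [r [hr rq rv]] := sublinear_flatten v hq.
exists r; split=> [//|x|x]; first exact: le_trans (rq _) (qp _).
rewrite inE => /predU1P[->|xs].
  by apply: le_trans rv _; rewrite lerN2.
by apply: le_trans (rq _) _; apply: le_trans (qs _ xs) _; rewrite lerN2.
Qed.

Lemma sublinear_sumE q (I : Type) (s : seq I) (e : I -> V) (x : I -> R) :
  sublinear q -> (forall i, q (- e i) <= - q (e i)) ->
  q (\sum_(i <- s) x i *: e i) = \sum_(i <- s) x i * q (e i).
Proof.
move=> hq qe.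
have qN i : q (- e i) = - q (e i).
  by apply/eqP; rewrite eq_le qe/= lerNl; exact: sublinear_oppr.
have le1 (y : I -> R) : q (\sum_(i <- s) y i *: e i) <= \sum_(i <- s) y i * q (e i).
  elim: s => [|i s IH]; first by rewrite !big_nil sublinear0.
  rewrite !big_cons; apply: le_trans (hq.1 _ _) _; apply: lerD => //.
  have [y0|y0] := leP 0 (y i); first by rewrite hq.2.
  have := hq.2 (- y i) (- e i); rewrite oppr_ge0 scalerN scaleNr opprK qN mulrNN => -> //; exact: ltW.
apply/eqP; rewrite eq_le le1/=.
have := le1 (fun i => - x i); have := sublinear_oppr (\sum_(i <- s) x i *: e i) hq.
have -> : \sum_(i <- s) - x i *: e i = - \sum_(i <- s) x i *: e i.
  by rewrite -sumrN; apply: eq_bigr => i _; rewrite scaleNr.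
have -> : \sum_(i <- s) - x i * q (e i) = - \sum_(i <- s) x i * q (e i).
  by rewrite -sumrN; apply: eq_bigr => i _; rewrite mulNr.
lra.
Qed.

(** A minorant of [p] that is linear on the span of the [e i] and still equal to [p]
at the vector with coordinates [t]; [b] lists its values on the [e i]. *)
Lemma hahn_banach_fin p (I : eqType) (s : seq I) (e : I -> V) (t : I -> R) :
  sublinear p -> exists b : I -> R,
    (forall x : I -> R, \sum_(i <- s) x i * b i <= p (\sum_(i <- s) x i *: e i)) /\
    \sum_(i <- s) t i * b i = p (\sum_(i <- s) t i *: e i).
Proof.
move=> hp; set v := \sum_(i <- s) _.
have [q0 [hq0 q0p q0v]] := sublinear_flatten v hp.
have [q [hq qq0 qs]] := sublinear_linearize [seq e i | i <- s] hq0.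
(* outside [s] the vectors are replaced by 0, where additivity is automatic *)
pose e' i := if i \in s then e i else 0.
have qe' i : q (- e' i) <= - q (e' i).
  rewrite /e'; case: ifPn => [is_|_]; last by rewrite oppr0 sublinear0// oppr0.
  by apply: qs; exact: map_f.
have E (x : I -> R) : \sum_(i <- s) x i *: e i = \sum_(i <- s) x i *: e' i.
  by apply: eq_big_seq => i is_; rewrite /e' is_.
exists (fun i => q (e' i)).
have qE (x : I -> R) : \sum_(i <- s) x i * q (e' i) = q (\sum_(i <- s) x i *: e i).
  by rewrite E sublinear_sumE.
split=> [x|]; first by rewrite qE; exact: le_trans (qq0 _) (q0p _).
rewrite qE -/v; apply/eqP; rewrite eq_le (le_trans (qq0 _) (q0p _))//=.
have := sublinear_oppr v hq; have := qq0 (- v); lra.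
Qed.

End HahnBanach.

(** * Summation by parts *)

Section Abel.
Context (R : realType).
Implicit Types (d f g v u : nat -> R).

Lemma abel_ge0 n d v : (forall m, (m <= n)%N -> 0 <= \sum_(i < m) d i) ->
  (forall i, (i < n)%N -> 0 <= v i) ->
  (forall i, (i.+1 < n)%N -> v i.+1 <= v i) ->
  0 <= \sum_(i < n) d i * v i.
Proof.
case: n => [|n]; first by rewrite big_ord0.
move=> dn v0 vd.
suff /(_ n (leqnn n)) : forall m, (m <= n)%N ->
    v m * (\sum_(i < m.+1) d i) <= \sum_(i < m.+1) d i * v i.
  by apply: le_trans; rewrite mulr_ge0 ?v0 ?dn.
elim=> [_|m IH mn]; first by rewrite !big_ord_recl !big_ord0 !addr0 mulrC.
rewrite big_ord_recr [leRHS]big_ord_recr/= mulrDr [X in _ + X <= _]mulrC lerD2r.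
apply: le_trans (IH (ltnW mn)); apply: ler_wpM2r; first by apply: dn; lia.
exact: vd.
Qed.

Lemma abel_le n f g v :
  (forall m, (m <= n)%N -> \sum_(i < m) f i <= \sum_(i < m) g i) ->
  (forall i, (i < n)%N -> 0 <= v i) ->
  (forall i, (i.+1 < n)%N -> v i.+1 <= v i) ->
  \sum_(i < n) f i * v i <= \sum_(i < n) g i * v i.
Proof.
move=> fg v0 vd; rewrite -subr_ge0 -sumrB.
under eq_bigr do rewrite -mulrBl.
apply: abel_ge0 (fun i => g i - f i) _ _ v0 vd => m mn.
by rewrite sumrB subr_ge0 fg.
Qed.

(** A pair of decreasing sequences is a positive combination of pairs of indicators of
initial segments, so it suffices to compare the sums over initial rectangles. *)
Lemma abel_le2 n n' (F G : nat -> nat -> R) v u :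
  (forall m m', (m <= n)%N -> (m' <= n')%N ->
    \sum_(i < m) \sum_(l < m') F i l <= \sum_(i < m) \sum_(l < m') G i l) ->
  (forall i, (i < n)%N -> 0 <= v i) ->
  (forall i, (i.+1 < n)%N -> v i.+1 <= v i) ->
  (forall i, (i < n')%N -> 0 <= u i) ->
  (forall i, (i.+1 < n')%N -> u i.+1 <= u i) ->
  \sum_(i < n) \sum_(l < n') F i l * (v i * u l) <=
  \sum_(i < n) \sum_(l < n') G i l * (v i * u l).
Proof.
move=> FG v0 vd u0 ud.
have E (H : nat -> nat -> R) : \sum_(i < n) \sum_(l < n') H i l * (v i * u l) =
    \sum_(i < n) (\sum_(l < n') H i l * u l) * v i.
  apply: eq_bigr => i _; rewrite mulr_suml; apply: eq_bigr => l _; ring.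
rewrite !E; apply: (@abel_le n (fun i => \sum_(l < n') F i l * u l)
  (fun i => \sum_(l < n') G i l * u l)) => // m mn.
have E2 (H : nat -> nat -> R) : \sum_(i < m) \sum_(l < n') H i l * u l =
    \sum_(l < n') (\sum_(i < m) H i l) * u l.
  by rewrite exchange_big/=; apply: eq_bigr => l _; rewrite mulr_suml.
rewrite !E2; apply: (@abel_le n' (fun l => \sum_(i < m) F i l)
  (fun l => \sum_(i < m) G i l)) => // m' mn'.
by rewrite exchange_big [leRHS]exchange_big/=; exact: FG.
Qed.

End Abel.

(** * The weak type inequality of Boole *)

Section Boole.
Context (R : realType).

Lemma coefPn_prod_ord m (x : 'I_m.+1 -> R) :
  (\prod_(i < m.+1) ('X - (x i)%:P))`_m = - \sum_i x i.
Proof.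
have := @coefPn_prod_XsubC R [seq x i | i <- enum 'I_m.+1].
by rewrite !big_map size_map size_enum_ord -!enumT !big_enum/=; apply.
Qed.

Lemma size_prod_ord m (x : 'I_m -> R) (P : pred 'I_m) :
  size (\prod_(i < m | P i) ('X - (x i)%:P)) = #|P|.+1.
Proof.
rewrite -big_filter size_prod_XsubC; congr S.
by rewrite -sum1_size big_filter -sum1_card.
Qed.

(** The points [y] interlace with the nodes [x] and the sum of the [(y k - x i)^-1] is
large at each of them; the claim is that the gaps are then short. Interpolating
the difference of the two node polynomials at the points [y] gives positive
weights [e k] with [\sum_k e k / (y k - x i) = 1] for every [i], and comparing
leading coefficients gives [\sum_k e k = \sum_i (y i - x i)]. Summing the first
identity over [i] concludes. *)
Lemma boole_ineq m (x y : 'I_m -> R) (s : R) :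
  (forall i, x i < y i) -> (forall i l : 'I_m, (i < l)%N -> y i < x l) ->
  (forall k, s <= \sum_i (y k - x i)^-1) ->
  s * \sum_i (y i - x i) <= m%:R.
Proof.
case: m x y => [|m] x y; first by rewrite !big_ord0 mulr0.
move=> xy yx sy.
have yy k l : k != l -> y k - y l != 0.
  rewrite subr_eq0 neq_ltn => /orP[] kl.
    by rewrite lt_eqF// (lt_trans (yx _ _ kl)).
  by rewrite gt_eqF// (lt_trans (yx _ _ kl)).
have xny k i : x i - y k != 0.
  rewrite subr_eq0; have [ki|ik|/val_inj->] := ltngtP (k : nat) i.
  - by rewrite gt_eqF// yx.
  - by rewrite lt_eqF// (lt_trans (xy i))// (lt_trans (yx _ _ ik)).
  - by rewrite lt_eqF.
pose e k := (y k - x k) * \prod_(i < m.+1 | i != k) ((y k - x i) / (y k - y i)).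
have e0 k : 0 <= e k.
  rewrite mulr_ge0 ?subr_ge0 ?(ltW (xy k))//; apply: prodr_ge0 => i ik.
  have [ki|ik'|/val_inj/eqP] := ltngtP (k : nat) i; last by rewrite eq_sym (negbTE ik).
  - apply: ltW; rewrite nmulr_rgt0 ?invr_lt0 subr_lt0 ?yx//.
    by rewrite (lt_trans (yx _ _ ki)).
  - apply: ltW; apply: mulr_gt0; rewrite ?invr_gt0 subr_gt0.
      by rewrite (lt_trans (xy _))// (lt_trans (yx _ _ ik')).
    by rewrite (lt_trans (yx _ _ ik')).
pose px := \prod_(i < m.+1) ('X - (x i)%:P).
pose py := \prod_(i < m.+1) ('X - (y i)%:P).
pose pyk k := \prod_(i < m.+1 | i != k) ('X - (y i)%:P).
have spx : size px = m.+2 by rewrite size_prod_ord card_ord.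
have spy : size py = m.+2 by rewrite size_prod_ord card_ord.
have spyk k : size (pyk k) = m.+1.
  by rewrite size_prod_ord; congr S; rewrite cardC1 card_ord.
have mon (P : pred 'I_m.+1) (z : 'I_m.+1 -> R) :
  \prod_(i < m.+1 | P i) ('X - (z i)%:P) \is monic by exact: monic_prod_XsubC.
(* The Lagrange interpolation of px - py at the nodes y *)
have L : px - py = \sum_k e k *: pyk k.
  apply/eqP; rewrite -subr_eq0; apply/eqP.
  set d := (X in X = _).
  apply: (@roots_geq_poly_eq0 _ _ [seq y k | k <- enum 'I_m.+1]).
  - apply/allP => _ /mapP[k _ ->]; rewrite /root /d !hornerE horner_sum.
    rewrite (bigD1 k)//= [X in _ - (_ + X)]big1 ?addr0; last first.
      move=> l lk; rewrite !hornerE horner_prod (bigD1 k)//=; last by rewrite eq_sym.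
      by rewrite !hornerE subrr/= mulr0 mul0r.
    rewrite !hornerE !horner_prod (bigD1 k)//= [X in _ - X - _](bigD1 k)//= !hornerE.
    rewrite subrr mul0r subr0 /e -mulrA -big_split/= subr_eq0; apply/eqP.
    by congr (_ * _); apply: eq_bigr => i ik; rewrite !hornerE mulfVK// yy// eq_sym.
  - rewrite map_inj_uniq ?enum_uniq// => k l /eqP kl.
    by apply/eqP; apply: contraTT kl => kl; rewrite -subr_eq0 yy.
  - rewrite size_map size_enum_ord; apply/leq_sizeP => j mj.
    rewrite /d !coefB coef_sum big1 ?subr0; last first.
      by move=> k _; rewrite coefZ nth_default ?mulr0// spyk.
    move: mj; rewrite leq_eqVlt => /predU1P[<-|mj]; last first.
      by rewrite !nth_default ?subrr ?spx ?spy.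
    have /monicP := mon xpredT x; have /monicP := mon xpredT y.
    by rewrite !lead_coefE -/px -/py spx spy/= => -> ->; rewrite subrr.
have Ex i : \sum_k e k * (y k - x i)^-1 = 1.
  have /(congr1 (fun p => p.[x i])) := L.
  rewrite !hornerE horner_sum horner_prod (bigD1 i)//= !hornerE subrr mul0r sub0r.
  have py0 : py.[x i] != 0.
    by rewrite horner_prod; apply/prodf_neq0 => k _; rewrite !hornerE xny.
  move=> /(congr1 (fun r => - (r / py.[x i]))); rewrite mulNr opprK divff// => ->.
  rewrite mulr_suml -sumrN; apply: eq_bigr => k _.
  rewrite !hornerE /py (bigD1 k)//= hornerM -/(pyk k) !hornerE.
  have pyk0 : (pyk k).[x i] != 0.
    by rewrite horner_prod; apply/prodf_neq0 => l _; rewrite !hornerE xny.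
  have := xny k i => h.
  have h' : y k - x i != 0 by rewrite -opprB oppr_eq0.
  by field; rewrite h h' pyk0.
have Es : \sum_k e k = \sum_i (y i - x i).
  have /(congr1 (fun p : {poly R} => p`_m)) := L.
  rewrite coefB !coefPn_prod_ord coef_sum opprK addrC sumrB => ->.
  apply: eq_bigr => k _; rewrite coefZ.
  have /monicP := mon (fun i => i != k) y.
  by rewrite lead_coefE -/(pyk k) spyk/= => ->; rewrite mulr1.
rewrite -Es mulr_sumr.
have -> : m.+1%:R = \sum_(i < m.+1) \sum_k e k * (y k - x i)^-1.
  by under eq_bigr do rewrite Ex; rewrite sumr_const card_ord.
rewrite exchange_big/=; apply: ler_sum => k _.
by rewrite -mulr_sumr mulrC ler_wpM2l.
Qed.

End Boole.

Section HalfKernel.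
Context (R : realType).
Implicit Types (E F G : seq int).

(** The kernel of the discrete Hilbert transform moved by one half: there is no
diagonal to exclude, and it is still odd, now about [1/2]. *)
Definition half_kernel (n : int) : R := (n%:~R - 2^-1)^-1.

Lemma int_half_neq0 (n : int) : n%:~R - 2^-1 != 0 :> R.
Proof.
apply/eqP => h; have : (2 * n)%:~R = 1%:~R :> R by rewrite rmorphM/=; lra.
by move/intr_inj; lia.
Qed.

Lemma half_kernelC n : half_kernel (1 - n) = - half_kernel n.
Proof.
rewrite /half_kernel rmorphB/= -[RHS]invrN; congr (_^-1).
by rewrite opprB; lra.
Qed.

(** Pigeonhole: distinct integers above [e] cannot all stay close to [e]. *)
Lemma uniq_int_far (g : seq int) (e : int) : uniq g -> g != [::] ->
  {in g, forall k, e < k} -> exists2 k, k \in g & (size g)%:Z <= k - e.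
Proof.
move=> ug g0 eg; apply: contrapT => /forall2NP h.
have : (size g <= size [seq (e + i.+1%:Z)%R | i <- iota 0 (size g).-1])%N.
  apply: uniq_leq_size => // k kg.
  have := eg _ kg; have := h k; rewrite kg => -[//|/negP]; rewrite -ltNge => h1 h2.
  apply/mapP; exists `|(k - e - 1)%R|%N; last by lia.
  by rewrite mem_iota; lia.
by rewrite size_map size_iota; case: (g) g0 => //= a l _; rewrite ltnn.
Qed.

(** The point to which the inequality of Boole is applied in the gap after the [i]-th
node. If the gap contains points of [G], take [k - 1/2] for one that is farthest
from the node: the number of points of [G] in the gap is at most twice its
distance. Otherwise any point close enough to the node will do, since there one
term of the sum exceeds all the others. *)
Lemma half_kernel_gap E G s (i : nat) : sorted <%O E -> uniq G -> 0 < s ->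
  {in G, forall k, s <= \sum_(j <- E) half_kernel (k - j)} ->
  (i < size E)%N ->
  exists y : R, [/\ (nth 0 E i)%:~R < y,
    forall l, (i < l < size E)%N -> y < (nth 0 E l)%:~R,
    s <= \sum_(l < size E) (y - (nth 0 E l)%:~R)^-1 &
    (size [seq k <- G | count (< k) E == i.+1])%:R <= 2 * (y - (nth 0 E i)%:~R)].
Proof.
move=> sE uG s0 Gs iE.
have sE' : sorted <=%O E by apply: sub_sorted sE => ? ? /ltW.
have Enat l : (i < l < size E)%N -> nth 0 E i + 1 <= nth 0 E l.
  move=> /andP[il lE]; have := sorted_ltn_nth lt_trans 0 sE; move=> /(_ i l).
  by rewrite !inE iE lE il lezD1; apply.
set Gi := [seq k <- G | _]; have [Gi0|Gi0] := eqVneq Gi [::].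
  rewrite Gi0/=.
  pose m : R := (size E)%:R; have m0 : 0 <= m by exact: ler0n.
  pose D := s + 2 * m + 2; have D2 : 2 < D by rewrite /D; lra.
  have D0 : 0 < D by lra.
  have Di0 : 0 < D^-1 by rewrite invr_gt0.
  have Di : D^-1 < 2^-1 by rewrite ltf_pV2 ?posrE.
  exists ((nth 0 E i)%:~R + D^-1); split; try lra.
    move=> l /Enat; rewrite -(ler_int R) rmorphD/=; lra.
  pose b (l : 'I_(size E)) : R := if l == i :> nat then D else -2.
  have : s <= \sum_l b l.
    rewrite (bigD1 (Ordinal iE))//= {1}/b/= eqxx.
    have : \sum_(l < size E) (-2 : R) <= \sum_(l < size E | l != Ordinal iE) b l.
      rewrite [leLHS](bigD1 (Ordinal iE))//=.
      under [leRHS]eq_bigr => l li.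
        have -> : b l = - 2 by rewrite /b; case: eqP => // li'; case/eqP: li; exact: val_inj.
      over.
      by rewrite gerDr; lra.
    by rewrite sumr_const card_ord -mulr_natr -/m /D; lra.
  move=> /le_trans; apply; apply: ler_sum => l _; rewrite /b; case: eqP => [->|/eqP li].
    by rewrite addrAC subrr add0r invrK.
  move: li; rewrite neq_ltn => /orP[li|il].
    have : (nth 0 E l)%:~R <= (nth 0 E i)%:~R :> R.
      rewrite ler_int; have := sorted_ltn_nth lt_trans 0 sE; move=> /(_ l i).
      by rewrite !inE iE ltn_ord li => /(_ isT isT isT)/ltW.
    move=> h; apply: (@le_trans _ _ 0); first lra.
    by rewrite invr_ge0; lra.
  have : (i < l < size E)%N by rewrite il ltn_ord.
  move=> /Enat; rewrite -(ler_int R) rmorphD/= => h.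
  set z := _ - _; have z0 : z <= - 2^-1 by rewrite /z; lra.
  have : (- z)^-1 <= 2.
    by rewrite -[leRHS]invrK lef_pV2 ?posrE; lra.
  by rewrite invrN; lra.
have uGi : uniq Gi by exact: filter_uniq.
have cE k : k \in Gi -> forall l, (l < size E)%N ->
    ((l <= i)%N -> nth 0 E l < k) /\ ((i < l)%N -> k <= nth 0 E l).
  rewrite mem_filter => /andP[/eqP c _] l lE; split=> li.
    by apply: nth_count_lt => //; rewrite c.
  by apply: nth_count_ge => //; rewrite c li.
have [|k kGi hk] := @uniq_int_far Gi (nth 0 E i) uGi Gi0.
  by move=> k /cE/(_ i iE)[+ _]; apply.
have kE := cE _ kGi; exists (k%:~R - 2^-1); split.
- by have := (kE i iE).1 (leqnn i); rewrite -lez1D -(ler_int R) rmorphD/=; lra.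
- move=> l /andP[il lE]; have := (kE l lE).2 il; rewrite -(ler_int R); lra.
- move: kGi; rewrite mem_filter => /andP[_ /Gs]; move=> /le_trans; apply.
  rewrite (big_nth 0) big_mkord; apply: ler_sum => l _.
  by rewrite /half_kernel rmorphB/= addrAC.
- have : (1 <= size Gi)%N by case: (Gi) Gi0.
  move: hk; rewrite -(ler_int R) -(ler_nat R) rmorphB/= -pmulrn; lra.
Qed.

(** The weak type (1,1) estimate on finite sets: add up the lengths given by the gaps
and bound their sum by the inequality of Boole. *)
Lemma half_kernel_weak E G s : uniq E -> uniq G -> 0 < s ->
  {in G, forall k, s <= \sum_(j <- E) half_kernel (k - j)} ->
  s * (size G)%:R <= 2 * (size E)%:R.
Proof.
wlog sE : E / sorted <%O E.
  move=> wl uE uG s0 Gs; have pE : perm_eq (sort <=%O E) E by rewrite perm_sort.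
  rewrite -(perm_size pE); apply: wl => //; rewrite ?sort_uniq//.
    by rewrite lt_sorted_uniq_le sort_uniq uE sort_le_sorted.
  by move=> k kG; rewrite (perm_big _ pE)/= Gs.
move=> uE uG s0 Gs.
have sE' : sorted <=%O E by apply: sub_sorted sE => ? ? /ltW.
have [y Hy] := fin_all_exists (fun i : 'I_(size E) =>
  half_kernel_gap sE uG s0 Gs (ltn_ord i)).
have B : s * \sum_(i < size E) (y i - (nth 0 E i)%:~R) <= (size E)%:R.
  apply: boole_ineq => [i|i l il|k]; first by case: (Hy i).
    by case: (Hy i) => _ + _ _; apply; rewrite il ltn_ord.
  by case: (Hy k).
have cnt k : k \in G -> (0 < count (< k) E <= size E)%N.
  move=> kG; rewrite count_size andbT lt0n; apply/eqP => c0.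
  have := Gs _ kG; rewrite leNgt => /negP; apply; apply: le_lt_trans s0.
  rewrite big_seq; apply: sumr_le0 => j jE.
  rewrite /half_kernel invr_le0 rmorphB/=.
  have : ~~ has (< k) E by rewrite has_count c0.
  by move/hasPn => /(_ _ jE); rewrite -leNgt -(ler_int R); lra.
have -> : (size G)%:R = \sum_(i < size E) (size [seq k <- G | count (< k) E == i.+1])%:R :> R.
  rewrite -natr_sum; congr (_%:R).
  under eq_bigr do rewrite -sum1_size big_filter.
  under eq_bigr do rewrite big_mkcond/=.
  rewrite exchange_big/= -sum1_size; apply: eq_big_seq => k /cnt /andP[c0 cE].
  have hi : ((count (< k) E).-1 < size E)%N by rewrite prednK.
  rewrite (bigD1 (Ordinal hi))//= prednK// eqxx big1// => i /eqP ii.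
  by case: eqP => // c; case: ii; apply: val_inj; rewrite /= c.
apply: le_trans (_ : s * (2 * \sum_(i < size E) (y i - (nth 0 E i)%:~R)) <= _).
  rewrite ler_pM2l// mulr_sumr; apply: ler_sum => i _.
  by case: (Hy i).
by rewrite mulrCA ler_pM2l.
Qed.

(** The points where the sum is negative are handled by the reflection [k |-> 1 - k],
[j |-> - j]. *)
Lemma half_kernel_weak_abs E G s : uniq E -> uniq G -> 0 <= s ->
  {in G, forall k, s <= `|\sum_(j <- E) half_kernel (k - j)|} ->
  s * (size G)%:R <= 4 * (size E)%:R.
Proof.
move=> uE uG; rewrite le_eqVlt => /predU1P[<-|s0] Gs; first by rewrite mul0r mulr_ge0.
pose T k : R := \sum_(j <- E) half_kernel (k - j).
pose P (k : int) : bool := s <= T k.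
have h1 := @half_kernel_weak E [seq k <- G | P k] s uE (filter_uniq _ uG) s0.
have h2 := @half_kernel_weak (map -%R E) (map (fun k => 1 - k) [seq k <- G | ~~ P k]) s.
rewrite !size_map in h2.
have uE' : uniq (map -%R E) by rewrite map_inj_uniq//; exact: oppr_inj.
have uG' : uniq (map (fun k => 1 - k) [seq k <- G | ~~ P k]).
  rewrite map_inj_uniq ?filter_uniq// => i j /(congr1 (fun x => 1 - x)).
  by rewrite !subKr.
have {}h1 : s * (size [seq k <- G | P k])%:R <= 2 * (size E)%:R.
  by apply: h1 => k; rewrite mem_filter => /andP[].
have {}h2 : s * (size [seq k <- G | ~~ P k])%:R <= 2 * (size E)%:R.
  apply: h2 => // _ /mapP[k + ->]; rewrite mem_filter => /andP[/= nP kG].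
  have := Gs _ kG; rewrite -/(T k) real_ler_normr ?num_real// => /orP[]; first by rewrite /P in nP; move=> h; rewrite h in nP.
  move=> /le_trans; apply; rewrite big_map -sumrN; apply: ler_sum => j _.
  by rewrite -half_kernelC le_eqVlt; apply/orP; left; apply/eqP; congr half_kernel; lia.
have -> : size G = (size [seq k <- G | P k] + size [seq k <- G | ~~ P k])%N.
  by rewrite !size_filter -(count_predC P).
by rewrite natrD mulrDr; lra.
Qed.

End HalfKernel.

(** * Mean square bound for the half kernel *)

Section SquareSums.
Context (R : realType).
Implicit Types (E F G : seq int).
Local Notation hk := (@half_kernel R).

Lemma sum_subset_le (T : eqType) (s s' : seq T) (f : T -> R) :
  uniq s -> {subset s <= s'} -> (forall x, 0 <= f x) ->
  \sum_(x <- s) f x <= \sum_(x <- s') f x.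
Proof.
move=> us ss' f0; elim: s us s' ss' => [_ s' _|a s IH /= /andP[as_ us] s' ss'].
  by rewrite big_nil sumr_ge0.
have as' : a \in s' by rewrite ss' ?mem_head.
rewrite big_cons (big_rem _ as')/= lerD2l; apply: IH => // x xs.
have : x \in a :: rem a s' by rewrite -(perm_mem (perm_to_rem as')) ss' ?inE ?xs ?orbT.
by rewrite inE => /predU1P[xa|//]; rewrite xa (negbTE as_) in xs.
Qed.

Definition int_window N : seq int := [seq r%:Z - N%:Z | r <- iota 0 (2 * N)].

Lemma mem_int_window N (k : int) : (k \in int_window N) = (- N%:Z <= k < N%:Z).
Proof.
apply/mapP/andP => [[r]|[h1 h2]]; first by rewrite mem_iota => h ->; lia.
by exists `|(k + N%:Z)%R|%N; [rewrite mem_iota|]; lia.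
Qed.

Lemma int_window_uniq N : uniq (int_window N).
Proof. by rewrite map_inj_uniq ?iota_uniq// => i j; lia. Qed.

Lemma sub_int_window E : exists N, {subset E <= int_window N}.
Proof.
elim: E => [|a E [N hN]]; first by exists 0%N.
exists (maxn N `|a|.+1)%N => x; rewrite inE => /predU1P[->|/hN];
  rewrite !mem_int_window; lia.
Qed.

Lemma sum_int_window N (f : int -> R) :
  \sum_(k <- int_window N) f k = \sum_(0 <= r < 2 * N) f (r%:Z - N%:Z).
Proof. by rewrite big_map /index_iota subn0. Qed.

Lemma half_kernel_sqr_le n : hk n ^+ 2 <= 4.
Proof.
have -> : 4 = 2 ^+ 2 :> R by rewrite expr2; lra.
rewrite -real_normK ?num_real// lerXn2r ?nnegrE//.
rewrite normfV -[leRHS]invrK lef_pV2 ?posrE ?normr_gt0 ?int_half_neq0//.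
have [n0|n0] := leP n 0.
  by move: n0; rewrite -(ler_int R) => n0; rewrite ler0_norm; lra.
by move: n0; rewrite -lez1D -(ler_int R) rmorphD/= => n0; rewrite ger0_norm; lra.
Qed.

(** The bound [5 - 1 / (n + 1)] is chosen so that the induction step reduces to [1 /
(z + 1/2) ^ 2 <= 1 / (z (z + 1))]. *)
Lemma sum_half_kernel_sqr_nat n :
  \sum_(1 <= i < n.+2) hk i%:Z ^+ 2 <= 5 - n.+1%:R^-1.
Proof.
elim: n => [|n IH]; first by rewrite big_nat1 invr1; have := half_kernel_sqr_le 1; lra.
rewrite big_nat_recr//=; apply: le_trans (lerD IH (lexx _)) _.
rewrite /half_kernel -pmulrn.
rewrite -[n.+2%:R]natr1; set z : R := n.+1%:R.
have z1 : 1 <= z by rewrite ler1n.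
have -> : (z + 1 - 2^-1)^-1 ^+ 2 = ((z + 2^-1) ^+ 2)^-1.
  by rewrite exprVn; congr ((_ ^+ 2)^-1); lra.
have : ((z + 2^-1) ^+ 2)^-1 <= (z * (z + 1))^-1.
  by rewrite lef_pV2 ?posrE ?exprn_gt0 ?mulr_gt0//; nra.
have -> : (z * (z + 1))^-1 = z^-1 - (z + 1)^-1.
  by field; apply/andP; split; lra.
by move: (_ ^- 2) (z^-1) ((z + 1)^-1) => a b c; lra.
Qed.

Lemma sum_half_kernel_sqr E : uniq E -> \sum_(n <- E) hk n ^+ 2 <= 10.
Proof.
move=> uE; have [N hN] := sub_int_window E.
pose s := [seq i%:Z | i <- index_iota 1 N.+2].
pose s' := [seq 1 - i%:Z | i <- index_iota 1 N.+2].
apply: le_trans (_ : \sum_(n <- s ++ s') hk n ^+ 2 <= _).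
  apply: sum_subset_le => [//|k /hN|x]; last exact: sqr_ge0.
  rewrite mem_int_window mem_cat => /andP[k1 k2].
  have [k0|k0] := leP k 0; apply/orP.
    by right; apply/mapP; exists `|1 - k|%N; [rewrite mem_index_iota|]; lia.
  by left; apply/mapP; exists `|k|%N; [rewrite mem_index_iota|]; lia.
rewrite big_cat/= !big_map.
under [X in _ + X]eq_bigr do rewrite half_kernelC sqrrN.
have := sum_half_kernel_sqr_nat N.
have : 0 <= N.+1%:R^-1 :> R by rewrite invr_ge0.
by move: (N.+1%:R^-1) (\sum_(1 <= i < N.+2) _) => a b; lra.
Qed.

Lemma half_kernel_small (n : int) (L : nat) : (0 < L)%N -> (L.+1 <= `|n|)%N -> `|hk n| <= L%:R^-1.
Proof.
move=> L0 Ln; rewrite normfV lef_pV2 ?posrE ?normr_gt0 ?int_half_neq0 ?ltr0n//.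
have : (L.+1%:Z <= n) || (n <= - L.+1%:Z) by lia.
rewrite -!(ler_int R) rmorphN/= -pmulrn -[L.+1%:R]natr1.
have : 0 <= L%:R :> R by [].
move: (L%:R) (n%:~R) => l x l0 /orP[] h.
  by rewrite ger0_norm; lra.
by rewrite ler0_norm; lra.
Qed.

(** Moving the centre by one changes the sum over a window by two terms near its ends,
and these are small. *)
Lemma half_kernel_window_diff M N (i j : int) : (M < N)%N ->
  (`|i| <= M)%N -> (`|j| <= M)%N ->
  `|\sum_(k <- int_window (N + 2)) hk (k - i) - \sum_(k <- int_window (N + 2)) hk (k - j)|
   <= `|i - j|%:~R * (2 * (N - M)%:R^-1).
Proof.
move=> MN; wlog ij : i j / i <= j.
  move=> wl iM jM; have [ij|/ltW ij] := leP i j; first exact: wl.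
  by rewrite distrC (distrC i); exact: wl.
have [n ->] : exists n : nat, j = i + n%:Z by exists `|j - i|%N; lia.
move=> {ij} iM; elim: n => [|n IH] jM; first by rewrite addr0 !subrr !normr0 mul0r.
have {}IH := IH ltac:(lia).
have -> : `|i - (i + n.+1%:Z)|%:~R = `|i - (i + n%:Z)|%:~R + 1 :> R.
  by rewrite -[1]/(1%:~R) -rmorphD/=; congr (_%:~R); lia.
rewrite mulrDl mul1r.
pose S (x : int) := \sum_(k <- int_window (N + 2)) hk (k - x).
rewrite -/(S i) -/(S (i + n%:Z)) in IH *; rewrite -/(S (i + n.+1%:Z)).
have -> : S i - S (i + n.+1%:Z) = (S i - S (i + n%:Z)) + (S (i + n%:Z) - S (i + n.+1%:Z)) by lra.
apply: le_trans (ler_normD _ _) (lerD IH _).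
set x := i + n%:Z; have -> : i + n.+1%:Z = x + 1 by rewrite /x; lia.
pose g (r : nat) := hk (r%:Z - (N + 2)%N%:Z - (x + 1)).
rewrite /S !sum_int_window -sumrB (@telescope_sumr_eq _ _ _ g)//; last first.
  by move=> r _; rewrite /g; congr (_ - _); congr half_kernel; lia.
rewrite mulr_natl mulr2n; apply: le_trans (ler_normB _ _) (lerD _ _).
  by apply: half_kernel_small; rewrite /x; lia.
by apply: half_kernel_small; rewrite /x; lia.
Qed.

(** Almost orthogonality of the translates of the kernel. Expanding the square over a
long window, the diagonal terms are bounded by [sum_half_kernel_sqr]; off the
diagonal the product of two translates is, by partial fractions, a difference of
kernels divided by [i - j], and its sum over the window tends to 0 as the window
grows. *)
Lemma half_kernel_L2 E G : uniq E -> uniq G ->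
  \sum_(k <- G) (\sum_(j <- E) hk (k - j)) ^+ 2 <= 12 * (size E)%:R.
Proof.
move=> uE uG; have [M0 EM] := sub_int_window E; have [N0 GN] := sub_int_window G.
pose M := (M0 + N0)%N; pose m := size E.
(* [K] makes the total of the off-diagonal terms in a row at most 1 *)
pose K := (2 * m + M + N0).+1; pose N := (M + K)%N.
have EM' j : j \in E -> (`|j| <= M)%N by move/EM; rewrite mem_int_window; lia.
set W := int_window (N + 2).
apply: le_trans (_ : \sum_(k <- W) (\sum_(j <- E) hk (k - j)) ^+ 2 <= _).
  apply: sum_subset_le => // [k /GN|k]; last exact: sqr_ge0.
  by rewrite !mem_int_window /N /K; lia.
have -> : \sum_(k <- W) (\sum_(j <- E) hk (k - j)) ^+ 2 =
    \sum_(i <- E) \sum_(j <- E) \sum_(k <- W) hk (k - i) * hk (k - j).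
  under eq_bigr do rewrite expr2 mulr_suml.
  rewrite exchange_big/=; apply: eq_bigr => i _.
  by under eq_bigr do rewrite mulr_sumr; rewrite exchange_big.
pose e : R := 2 * K%:R^-1.
have e0 : 0 <= e by rewrite mulr_ge0 ?invr_ge0.
have off i j : i \in E -> j \in E -> i != j ->
    \sum_(k <- W) hk (k - i) * hk (k - j) <= e.
  move=> iE jE ij.
  have ij0 : (i - j)%:~R != 0 :> R by rewrite intr_eq0 subr_eq0.
  have -> : \sum_(k <- W) hk (k - i) * hk (k - j) =
      (\sum_(k <- W) hk (k - i) - \sum_(k <- W) hk (k - j)) / (i - j)%:~R.
    rewrite -sumrB mulr_suml; apply: eq_bigr => k _; rewrite /half_kernel !rmorphB/=.
    have := int_half_neq0 R (k - i); have := int_half_neq0 R (k - j).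
    rewrite !rmorphB/= in ij0 *; move: (2^-1) => c h1 h2.
    by field; rewrite ij0 h1 h2.
  apply: le_trans (ler_norm _) _; rewrite normrM normfV ler_pdivrMr ?normr_gt0//.
  rewrite -intr_norm mulrC; apply: le_trans (half_kernel_window_diff _ (EM' _ iE) (EM' _ jE)) _.
    by rewrite /N /K; lia.
  by rewrite /N addKn.
have diag i : \sum_(k <- W) hk (k - i) * hk (k - i) <= 10.
  have := @sum_half_kernel_sqr [seq k - i | k <- W].
  rewrite big_map map_inj_uniq ?int_window_uniq; last exact: addIr.
  by under eq_bigr do rewrite expr2; apply.
have row i : i \in E -> \sum_(j <- E) \sum_(k <- W) hk (k - i) * hk (k - j) <= 12.
  move=> iE; rewrite (bigD1_seq i)//=.
  have : \sum_(j <- E | j != i) \sum_(k <- W) hk (k - i) * hk (k - j) <= \sum_(j <- E) e.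
    apply: (@le_trans _ _ (\sum_(j <- E | j != i) e)).
      rewrite big_seq_cond [leRHS]big_seq_cond; apply: ler_sum => j /andP[jE ji].
      by apply: off; rewrite // eq_sym.
    rewrite [leRHS](bigID (fun j => j != i))/= lerDl.
    by apply: sumr_ge0.
  rewrite big_const_seq count_predT iter_addr_0 -mulr_natr -/m.
  have : e * m%:R <= 1.
    rewrite /e mulrAC ler_pdivrMr ?ltr0n// mul1r -natrM ler_nat /K; lia.
  have := diag i; lra.
apply: le_trans (_ : \sum_(i <- E) (12 : R) <= _).
  by rewrite big_seq [leRHS]big_seq; apply: ler_sum.
by rewrite big_const_seq count_predT iter_addr_0 mulr_natr.
Qed.

End SquareSums.

(** * Kernels dominated by the Hilbert matrix on finite sets *)

Section HilbertBounded.
Context (R : realType).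
Implicit Types (E F G : seq int) (k : int -> int -> R).
Local Notation hk := (@half_kernel R).

Definition hilbert_sum (m n : nat) : R :=
  \sum_(i < m) \sum_(l < n) (i + l).+1%:R^-1.

Lemma hilbert_sumC m n : hilbert_sum m n = hilbert_sum n m.
Proof.
rewrite /hilbert_sum exchange_big/=; apply: eq_bigr => i _; apply: eq_bigr => l _.
by rewrite addnC.
Qed.

Lemma hilbert_sum_ge m n : \sum_(l < n) (m%:R / (m + l)%:R) <= hilbert_sum m n.
Proof.
rewrite /hilbert_sum exchange_big/=; apply: ler_sum => l _.
rewrite -[m in m%:R]card_ord -sumr_const mulr_suml; apply: ler_sum => i _.
by rewrite mul1r lef_pV2 ?posrE ?ltr0n ?ler_nat; have := ltn_ord i; lia.
Qed.

Lemma hilbert_sum_ge_half m n : (m <= n)%N -> m%:R / 2 <= hilbert_sum m n.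
Proof.
move=> mn; apply: le_trans (hilbert_sum_ge m n).
rewrite -(subnKC mn) big_split_ord/=.
apply: ler_wpDr; first by apply: sumr_ge0 => l _; rewrite divr_ge0.
rewrite -[X in X%:R / 2]card_ord -sumr_const mulr_suml; apply: ler_sum => i _.
rewrite mul1r.
have m0 : (0 < m)%N by have := ltn_ord i; lia.
rewrite ler_pdivlMr ?ltr0n; last lia.
rewrite mulrC ler_pdivrMr// -natrM ler_nat; have := ltn_ord i; lia.
Qed.

(** What survives of a bound by the Hilbert matrix when one only looks at the sizes of
finite sets; this is invariant under permutations of the integers, as the norms
are. *)
Definition hilbert_bounded k (C : R) := forall E F, uniq E -> uniq F ->
  `|\sum_(x <- F) \sum_(y <- E) k x y| <= C * hilbert_sum (size E) (size F).

(** A summable convolution kernel has sum at most [C] times the smaller of the two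
sizes, while the Hilbert matrix has sum at least half of it. *)
Lemma summable_hilbert_bounded (w : int -> R) C : (forall n, 0 <= w n) ->
  (forall s : seq int, uniq s -> \sum_(n <- s) w n <= C) ->
  hilbert_bounded (fun x y => w (x - y)) (2 * C).
Proof.
move=> w0 wC E F uE uF.
have C0 : 0 <= C by apply: le_trans (wC [::] isT); rewrite big_nil.
rewrite ger0_norm; last by apply: sumr_ge0 => x _; exact: sumr_ge0.
have [mn|/ltnW nm] := leqP (size E) (size F).
  rewrite exchange_big/= -mulrA mulrCA.
  apply: (@le_trans _ _ (\sum_(y <- E) C)).
    apply: ler_sum => y _; have := wC [seq x - y | x <- F].
    by rewrite big_map map_inj_uniq//; [apply|exact: addIr].
  rewrite big_const_seq count_predT iter_addr_0 -[C *+ _]mulr_natr ler_wpM2l//.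
  by have := hilbert_sum_ge_half mn; lra.
rewrite -mulrA mulrCA hilbert_sumC.
apply: (@le_trans _ _ (\sum_(x <- F) C)).
  apply: ler_sum => x _; have := wC [seq x - y | y <- E].
  rewrite big_map map_inj_uniq//; first by apply.
  by move=> i j /addrI/oppr_inj.
rewrite big_const_seq count_predT iter_addr_0 -[C *+ _]mulr_natr ler_wpM2l//.
by have := hilbert_sum_ge_half nm; lra.
Qed.

Lemma half_kernel_sqr_hilbert_bounded :
  hilbert_bounded (fun x y => hk (x - y) ^+ 2) 20.
Proof.
have -> : 20 = 2 * 10 :> R by lra.
apply: (@summable_hilbert_bounded (fun n => hk n ^+ 2) 10) => [n|s us].
  exact: sqr_ge0.
exact: sum_half_kernel_sqr.
Qed.

(** Sort [F] by decreasing values of [T]. On the first [m] points, where [m] is the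
size of [E], the mean square bound and [T <= 1 + T ^ 2] give [13 m]; the weak type
bound gives [4 m / (l + 1)] for the [l]-th of the remaining values. As [m / (m +
l) >= 1 / 2] for [l < m], both are at most [26 m / (m + l)] termwise. *)
Lemma half_kernel_sum_abs E F : uniq E -> uniq F -> (size E <= size F)%N ->
  \sum_(x <- F) `|\sum_(y <- E) hk (x - y)| <= 26 * hilbert_sum (size E) (size F).
Proof.
move=> uE uF mn; have [m0|m0] := posnP (size E).
  move/size0nil: (m0) => ->; rewrite big1 => [|x _]; last by rewrite big_nil normr0.
  by rewrite mulr_ge0// /hilbert_sum big_ord0.
pose T (x : int) := `|\sum_(y <- E) hk (x - y)|.
pose G := sort (fun x y => T y <= T x) F.
have pG : perm_eq G F by rewrite perm_sort.
have uG : uniq G by rewrite (perm_uniq pG).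
rewrite -(perm_big _ pG)/= -(perm_size pG).
rewrite -(perm_size pG) in mn; set m := size E in mn *; set n := size G in mn *.
have sG i j : (i <= j < n)%N -> T (nth 0 G j) <= T (nth 0 G i).
  move=> /andP[ij jn].
  have tr : transitive (fun x y => T y <= T x) by move=> y x z h1 h2; exact: le_trans h2 h1.
  have := @sorted_leq_nth _ (fun x y => T y <= T x) tr _ 0 G.
  move=> /(_ (fun x => lexx _)); apply => //; rewrite ?inE//; last exact: leq_ltn_trans jn.
  by apply: sort_sorted => x y; exact: le_total.
(* weak type (1,1): the l-th largest value is at most 4m/(l+1) *)
have tail l : (l < n)%N -> T (nth 0 G l) * l.+1%:R <= 4 * m%:R.
  move=> ln; have := @half_kernel_weak_abs R E (take l.+1 G) (T (nth 0 G l)) uE.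
  rewrite take_uniq// => /(_ isT (normr_ge0 _)).
  rewrite size_takel//; apply => x xt.
  have /= := nthP 0 xt; rewrite size_takel// => -[i il <-].
  by rewrite nth_take//; apply: sG; rewrite ln andbT.
apply: le_trans (ler_wpM2l _ (hilbert_sum_ge m n)); last by lra.
rewrite (big_nth 0) big_mkord -/n.
rewrite -(subnKC mn) !big_split_ord/= mulrDr; apply: lerD.
  apply: (@le_trans _ _ (13 * m%:R)).
    have L2 := half_kernel_L2 R uE (take_uniq m uG).
    apply: (@le_trans _ _ (\sum_(i < m) (1 + T (nth 0 G i) ^+ 2))).
      apply: ler_sum => i _; rewrite -/(T _).
      by have := sqr_ge0 (T (nth 0 G i) - 1); have := normr_ge0 (\sum_(y <- E) hk (nth 0 G i - y)); rewrite -/(T _) sqrrB; nra.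
    rewrite big_split/= sumr_const card_ord.
    have : \sum_(i < m) T (nth 0 G i) ^+ 2 <= 12 * m%:R.
      apply: le_trans L2; rewrite (big_nth 0) big_mkord size_takel//.
      apply: ler_sum => i _; rewrite nth_take//= /T real_normK ?num_real//.
    by lra.
  apply: (@le_trans _ _ (\sum_(i < m) (13 : R))).
    by rewrite sumr_const card_ord mulr_natr.
  rewrite mulr_sumr; apply: ler_sum => i _; have := ltn_ord i => im.
  rewrite mulrA ler_pdivlMr ?ltr0n; last lia.
  rewrite -[X in X * _ <= _]/(13%:R) -[26]/(26%:R) -!natrM ler_nat; lia.
rewrite mulr_sumr; apply: ler_sum => l _ /=.
have lt_ : (m + l < n)%N by have := ltn_ord l; lia.
have := tail _ lt_; rewrite -/(T _) -ler_pdivlMr ?ltr0n// => /le_trans; apply.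
rewrite -[26]/(26%:R) -[4]/(4%:R) mulrA -!natrM ler_pdivrMr ?ltr0n; last lia.
rewrite mulrAC ler_pdivlMr ?ltr0n; last lia.
by rewrite -!natrM ler_nat; nia.
Qed.

(** The absolute values may be summed over the larger of the two sets; oddness about
[1/2] exchanges their roles. *)
Lemma half_kernel_hilbert_bounded : hilbert_bounded (fun x y => hk (x - y)) 26.
Proof.
move=> E F uE uF; have [mn|/ltnW nm] := leqP (size E) (size F).
  apply: le_trans (half_kernel_sum_abs uE uF mn).
  exact: ler_norm_sum.
pose F' := [seq x - 1 | x <- F].
have uF' : uniq F' by rewrite map_inj_uniq//; exact: addIr.
have -> : \sum_(x <- F) \sum_(y <- E) hk (x - y) =
    - \sum_(y <- E) \sum_(x <- F') hk (y - x).
  rewrite exchange_big/= -sumrN; apply: eq_bigr => y _.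
  rewrite big_map -sumrN; apply: eq_bigr => x _.
  by rewrite -half_kernelC; congr half_kernel; lia.
have sF' : size F' = size F by rewrite size_map.
rewrite normrN hilbert_sumC -sF'.
apply: le_trans (half_kernel_sum_abs uF' uE _); last by rewrite sF'.
exact: ler_norm_sum.
Qed.

Lemma hilbert_bounded_le k k' C C' w : (forall x y, `|k x y - k' x y| <= w x y) ->
  hilbert_bounded k' C -> hilbert_bounded w C' -> hilbert_bounded k (C + C').
Proof.
move=> kw hk' hw E F uE uF; rewrite mulrDl.
have := hk' E F uE uF; have := hw E F uE uF.
set a := \sum_(x <- F) _; set b := \sum_(x <- F) _; move=> ha hb.
set c := \sum_(x <- F) _; have : `|c - b| <= a.
  rewrite -sumrB; apply: le_trans (ler_norm_sum _ _ _) _; apply: ler_sum => x _.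
  rewrite -sumrB; apply: le_trans (ler_norm_sum _ _ _) _; apply: ler_sum => y _.
  exact: kw.
move=> hc; have -> : c = b + (c - b) by lra.
apply: le_trans (ler_normD _ _) _; apply: lerD => //.
exact: le_trans hc (le_trans (ler_norm _) ha).
Qed.

End HilbertBounded.

(** * Unit intervals and counting measure *)

Section Cells.
Context (R : realType).
Local Open Scope ereal_scope.
Local Notation mu := (@lebesgue_measure R).
Local Notation cell := (Num.ceil : measurableTypeR R -> int).

Lemma cellE (n : int) : cell @^-1` [set n] = `](n - 1)%:~R, n%:~R]%classic.
Proof.
apply/seteqP; split=> x; rewrite /= in_itv/=.
  by move=> <-; exact: ceil_itv.
by move=> h; apply/eqP; rewrite ceil_eq.
Qed.

Lemma preimage_cell (A : set int) : cell @^-1` A = \bigcup_(n in A) cell @^-1` [set n].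
Proof. by apply/seteqP; split=> [x Ax|x [n An /= xn]]; [exists (cell x)|rewrite /= xn]. Qed.

Lemma measurable_cell : measurable_fun [set: measurableTypeR R] cell.
Proof.
move=> _ A _; rewrite setTI preimage_cell bigcup_mkcond.
apply: countable_bigcupT_measurable => // n; case: ifPn => // _.
by rewrite cellE; exact: measurable_itv.
Qed.

Lemma measurable_preimage_cell (A : set int) : measurable (cell @^-1` A : set (measurableTypeR R)).
Proof. by rewrite -[X in measurable X]setTI; exact: measurable_cell. Qed.

Lemma measurable_comp_cell d (T : sigmaRingType d) (f : int -> T) :
  measurable_fun [set: measurableTypeR R] (f \o cell).
Proof. by move=> _ B _; rewrite setTI; exact: (measurable_preimage_cell (f @^-1` B)). Qed.

Lemma mu_cell n : mu (cell @^-1` [set n]) = 1.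
Proof.
rewrite cellE lebesgue_measure_itv/= lte_fin ltr_int ltrBlDr ltrDl ltr01 -EFinD.
by rewrite -rmorphB/= opprB addrCA subrr addr0.
Qed.

Lemma mu_preimage_fset (A : {fset int}) : mu (cell @^-1` [set` A]) = ((#|` A |)%:R)%:E.
Proof.
rewrite preimage_cell measure_fin_bigcup//.
- rewrite -fsbig_seq// (eq_bigr (fun=> 1)); last by move=> n _; exact: mu_cell.
  by rewrite sumEFin big_const_seq count_predT iter_addr_0.
- by move=> i j _ _ [x []] /= <-.
- by move=> n _; exact: measurable_preimage_cell.
Qed.

(** The map [cell] transports Lebesgue measure to counting measure, so that [a] and [a
\o cell] have the same distribution. An infinite set of integers is compared with
its finite subsets. *)
Lemma mu_preimage_cell (A : set int) : mu (cell @^-1` A) = Zcount R A.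
Proof.
rewrite /Zcount/= /counting; case: ifPn => /asboolP finA.
  by rewrite -[in LHS](fset_setK finA) mu_preimage_fset.
apply/eqP; rewrite -leye_eq leNgt; apply/negP => h.
have [r muE] : exists r : R, mu (cell @^-1` A) = r%:E.
  exists (fine (mu (cell @^-1` A))); rewrite fineK// ge0_fin_numE//.
have r0 : (0 <= r)%R by rewrite -lee_fin -muE.
have [B BA Bn] := infinite_set_fset (Num.truncn r).+1 finA.
have mB (D : set int) : (cell @^-1` D : set (measurableTypeR R)) \in measurable.
  by apply: mem_set; exact: measurable_preimage_cell.
have : mu (cell @^-1` [set` B]) <= mu (cell @^-1` A).
  by apply: le_measure => [||x /BA]; [exact: mB..|].
rewrite mu_preimage_fset muE lee_fin leNgt => /negP; apply.
by apply: (lt_le_trans (truncnS_gt r)); rewrite ler_nat.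
Qed.

Lemma ge0_integral_Zcount (f : int -> \bar R) : (forall n, 0 <= f n) ->
  \int[Zcount R]_n f n = \int[mu]_x f (cell x).
Proof.
move=> f0; transitivity (\int[pushforward mu cell]_n f n).
  have mc := measurable_cell.
  by apply: eq_measure_integral => //= A _ _; exact/esym/mu_preimage_cell.
by rewrite (ge0_integral_pushforward measurable_cell).
Qed.

Lemma integrable_Zcount (f : int -> \bar R) :
  (Zcount R).-integrable setT f <-> mu.-integrable setT (f \o cell).
Proof.
have E : \int[Zcount R]_n `|f n| = \int[mu]_x `|(f \o cell) x|.
  by rewrite (@ge0_integral_Zcount (fun n => `|f n|)).
split=> /integrableP[_ h]; apply/integrableP; split.
- exact: measurable_comp_cell.
- by rewrite -E.
- by move=> _ A _; rewrite setTI.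
- by rewrite E.
Qed.

Lemma integral_Zcount (f : int -> \bar R) : \int[Zcount R]_n f n = \int[mu]_x f (cell x).
Proof.
rewrite integralE [RHS]integralE; congr (_ - _).
  rewrite ge0_integral_Zcount; last by move=> n; exact: funepos_ge0.
  by apply: eq_integral => x _; rewrite !funeposE.
rewrite ge0_integral_Zcount; last by move=> n; exact: funeneg_ge0.
by apply: eq_integral => x _; rewrite !funenegE.
Qed.

Lemma Rintegral_Zcount (f : int -> R) :
  (\int[Zcount R]_n f n = \int[mu]_x f (cell x))%R.
Proof. by rewrite /Rintegral integral_Zcount. Qed.

End Cells.

(** * Scalars, finitely supported sequences and equimeasurability *)

Section ComplexAbs.
Context (R : realType).
Implicit Types (z : R[i]) (x : R).

Lemma cabs_real x : cabs (x%:C)%C = `|x|.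
Proof. by rewrite /cabs /= expr0n/= addr0 sqrtr_sqr. Qed.

Lemma normRe_le_cabs z : `|complex.Re z| <= cabs z.
Proof.
case: z => a b; rewrite /cabs/= -sqrtr_sqr ler_sqrt ?addr_ge0 ?sqr_ge0//.
by rewrite lerDl sqr_ge0.
Qed.

Lemma normIm_le_cabs z : `|complex.Im z| <= cabs z.
Proof.
case: z => a b; rewrite /cabs/= -sqrtr_sqr ler_sqrt ?addr_ge0 ?sqr_ge0//.
by rewrite lerDr sqr_ge0.
Qed.

Lemma cabs_le z : cabs z <= `|complex.Re z| + `|complex.Im z|.
Proof.
case: z => a b; rewrite /cabs/= -[leRHS]ger0_norm ?addr_ge0// -sqrtr_sqr.
rewrite ler_sqrt ?sqr_ge0// sqrrD !real_normK ?num_real//.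
by rewrite -addrA lerD2l lerDr mulrn_wge0// mulr_ge0.
Qed.

Lemma cabs_ge0 z : 0 <= cabs z.
Proof. exact: le_trans (normRe_le_cabs z). Qed.

End ComplexAbs.

Section Place.
Context (R : realType).
Implicit Types (s : seq int) (v : seq R).

(** The sequence with value [nth 0 v i] at the [i]-th integer of [s]. Elsewhere
[index] is [size s], past the end of [v], and the default value 0 is returned. *)
Definition place s v (k : int) : R := nth 0 v (index k s).

Lemma place_ge0 s v : all (fun x => 0 <= x) v -> forall k, 0 <= place s v k.
Proof.
move=> /allP v0 k; rewrite /place; have [h|h] := ltnP (index k s) (size v).
  by apply: v0; exact: mem_nth.
by rewrite nth_default.
Qed.

Lemma place_notin s v k : size v = size s -> k \notin s -> place s v k = 0.
Proof. by move=> sv ks; rewrite /place nth_default// memNindex// sv. Qed.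

Lemma place_nth s v i : uniq s -> (i < size s)%N -> place s v (nth 0 s i) = nth 0 v i.
Proof. by move=> us si; rewrite /place index_uniq. Qed.

Lemma map_place s v : uniq s -> size v = size s -> map (place s v) s = v.
Proof.
move=> us sv; apply: (@eq_from_nth _ 0); rewrite size_map// => i si.
by rewrite (nth_map 0)// place_nth.
Qed.

Lemma place_map s (a : int -> R) : forall k, k \in s -> place s (map a s) k = a k.
Proof. by move=> k ks; rewrite /place (nth_map 0) ?index_mem// nth_index. Qed.

Lemma Zcount_seq s : uniq s -> Zcount R [set` s] = ((size s)%:R)%:E.
Proof.
move=> us; rewrite /Zcount/= /counting asboolT; last exact: finite_seq.
have -> : [set` s] = [set` [fset x in s]%fset].
  by apply/seteqP; split=> x /=; rewrite inE.
by rewrite set_fsetK card_fseq undup_id.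
Qed.

Lemma Zcount_place s v (t : R) : uniq s -> size v = size s -> 0 <= t ->
  Zcount R [set k | t < place s v k] = ((count (> t) v)%:R)%:E.
Proof.
move=> us sv t0.
have -> : [set k | t < place s v k] = [set` [seq k <- s | t < place s v k]].
  apply/seteqP; split=> k /=; rewrite mem_filter; last by case/andP.
  move=> tk; rewrite tk/=; apply: contraTT tk => ks.
  by rewrite place_notin// -leNgt.
rewrite Zcount_seq ?filter_uniq// size_filter -[in RHS](map_place us sv) count_map.
by [].
Qed.

Lemma ge0_integral_Zcount_seq s (f : int -> \bar R) : uniq s ->
  (forall k, 0 <= f k)%E -> (forall k, k \notin s -> f k = 0)%E ->
  (\int[Zcount R]_k f k = \sum_(k <- s) f k)%E.
Proof.
move=> us f0 fs.
pose D := \big[setU/set0]_(k <- s) [set k].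
have DE : D = [set` s].
  rewrite /D -bigcup_seq; apply/seteqP; split=> [x [k ks ->]//|x xs]; by exists x.
transitivity (\int[Zcount R]_(k in D) f k)%E.
  rewrite [RHS]integral_mkcond; apply: eq_integral => k _.
  rewrite patchE DE; case: ifPn => // /negP ks; rewrite fs//.
  by apply/negP => h; apply: ks; exact: mem_set.
rewrite ge0_integral_bigsetU//.
- apply: eq_bigr => k _.
  rewrite (eq_integral (cst (f k))); last by move=> x /set_mem ->.
  rewrite integral_cst//; have := @Zcount_seq [:: k] isT.
  have -> : [set` [:: k]] = [set k] by apply/seteqP; split=> x /=; rewrite inE => /eqP.
  by move=> /= ->; rewrite mule1.
- by move=> i j _ _ [x [/= -> ->]].
Qed.

End Place.

Section Norm.
Context (R : realType) (K : scalars) (rho : (R -> R) -> \bar R).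
Hypothesis X_ri : rearrangement_invariant (@lebesgue_measure R) K rho.
Local Notation mu := (@lebesgue_measure R).
Local Notation cell := (Num.ceil : measurableTypeR R -> int).
Local Notation Mp := (@Mplus _ (measurableTypeR R) R).
Implicit Types (f g : R -> R) (a b : int -> R).

Lemma Mplus_cell a : (forall n, 0 <= a n) -> Mp (a \o cell).
Proof. by move=> a0; split => [|x]; [exact: measurable_comp_cell|exact: a0]. Qed.

Lemma Mplus_abs f : measurable_fun [set: measurableTypeR R] f -> Mp (fun x => `|f x|).
Proof. by move=> mf; split => [|x]; [exact: measurableT_comp|]. Qed.

Lemma bfs_normE f : Mp f ->
  @bfs_norm _ (measurableTypeR R) R rho (fun x => (f x)%:C)%C = rho f.
Proof.
by move=> [_ f0]; congr rho; apply/funext => x; rewrite cabs_real ger0_norm.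
Qed.

Lemma Mfun_real f : measurable_fun [set: measurableTypeR R] f ->
  @Mfun _ (measurableTypeR R) R K (fun x => (f x)%:C)%C.
Proof. by move=> mf; split. Qed.

Lemma bfs_real f : Mp f -> (rho f < +oo)%E ->
  @bfs _ (measurableTypeR R) R K rho (fun x => (f x)%:C)%C.
Proof. by move=> mf h; split; [apply: Mfun_real; case: mf|rewrite bfs_normE]. Qed.

(** Invariance is given for functions of finite norm; if one of the two norms is
infinite, then the other one cannot be finite. *)
Lemma rho_equimeasurable f g : Mp f -> Mp g ->
  (forall s : R, 0 < s -> mu [set x | s < f x] = mu [set x | s < g x]) ->
  rho f = rho g.
Proof.
wlog fin : f g / (rho f < +oo)%E.
  move=> wl mf mg h; have [rf|rf] := ltP (rho f) +oo%E; first exact: wl.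
  have [rg|rg] := ltP (rho g) +oo%E.
    by apply/esym/wl => // s s0; rewrite h.
  by move: rf rg; rewrite !leye_eq => /eqP -> /eqP ->.
move=> mf mg h.
have [|||] := X_ri.2 (fun x => (f x)%:C)%C (fun x => (g x)%:C)%C.
- exact: bfs_real.
- by apply: Mfun_real; case: mg.
- move=> t t0; rewrite /decreasing_rearrangement; congr (ereal_inf (_ @` _)).
  have E k s : Mp k -> [set x | s < cabs (k x)%:C%C] = [set x | s < k x].
    by move=> [_ k0]; apply/seteqP; split=> x; rewrite /mkset cabs_real ger0_norm.
  by apply/seteqP; split=> s /= [s0]; rewrite !E// h.
- by move=> _; rewrite !bfs_normE.
Qed.

End Norm.

(** * Step functions and elementary properties of the norm *)

Section StepFunctions.
Context (R : realType).
Local Notation mu := (@lebesgue_measure R).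
Local Notation cell := (Num.ceil : measurableTypeR R -> int).
Local Notation Mp := (@Mplus _ (measurableTypeR R) R).
Implicit Types (a : int -> R).

Definition integers : set (measurableTypeR R) := range (fun n : int => n%:~R).

Lemma countable_integers : countable integers.
Proof. by apply: (card_le_trans (card_image_le _ _)); exact: countableP. Qed.

Lemma negligible_integers : mu.-negligible integers.
Proof.
apply/negligibleP; last exact: countable_lebesgue_measure0 countable_integers.
exact: countable_measurable countable_integers.
Qed.

(** The open intervals leave out the integers, so [step_function a] is [a \o cell] off
a null set. *)
Lemma step_functionE a (x : R) : step_function a x = a (cell x) * \1_(~` integers) x.
Proof.
transitivity (\sum_(n \in [set cell x]) a n * \1_(`](n - 1)%:~R, n%:~R[%classic : set R) x).
  apply/esym/fsbig_widen => // n [_ /= nx].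
  rewrite indicE; case: (boolP (x \in _)) => [|_]; last by rewrite mulr0.
  move=> /set_mem/=; rewrite in_itv/= => /andP[h1 h2]; case: nx; apply/esym/eqP.
  by rewrite ceil_eq h1 ltW.
rewrite fsbig_set1; congr (_ * _); rewrite !indicE; congr ((nat_of_bool _)%:R).
have /andP[h1 h2] := ceil_itv x.
apply/idP/idP => /set_mem h; apply: mem_set.
  move: h; rewrite /= in_itv/= => /andP[_ h] [n _ nx].
  by move: h; rewrite -nx intrKceil ltxx.
rewrite /= in_itv/= h1 lt_neqAle h2 andbT; apply/eqP => e; apply: h.
by exists (cell x).
Qed.

Lemma measurable_step_function a : measurable_fun [set: measurableTypeR R] (step_function a).
Proof.
have -> : step_function a = (fun x => (a \o cell) x * \1_(~` integers) x).
  by apply/funext => x; rewrite step_functionE.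
apply: measurable_funM; first exact: measurable_comp_cell.
apply: measurable_indic; apply: measurableC.
exact: countable_measurable countable_integers.
Qed.

Lemma Mplus_step_function a : (forall n, 0 <= a n) -> Mp (step_function a).
Proof.
move=> a0; split; first exact: measurable_step_function.
by move=> x; rewrite step_functionE mulr_ge0.
Qed.

Lemma step_function_ae a : {ae mu, forall x, step_function a x = a (cell x)}.
Proof.
apply: (negligibleS _ negligible_integers) => x /= h; apply: contrapT => nx; apply: h.
by rewrite step_functionE indicE mem_set// mulr1.
Qed.

End StepFunctions.

Section NormTheory.
Context (R : realType) (K : scalars) (rho : (R -> R) -> \bar R).
Hypothesis X_ri : rearrangement_invariant (@lebesgue_measure R) K rho.
Local Notation mu := (@lebesgue_measure R).
Local Notation cell := (Num.ceil : measurableTypeR R -> int).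
Local Notation Mp := (@Mplus _ (measurableTypeR R) R).
Implicit Types (f g : R -> R) (a b : int -> R).

Lemma rho_ge0 f : Mp f -> (0 <= rho f)%E.
Proof. exact: bfn_ge0 X_ri.1 f. Qed.

Lemma rho_mono_ae f g : Mp f -> Mp g -> {ae mu, forall x, f x <= g x} ->
  (rho f <= rho g)%E.
Proof. exact: (bfn_mono X_ri.1). Qed.

Lemma rho_mono f g : Mp f -> Mp g -> (forall x, f x <= g x) -> (rho f <= rho g)%E.
Proof. by move=> mf mg fg; apply: rho_mono_ae => //; exact: nearW. Qed.

Lemma Mplus0 : Mp (fun=> 0).
Proof. by split => //; exact: measurable_cst. Qed.

Lemma rho0 : rho (fun=> 0) = 0%E.
Proof. by apply/(bfn_eq0 X_ri.1 Mplus0); exact: nearW. Qed.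

Lemma MplusD f g : Mp f -> Mp g -> Mp (fun x => f x + g x).
Proof.
by move=> [mf f0] [mg g0]; split => [|x]; [exact: measurable_funD|exact: addr_ge0].
Qed.

Lemma MplusZ (c : R) f : 0 <= c -> Mp f -> Mp (fun x => c * f x).
Proof.
by move=> c0 [mf f0]; split => [|x]; [exact: measurable_funM|exact: mulr_ge0].
Qed.

Lemma rhoD f g : Mp f -> Mp g -> (rho (fun x => f x + g x)%R <= rho f + rho g)%E.
Proof. exact: (bfn_triangle X_ri.1). Qed.

Lemma rhoZ (c : R) f : 0 <= c -> Mp f -> rho (fun x => c * f x) = (c%:E * rho f)%E.
Proof. by move=> c0 mf; apply: (bfn_homo X_ri.1). Qed.

Lemma rhoD_le f g s t : Mp f -> Mp g -> (rho f <= s%:E)%E -> (rho g <= t%:E)%E ->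
  (rho (fun x => f x + g x)%R <= (s + t)%:E)%E.
Proof.
by move=> mf mg fs gt; apply: le_trans (rhoD mf mg) _; rewrite EFinD leeD.
Qed.

Lemma rhoZ_le (c : R) f s : 0 <= c -> Mp f -> (rho f <= s%:E)%E ->
  (rho (fun x => c * f x)%R <= (c * s)%:E)%E.
Proof. by move=> c0 mf fs; rewrite rhoZ// EFinM lee_wpmul2l. Qed.

Lemma Mplus_sum (I : Type) (s : seq I) (F : I -> R -> R) : (forall i, Mp (F i)) ->
  Mp (fun x => \sum_(i <- s) F i x).
Proof.
move=> mF; split; first by apply: measurable_sum => i; case: (mF i).
by move=> x; apply: sumr_ge0 => i _; case: (mF i).
Qed.

Lemma rho_sum_le (I : Type) (s : seq I) (F : I -> R -> R) (c : I -> R) :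
  (forall i, Mp (F i)) -> (forall i, rho (F i) <= (c i)%:E)%E ->
  (rho (fun x => \sum_(i <- s) F i x)%R <= (\sum_(i <- s) c i)%:E)%E.
Proof.
move=> mF Fc; elim: s => [|i s IH].
  rewrite big_nil; under [X in rho X]eq_fun do rewrite big_nil.
  by rewrite rho0.
rewrite big_cons; under [X in rho X]eq_fun do rewrite big_cons.
by apply: rhoD_le => //; exact: Mplus_sum.
Qed.

Lemma rho_limit (F : nat -> R -> R) f c : (forall n, Mp (F n)) -> Mp f ->
  (forall x, nondecreasing_seq (fun n => F n x)) ->
  (forall x, F n x @[n --> \oo] --> f x) ->
  (forall n, rho (F n) <= c)%E -> (rho f <= c)%E.
Proof.
move=> mF mf nd cv Fc.
have [|_ cvr] := bfn_fatou X_ri.1 mF mf; first by apply: nearW => x; split.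
rewrite -(cvg_lim _ cvr)//; apply: lime_le; first by apply/cvg_ex; exists (rho f).
exact: nearW.
Qed.

Lemma lebesgue_measure_shift (t : R) (A : set R) : measurable (A : set (measurableTypeR R)) ->
  mu [set x | A (x + t)] = mu A.
Proof.
move=> mA; have mt : measurable_fun [set: measurableTypeR R] (fun x : measurableTypeR R => (x + t : measurableTypeR R)).
  exact: measurable_funD.
apply/esym; rewrite -[RHS]/(pushforward mu (fun x : measurableTypeR R => (x + t : measurableTypeR R)) A).
apply: lebesgue_measure_unique => //= _ [[a b]] _ <-.
rewrite /pushforward (_ : _ @^-1` _ = `](a - t), (b - t)]%classic).
  by rewrite !lebesgue_measure_itv/= !lte_fin ltrD2r; case: ifPn => // _; congr (_%:E); lra.
by apply/seteqP; split=> x /=; rewrite !in_itv/= ltrBlDr lerBrDr.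
Qed.

Lemma Mplus_shift (t : R) f : Mp f -> Mp (fun x => f (x + t)).
Proof.
move=> [mf f0]; split => // ; apply: (measurableT_comp mf).
exact: measurable_funD.
Qed.

Lemma rho_shift (t : R) f : Mp f -> rho (fun x => f (x + t)) = rho f.
Proof.
move=> mf; apply: (rho_equimeasurable X_ri) => //; first exact: Mplus_shift.
move=> s s0; apply: (lebesgue_measure_shift t (A := [set x | s < f x])).
have -> : [set x | s < f x] = f @^-1` `]s, +oo[%classic.
  by apply/seteqP; split=> x /=; rewrite in_itv/= andbT.
by rewrite -[X in measurable X]setTI; apply: mf.1 => //; exact: measurable_itv.
Qed.

Lemma discretized_normE a : (forall n, 0 <= a n) ->
  discretized_norm rho a = rho (a \o cell).
Proof.
move=> a0; apply/eqP; rewrite eq_le; apply/andP; split; apply: rho_mono_ae.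
- exact: Mplus_step_function.
- exact: Mplus_cell.
- by apply: (negligibleS _ (step_function_ae a)) => x /=; apply: contra_not => ->.
- exact: Mplus_cell.
- exact: Mplus_step_function.
- by apply: (negligibleS _ (step_function_ae a)) => x /=; apply: contra_not => ->.
Qed.

End NormTheory.

(** * Norms of sequences and their associates *)

Section SequenceNorms.
Context (R : realType).
Implicit Types (tau : (int -> R) -> \bar R) (a b g : int -> R).
Local Open Scope ereal_scope.

(** The properties that the norm of the discretized space and its associate have in
common. The last one is rearrangement invariance for finitely supported sequences. *)
Record seq_norm tau : Prop := SeqNorm {
  sn_ge0 : forall a, (forall n, 0 <= a n)%R -> 0 <= tau a ;
  sn_mono : forall a b, (forall n, 0 <= a n)%R -> (forall n, a n <= b n)%R ->
    tau a <= tau b ;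
  sn_add : forall a b, (forall n, 0 <= a n)%R -> (forall n, 0 <= b n)%R ->
    tau (fun n => a n + b n)%R <= tau a + tau b ;
  sn_scale : forall (c : R) a, (0 <= c)%R -> (forall n, 0 <= a n)%R ->
    tau (fun n => c * a n)%R <= c%:E * tau a ;
  sn_place : forall s s' v, uniq s -> uniq s' -> size v = size s ->
    size s' = size s -> all (fun x => 0 <= x)%R v ->
    tau (place s v) = tau (place s' v)
}.

Lemma measurable_int_fun d (T : sigmaRingType d) (f : int -> T) : measurable_fun [set: int] f.
Proof. by []. Qed.

Lemma le_integral_Zcount (f h : int -> R) : (forall n, 0 <= f n)%R ->
  (forall n, f n <= h n)%R ->
  \int[Zcount R]_n (f n)%:E <= \int[Zcount R]_n (h n)%:E.
Proof.
move=> f0 fh; apply: ge0_le_integral => //.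
- by move=> n _; rewrite lee_fin.
- by move=> n _; rewrite lee_fin.
Qed.

Lemma integral_Zcount_window (f : int -> R) c : (forall n, 0 <= f n)%R ->
  (forall N, \sum_(k <- int_window N) f k <= c)%R ->
  \int[Zcount R]_n (f n)%:E <= c%:E.
Proof.
move=> f0 fc; pose F N n := (f n * (n \in int_window N)%:R)%:E.
have F0 N n : 0 <= F N n by rewrite lee_fin mulr_ge0.
have nd n : nondecreasing_seq (F^~ n).
  move=> N M NM; rewrite lee_fin ler_wpM2l// ler_nat !mem_int_window.
  by case: andP => // h; rewrite lt0b; apply/andP; lia.
have cv n : F N n @[N --> \oo] --> (f n)%:E.
  apply: cvg_near_cst; exists `|n|.+1%N => // N /= hN; rewrite /F mem_int_window.
  by rewrite (_ : _ && _) ?mulr1//; lia.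
rewrite (eq_integral (fun n => limn (F^~ n))); last first.
  by move=> n _; apply/esym/cvg_lim.
have cvI := @cvg_monotone_convergence _ _ _ (Zcount R) setT measurableT F
  (fun N => @measurable_int_fun _ _ (F N)) (fun N n _ => F0 N n) (fun n _ => @nd n).
rewrite -(cvg_lim _ cvI)//; apply: lime_le; first exact: (cvgP _ cvI).
apply: nearW => N; rewrite (@ge0_integral_Zcount_seq _ (int_window N))//.
- rewrite big_seq (eq_bigr (fun k => (f k)%:E)); last by move=> k kN; rewrite /F kN mulr1.
  by rewrite -big_seq sumEFin lee_fin.
- exact: int_window_uniq.
- by move=> k /negbTE kN; rewrite /F kN mulr0.
Qed.

Section Associate.
Variable tau : (int -> R) -> \bar R.
Local Notation tau' := (associate_norm (Zcount R) tau).

Lemma associate_norm_ub b g : (forall n, 0 <= g n)%R -> tau g <= 1 ->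
  \int[Zcount R]_n (b n * g n)%:E <= tau' b.
Proof. by move=> g0 tg; apply: ereal_sup_ubound; exists g. Qed.

Lemma associate_norm_lub b c :
  (forall g, (forall n, 0 <= g n)%R -> tau g <= 1 ->
    \int[Zcount R]_n (b n * g n)%:E <= c) -> tau' b <= c.
Proof. by move=> h; apply: ge_ereal_sup => _ [g [[_ g0] tg] <-]; exact: h. Qed.

Lemma associate_norm_le b (c : R) : (forall n, 0 <= b n)%R ->
  (forall g, (forall n, 0 <= g n)%R -> tau g <= 1 ->
    forall N, (\sum_(k <- int_window N) b k * g k <= c)%R) -> tau' b <= c%:E.
Proof.
move=> b0 h; apply: associate_norm_lub => g g0 tg.
by apply: integral_Zcount_window => [n|]; [exact: mulr_ge0|exact: h].
Qed.

Hypothesis tau_norm : seq_norm tau.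

Lemma seq_norm0 : tau (fun=> 0%R) = 0.
Proof.
apply/eqP; rewrite eq_le (sn_ge0 tau_norm)// andbT.
have := @sn_scale _ tau_norm 0%R (fun=> 0%R) (lexx _) (fun=> lexx _).
by rewrite mul0e; under [X in tau X]eq_fun do rewrite mul0r.
Qed.

(** The restriction of [a] to [s], divided by [x], competes in the supremum defining
the associate norm. *)
Lemma associate_hoelder a b (x y : R) s : (forall n, 0 <= a n)%R ->
  (forall n, 0 <= b n)%R -> uniq s -> (0 < x)%R ->
  tau a <= x%:E -> tau' b <= y%:E -> (\sum_(k <- s) a k * b k <= x * y)%R.
Proof.
move=> a0 b0 us x0 ax bY.
pose g k := (x^-1 * (a k * (k \in s)%:R))%R.
have xi : (0 <= x^-1)%R by rewrite invr_ge0 ltW.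
have g0' n : (0 <= a n * (n \in s)%:R)%R by rewrite mulr_ge0.
have g0 n : (0 <= g n)%R by rewrite mulr_ge0.
have g1 : tau g <= 1.
  apply: le_trans (sn_scale tau_norm xi g0') _.
  apply: (@le_trans _ _ (x^-1%:E * x%:E)); last by rewrite -EFinM mulVf ?gt_eqF.
  rewrite lee_wpmul2l//; apply: le_trans ax; apply: (sn_mono tau_norm) => // n.
  by case: (n \in s); rewrite ?mulr1// mulr0.
have := le_trans (associate_norm_ub b g0 g1) bY.
rewrite (@ge0_integral_Zcount_seq _ s)//; last 2 first.
- by move=> k; rewrite lee_fin mulr_ge0.
- by move=> k /negbTE ks; rewrite /g ks !mulr0.
rewrite sumEFin lee_fin -ler_pdivrMl// mulr_sumr => h.
apply: le_trans h.
rewrite big_seq [leRHS]big_seq; apply: ler_sum => k ks.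
by rewrite /g ks mulr1 le_eqVlt; apply/orP; left; apply/eqP; ring.
Qed.

Lemma sum_place s v (f : int -> R) : uniq s -> size v = size s ->
  (\sum_(k <- s) place s v k * f k = \sum_(i < size s) nth 0 v i * f (nth 0 s i))%R.
Proof.
move=> us sv; rewrite (big_nth 0%R) big_mkord; apply: eq_bigr => i _.
by rewrite place_nth.
Qed.

Lemma integral_place s v g : uniq s -> size v = size s -> all (fun x => 0 <= x)%R v ->
  (forall n, 0 <= g n)%R ->
  \int[Zcount R]_n (place s v n * g n)%:E =
  (\sum_(i < size s) nth 0 v i * g (nth 0 s i))%:E.
Proof.
move=> us sv v0 g0; rewrite (@ge0_integral_Zcount_seq _ s)//.
- by rewrite sumEFin sum_place.
- by move=> k; rewrite lee_fin mulr_ge0// place_ge0.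
- by move=> k ks; rewrite place_notin// mul0r.
Qed.

(** A competitor for the positions [s] becomes one for the positions [s'] by moving
its values. *)
Lemma associate_place_le s s' v : uniq s -> uniq s' -> size v = size s ->
  size s' = size s -> all (fun x => 0 <= x)%R v ->
  tau' (place s v) <= tau' (place s' v).
Proof.
move=> us us' sv ss v0; apply: associate_norm_lub => g g0 tg.
have mg0 : all (fun x => 0 <= x)%R (map g s) by apply/allP => _ /mapP[k _ ->].
pose h := place s' (map g s).
have h0 n : (0 <= h n)%R by exact: place_ge0.
have th : tau h <= 1.
  apply: le_trans tg; rewrite /h -(sn_place tau_norm us us')// ?size_map//.
  apply: (sn_mono tau_norm) => n; first exact: place_ge0.
  have [ns|ns] := boolP (n \in s); first by rewrite place_map.
  by rewrite place_notin// size_map.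
have := associate_norm_ub (place s' v) h0 th.
rewrite !integral_place ?ss// => /(le_trans _); apply.
rewrite lee_fin le_eqVlt; apply/orP; left; apply/eqP.
apply: eq_bigr => i _; congr (_ * _)%R.
by rewrite /h place_nth ?ss// (nth_map 0)%R.
Qed.

Lemma associate_seq_norm : seq_norm tau'.
Proof.
have mulg0 a g : (forall n, 0 <= a n)%R -> (forall n, 0 <= g n)%R ->
  forall n, 0 <= (a n * g n)%:E by move=> a0 g0 n; rewrite lee_fin mulr_ge0.
split.
- move=> a a0; apply: le_trans (associate_norm_ub a (fun=> lexx 0%R) _).
    by apply: integral_ge0 => n _; rewrite mulr0.
  by rewrite seq_norm0.
- move=> a b a0 ab; apply: associate_norm_lub => g g0 tg.
  apply: le_trans (associate_norm_ub b g0 tg).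
  by apply: le_integral_Zcount => n; [exact: mulr_ge0|exact: ler_wpM2r].
- move=> a b a0 b0; apply: associate_norm_lub => g g0 tg.
  under eq_integral do rewrite mulrDl EFinD.
  rewrite ge0_integralD//; try by move=> n _; exact: mulg0.
  by apply: leeD; exact: associate_norm_ub.
- move=> c a c0 a0; apply: associate_norm_lub => g g0 tg.
  under eq_integral do rewrite -mulrA EFinM.
  rewrite ge0_integralZl//; last by move=> n _; exact: mulg0.
  by rewrite lee_wpmul2l//; exact: associate_norm_ub.
- move=> s s' v us us' sv ss v0; apply/eqP.
  by rewrite eq_le !associate_place_le// ?ss.
Qed.

End Associate.

End SequenceNorms.

Section DiscretizedNorm.
Context (R : realType) (K : scalars) (rho : (R -> R) -> \bar R).
Hypothesis X_ri : rearrangement_invariant (@lebesgue_measure R) K rho.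
Local Notation cell := (Num.ceil : measurableTypeR R -> int).
Local Open Scope ereal_scope.

Lemma discretized_seq_norm : seq_norm (discretized_norm rho).
Proof.
have E := discretized_normE X_ri.
have M := @Mplus_cell R.
split.
- by move=> a a0; rewrite E//; apply: (rho_ge0 X_ri); exact: M.
- move=> a b a0 ab; have b0 n : (0 <= b n)%R by exact: le_trans (ab n).
  rewrite !E//; apply: (rho_mono X_ri); [exact: M|exact: M|].
  by move=> x; exact: ab.
- move=> a b a0 b0; rewrite !E//; first exact: (rhoD X_ri (M _ a0) (M _ b0)).
  by move=> n; exact: addr_ge0.
- move=> c a c0 a0; rewrite !E//; last by move=> n; exact: mulr_ge0.
  by rewrite -(rhoZ X_ri c0 (M _ a0)).
- move=> s s' v us us' sv ss v0.
  have p0 := place_ge0 _ v0; rewrite !E//.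
  apply: (rho_equimeasurable X_ri); [exact: M|exact: M|] => t t0.
  transitivity (Zcount R [set k | (t < place s v k)%R]).
    exact: (mu_preimage_cell R [set k | (t < place s v k)%R]).
  transitivity (Zcount R [set k | (t < place s' v k)%R]).
    by rewrite !Zcount_place ?(ltW t0)// ss.
  exact/esym/(mu_preimage_cell R [set k | (t < place s' v k)%R]).
Qed.

End DiscretizedNorm.

(** * Dilations and tail sums *)

Section SeqNormSums.
Context (R : realType).
Implicit Types (tau : (int -> R) -> \bar R) (a b : int -> R).

Lemma sn_scale_le tau (c s : R) a : seq_norm tau -> 0 <= c -> (forall n, 0 <= a n) ->
  (tau a <= s%:E)%E -> (tau (fun n => c * a n)%R <= (c * s)%:E)%E.
Proof.
move=> ht c0 a0 h; apply: le_trans (sn_scale ht c0 a0) _.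
by rewrite EFinM lee_wpmul2l.
Qed.

Lemma sn_sum_le tau (I : Type) (s : seq I) (F : I -> int -> R) (c : I -> R) :
  seq_norm tau -> (forall i n, 0 <= F i n) -> (forall i, (tau (F i) <= (c i)%:E)%E) ->
  (tau (fun n => \sum_(i <- s) F i n)%R <= (\sum_(i <- s) c i)%:E)%E.
Proof.
move=> ht F0 Fc; elim: s => [|i s IH].
  under [X in tau X]eq_fun do rewrite big_nil.
  by rewrite big_nil seq_norm0.
under [X in tau X]eq_fun do rewrite big_cons.
rewrite big_cons EFinD; apply: le_trans (sn_add ht _ _) _ => //.
  by move=> n; apply: sumr_ge0.
exact: leeD.
Qed.

End SeqNormSums.

Section Dilation.
Context (R : realType).
Implicit Types (tau : (int -> R) -> \bar R) (a b : int -> R).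

Lemma decreasing_dilation m a : (0 < m)%N -> decreasing_sequences a ->
  decreasing_sequences (dilation m a).
Proof.
move=> m0 [an a0 ad]; split=> [n n0|n|i j i1 ij]; rewrite /dilation.
- by apply: an; nia.
- exact: a0.
- by apply: ad; nia.
Qed.

Lemma decreasing_scale (c : R) a : 0 <= c -> decreasing_sequences a ->
  decreasing_sequences (fun n => c * a n).
Proof.
move=> c0 [an a0 ad]; split=> [n n0|n|i j i1 ij].
- by rewrite an// mulr0.
- exact: mulr_ge0.
- by rewrite ler_wpM2l// ad.
Qed.

(** Stated for an upper bound [s] of the norm rather than for the norm itself, so that
it can be iterated without knowing that norms are finite. *)
Definition dilation_contracts tau (q : nat) (h : R) :=
  forall a s, decreasing_sequences a -> 0 < s -> (tau a <= s%:E)%E ->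
    (tau (dilation q a) <= (h * s)%:E)%E.

Lemma dilation_norm_contracts tau m (h : R) : seq_norm tau ->
  (dilation_norm tau m <= h%:E)%E -> (0 < m)%N -> dilation_contracts tau m h.
Proof.
move=> ht hm m0 a s Da s0 as_.
have si : 0 <= s^-1 by rewrite invr_ge0 ltW.
pose b n := s^-1 * a n; have Db := decreasing_scale si Da.
have b0 : forall n, 0 <= b n by case: Db.
have tb : (tau b <= 1)%E.
  have := sn_scale_le ht si _ as_; rewrite mulVf ?gt_eqF//; apply.
  by case: Da.
have : (tau (dilation m b) <= h%:E)%E.
  by apply: le_trans hm; apply: ereal_sup_ubound; exists b.
have -> : dilation m a = (fun n => s * dilation m b n).
  by apply/funext => n; rewrite /dilation /b mulVKf ?gt_eqF.
by move=> h1; rewrite mulrC; apply: sn_scale_le => //; [exact: ltW|move=> n; exact: b0].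
Qed.

Lemma dilation_norm_ge0 tau m : seq_norm tau -> (0 <= dilation_norm tau m)%E.
Proof.
move=> ht; apply: ereal_sup_ubound; exists (fun=> 0); first split => //.
  by rewrite seq_norm0// lee01.
exact: (seq_norm0 ht).
Qed.

Lemma ln_nat_gt0 m : (2 <= m)%N -> 0 < ln (m%:R : R).
Proof. by move=> m2; rewrite ln_gt0// ltr1n. Qed.

(** If no dilation had norm less than 1, then no term of the supremum would be
positive. *)
Lemma lower_boyd_gt0_contracts tau : seq_norm tau -> (0 < lower_boyd tau)%E ->
  exists q (h : R), [/\ (2 <= q)%N, 0 <= h < 1 & dilation_contracts tau q h].
Proof.
move=> ht l0.
have [m m2 hm] : exists2 m, (2 <= m)%N & (dilation_norm tau m < 1)%E.
  apply: contrapT => /forall2NP h; move: l0; rewrite ltNge => /negP; apply.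
  apply: ge_ereal_sup => _ [m /= m2 <-]; rewrite oppe_le0.
  apply: mule_ge0; last first.
    by rewrite inver gt_eqF ?ln_nat_gt0// lee_fin invr_ge0 ltW// ln_nat_gt0.
  rewrite lne_ge0 leNgt; apply/negP; by case: (h m).
have h0 := dilation_norm_ge0 m ht.
have hfin : dilation_norm tau m \is a fin_num.
  by rewrite ge0_fin_numE// (lt_trans hm) ?ltry.
exists m, (fine (dilation_norm tau m)); split => //.
  by rewrite fine_ge0//= -lte_fin fineK.
by apply: dilation_norm_contracts; rewrite ?fineK//; lia.
Qed.

(** The slack [e] keeps the bounds positive when [h] is 0. *)
Lemma dilation_contracts_iter tau q h i : (0 < q)%N -> 0 <= h ->
  dilation_contracts tau q h ->
  forall a s, decreasing_sequences a -> 0 < s -> (tau a <= s%:E)%E ->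
   forall e, 0 < e -> (tau (dilation (q ^ i) a) <= (h ^+ i * s + e)%:E)%E.
Proof.
move=> q0 h0 hq a s Da s0 as_; elim: i => [|i IH] e e0.
  rewrite expn0 expr0 mul1r; apply: (@le_trans _ _ s%:E); last by rewrite lee_fin; lra.
  have -> // : dilation 1 a = a by apply/funext => n; rewrite /dilation mul1r.
have -> : dilation (q ^ i.+1) a = dilation q (dilation (q ^ i) a).
  apply/funext => n; rewrite /dilation mulrA; congr (a (_ * _)).
  by rewrite expnSr PoszM.
have qi : (0 < q ^ i)%N by rewrite expn_gt0 q0.
have e'0 : 0 < e / (h + 1) by apply: divr_gt0; lra.
have p0 : 0 < h ^+ i * s + e / (h + 1).
  by apply: ltr_wpDl => //; apply: mulr_ge0; [exact: exprn_ge0|exact: ltW].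
apply: le_trans (hq _ _ (decreasing_dilation qi Da) p0 (IH _ e'0)) _.
rewrite lee_fin mulrDr exprS mulrA lerD2l mulrCA ger_pMr// ler_pdivrMr; lra.
Qed.

(** The adjoint of the averaging operator of Hardy. *)
Definition tail_sum (n : nat) a (k : int) : R :=
  if 1 <= k then \sum_(`|k|%N <= j < n.+1) a j%:Z / j%:R else 0.

Lemma tail_sum_ge0 n a k : (forall n, 0 <= a n) -> 0 <= tail_sum n a k.
Proof. by move=> a0; rewrite /tail_sum; case: ifP => // _; apply: sumr_ge0 => j _; exact: divr_ge0. Qed.

(** On a block [k <= j < q * k] the terms are at most [a k / k], and there are fewer
than [q * k] of them. *)
Lemma block_sum_le q a k : (0 < k)%N -> (0 < q)%N -> decreasing_sequences a ->
  \sum_(k <= j < q * k) a j%:Z / j%:R <= q%:R * a k%:Z.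
Proof.
move=> k0 q0 [_ a0 ad].
apply: (@le_trans _ _ (\sum_(k <= j < q * k) a k%:Z / k%:R)).
  rewrite big_nat [leRHS]big_nat; apply: ler_sum => j /andP[kj _].
  apply: ler_pM => //; first by apply: ad; lia.
  by rewrite lef_pV2 ?posrE ?ltr0n ?ler_nat//; lia.
rewrite sumr_const_nat -[_ *+ (_ - _)]mulr_natr mulrAC ler_pdivrMr ?ltr0n//.
rewrite mulrC mulrAC -natrM ler_wpM2r// ler_nat leq_subr//.
Qed.

(** Cut the sum at the points [q ^ i * k]. *)
Lemma tail_sum_le_dilations q n a k L : (1 < q)%N -> decreasing_sequences a ->
  (n < q ^ L)%N ->
  tail_sum n a k <= q%:R * \sum_(i < L) dilation (q ^ i) a k.
Proof.
move=> q1 Da nL; have a0 : forall n, 0 <= a n by case: Da.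
rewrite /tail_sum; case: ifPn => [k1|_]; last first.
  by apply: mulr_ge0 => //; apply: sumr_ge0 => i _; exact: a0.
have [m m0 ->] : exists2 m : nat, (0 < m)%N & k = m%:Z by exists `|k|%N; lia.
rewrite absz_nat.
have key M : \sum_(m <= j < q ^ M * m) a j%:Z / j%:R <= q%:R * \sum_(i < M) dilation (q ^ i) a m%:Z.
  elim: M => [|M IH]; first by rewrite expn0 mul1n big_geq// big_ord0 mulr0.
  rewrite big_ord_recr/= mulrDr.
  have qM : (0 < q ^ M)%N by rewrite expn_gt0; lia.
  rewrite (@big_cat_nat _ _ _ (q ^ M * m))/=; [|by rewrite leq_pmull|].
    apply: lerD => //; rewrite expnS -mulnA.
    by apply: block_sum_le => //; [rewrite muln_gt0 qM|lia].
  by rewrite leq_mul2r expnS leq_pmull ?orbT//; lia.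
apply: le_trans (key L).
have [h|h] := leqP n.+1 m.
  by rewrite big_geq//; apply: sumr_ge0 => j _; exact: divr_ge0.
have h' : (n.+1 <= q ^ L * m)%N by apply: (leq_trans nL); rewrite leq_pmulr.
rewrite [leRHS](@big_cat_nat _ _ _ n.+1)//=; last exact: ltnW.
by rewrite lerDl; apply: sumr_ge0 => j _; exact: divr_ge0.
Qed.

(** The dilations by [q ^ i] have norms at most [h ^ i], so a geometric series
converges. *)
Lemma tail_sum_bounded tau q h : seq_norm tau -> (2 <= q)%N -> 0 <= h < 1 ->
  dilation_contracts tau q h ->
  forall n a s, decreasing_sequences a -> 0 < s -> (tau a <= s%:E)%E ->
    (tau (tail_sum n a) <= (q%:R / (1 - h) * (2 * s))%:E)%E.
Proof.
move=> ht q2 /andP[h0 h1] hq n a s Da s0 as_.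
have a0 : forall n, 0 <= a n by case: Da.
have nL : (n < q ^ n)%N by exact: ltn_expl.
apply: le_trans (sn_mono ht (fun k => tail_sum_ge0 n k a0)
  (fun k => tail_sum_le_dilations k q2 Da nL)) _.
rewrite -mulrA; apply: sn_scale_le => //.
  by move=> k; apply: sumr_ge0 => i _; exact: a0.
(* the [n] slacks then add up to at most [s / (1 - h)] *)
pose e := s / ((1 - h) * (n%:R + 1)).
have n0 : 0 <= n%:R :> R by [].
have p0 : 0 < (1 - h) * (n%:R + 1) by apply: mulr_gt0; lra.
have e0 : 0 < e by exact: divr_gt0.
apply: le_trans (sn_sum_le _ ht _ (fun i : 'I_n =>
   @dilation_contracts_iter tau q h i _ h0 hq a s Da s0 as_ e e0)) _.
- by move=> i k; exact: a0.
- by lia.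
rewrite lee_fin big_split/= -mulr_suml sumr_const card_ord.
have -> : (1 - h)^-1 * (2 * s) = (1 - h)^-1 * s + (1 - h)^-1 * s by ring.
apply: lerD.
  rewrite ler_wpM2r ?(ltW s0)// -[leRHS]mul1r ler_pdivlMr; last lra.
  have := subrX1 h n; have : 0 <= h ^+ n by exact: exprn_ge0.
  by rewrite mulrC; nra.
have -> : e *+ n = ((1 - h)^-1 * s) * (n%:R / (n%:R + 1)).
  rewrite -[e *+ n]mulr_natr /e; field.
  by apply/andP; split; lra.
rewrite ger_pMr ?ler_pdivrMr; [lra|lra|].
by rewrite mulr_gt0// invr_gt0; lra.
Qed.

End Dilation.

(** * The bilinear estimate *)

Section BilinearBound.
Context (R : realType).
Implicit Types (tau : (int -> R) -> \bar R) (a b : int -> R) (v u : seq R).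

Definition pos_range (n : nat) : seq int := [seq i.+1%:Z | i <- iota 0 n].

Lemma size_pos_range n : size (pos_range n) = n.
Proof. by rewrite size_map size_iota. Qed.

Lemma pos_range_uniq n : uniq (pos_range n).
Proof. by rewrite map_inj_uniq ?iota_uniq// => i j []. Qed.

Lemma nth_pos_range n i : (i < n)%N -> nth 0 (pos_range n) i = i.+1%:Z.
Proof. by move=> ni; rewrite (nth_map 0%N) ?size_iota// nth_iota. Qed.

Lemma mem_pos_range n k : (k \in pos_range n) = (1 <= k <= n%:Z).
Proof.
apply/mapP/andP => [[n0]|[k1 kn]]; first by rewrite mem_iota => h ->; lia.
by exists `|k|.-1%N; [rewrite mem_iota|]; lia.
Qed.

Lemma place_pos_range v i : (i < size v)%N -> place (pos_range (size v)) v i.+1%:Z = nth 0 v i.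
Proof.
by move=> iv; rewrite -(nth_pos_range iv) place_nth ?pos_range_uniq ?size_pos_range.
Qed.

Lemma decreasing_place v : all (fun x => 0 <= x) v -> sorted (fun x y => y <= x) v ->
  decreasing_sequences (place (pos_range (size v)) v).
Proof.
move=> v0 sv; have tr : transitive (fun x y : R => y <= x).
  by move=> x y z h1 h2; exact: le_trans h2 h1.
split=> [n n0|n|m n m1 mn].
- by rewrite place_notin ?size_pos_range// mem_pos_range; lia.
- exact: place_ge0.
have [i iE] : exists i : nat, m = i.+1%:Z by exists `|m|.-1%N; lia.
rewrite {}iE {m1} in mn *; have [j jE] : exists j : nat, n = j.+1%:Z by exists `|n|.-1%N; lia.
rewrite {}jE in mn *.
have [jv|jv] := ltnP j (size v); last first.
  rewrite (@place_notin _ _ _ j.+1%:Z) ?size_pos_range//; first exact: place_ge0.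
  by rewrite mem_pos_range; lia.
have ij : (i <= j)%N by lia.
rewrite !place_pos_range//; last exact: leq_ltn_trans jv.
have := @sorted_leq_nth _ (fun x y : R => y <= x) tr (fun x => lexx x) 0 v sv.
by apply; rewrite ?inE// (leq_ltn_trans ij).
Qed.

Lemma tail_sum_place v l :
  tail_sum (size v) (place (pos_range (size v)) v) l.+1%:Z =
  \sum_(i < size v | (l <= i)%N) nth 0 v i / i.+1%:R.
Proof.
rewrite /tail_sum (_ : _ <= _ = true) ?absz_nat; last by lia.
rewrite big_add1/= big_geq_mkord; apply: eq_bigr => i _.
by rewrite place_pos_range.
Qed.

(** Bound [1 / (i + l + 1)] by the inverse of the larger of [i + 1] and [l + 1]. *)
Lemma hilbert_sum_le_tails v u :
  all (fun x => 0 <= x) v -> all (fun x => 0 <= x) u ->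
  \sum_(i < size v) \sum_(l < size u) (i + l).+1%:R^-1 * (nth 0 v i * nth 0 u l) <=
  \sum_(l < size u) nth 0 u l * tail_sum (size v) (place (pos_range (size v)) v) l.+1%:Z +
  \sum_(i < size v) nth 0 v i * tail_sum (size u) (place (pos_range (size u)) u) i.+1%:Z.
Proof.
move=> v0 u0.
have nv i : 0 <= nth 0 v i by have [h|h] := ltnP i (size v); [exact: (allP v0) (mem_nth _ h)|rewrite nth_default].
have nu i : 0 <= nth 0 u i by have [h|h] := ltnP i (size u); [exact: (allP u0) (mem_nth _ h)|rewrite nth_default].
under [X in _ <= X + _]eq_bigr do rewrite tail_sum_place mulr_sumr big_mkcond/=.
under [X in _ <= _ + X]eq_bigr do rewrite tail_sum_place mulr_sumr big_mkcond/=.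
rewrite [X in _ <= X + _]exchange_big/= -big_split/=; apply: ler_sum => i _.
rewrite -big_split/=; apply: ler_sum => l _.
set x := nth 0 v i; set y := nth 0 u l.
have x0 : 0 <= x by exact: nv.
have y0 : 0 <= y by exact: nu.
have xy : 0 <= x * y by exact: mulr_ge0.
have inv_le m n : (m <= n)%N -> n.+1%:R^-1 <= m.+1%:R^-1 :> R.
  by move=> mn; rewrite lef_pV2 ?posrE ?ltr0n ?ler_nat.
have [li|il] := leqP l i.
  apply: ler_wpDr.
    by case: ifP => // _; exact: mulr_ge0 x0 (divr_ge0 y0 (ler0n _ _)).
  have -> : y * (x / i.+1%:R) = i.+1%:R^-1 * (x * y) by ring.
  by apply: ler_wpM2r => //; apply: inv_le; exact: leq_addr.
have -> : x * (y / l.+1%:R) = l.+1%:R^-1 * (x * y) by ring.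
rewrite (ltnW il) add0r; apply: ler_wpM2r => //; apply: inv_le; exact: leq_addl.
Qed.

Lemma tails_le tau (c1 c2 x y : R) v u : seq_norm tau ->
  all (fun x => 0 <= x) v -> all (fun x => 0 <= x) u -> 0 < c1 -> 0 < x -> 0 < y ->
  let a := place (pos_range (size v)) v in let b := place (pos_range (size u)) u in
  (tau a <= x%:E)%E -> (associate_norm (Zcount R) tau b <= y%:E)%E ->
  (tau (tail_sum (size v) a) <= (c1 * x)%:E)%E ->
  (associate_norm (Zcount R) tau (tail_sum (size u) b) <= (c2 * y)%:E)%E ->
  \sum_(l < size u) nth 0 u l * tail_sum (size v) a l.+1%:Z +
  \sum_(i < size v) nth 0 v i * tail_sum (size u) b i.+1%:Z <= (c1 + c2) * (x * y).
Proof.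
move=> ht v0 u0 c10 x0 y0 a b ax bY tax tby.
have a0 : forall k, 0 <= a k by exact: place_ge0.
have b0 : forall k, 0 <= b k by exact: place_ge0.
rewrite mulrDl; apply: lerD.
  have := associate_hoelder ht (fun k => tail_sum_ge0 (size v) k a0) b0
    (pos_range_uniq (size u)) (mulr_gt0 c10 x0) tax bY.
  rewrite -mulrA; apply: le_trans; rewrite (eq_bigr (fun k => b k * tail_sum (size v) a k)).
    rewrite sum_place ?pos_range_uniq ?size_pos_range//.
    by apply: ler_sum => i _; rewrite nth_pos_range.
  by move=> k _; rewrite mulrC.
have := associate_hoelder ht a0 (fun k => tail_sum_ge0 (size u) k b0)
    (pos_range_uniq (size v)) x0 ax tby.
rewrite mulrCA; apply: le_trans.
rewrite sum_place ?pos_range_uniq ?size_pos_range//.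
by apply: ler_sum => i _; rewrite nth_pos_range.
Qed.

(** The decreasing arrangement of the part of [a] on [s] has no larger norm than [a]. *)
Lemma sort_place tau a (s : seq int) x : seq_norm tau -> uniq s -> (forall k, 0 <= a k) ->
  (tau a <= x%:E)%E -> exists s' : seq int,
  let v := map a s' in
  [/\ perm_eq s' s, sorted (fun x y => y <= x) v, all (fun x => 0 <= x) v &
     (tau (place (pos_range (size v)) v) <= x%:E)%E].
Proof.
move=> ht us a0 ax; exists (sort (fun k l => a l <= a k) s) => v.
have ps : perm_eq (sort (fun k l => a l <= a k) s) s by rewrite perm_sort.
have us' : uniq (sort (fun k l => a l <= a k) s) by rewrite (perm_uniq ps).
have v0 : all (fun x => 0 <= x) v by apply/allP => _ /mapP[k _ ->].
split => //.
  rewrite sorted_map; apply: sort_sorted => k l; exact: le_total.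
rewrite (@sn_place _ _ ht _ (sort (fun k l => a l <= a k) s)) ?pos_range_uniq//.
- apply: le_trans ax; apply: (sn_mono ht) => k; first exact: place_ge0.
  have [ks|ks] := boolP (k \in sort (fun k l => a l <= a k) s); first by rewrite place_map.
  by rewrite place_notin ?size_map.
- by rewrite size_pos_range.
- by rewrite size_pos_range size_map.
Qed.

(** Arrange both sequences decreasingly. Summation by parts replaces the kernel by the
Hilbert matrix, which is a sum of two tail sum operators; one of them is bounded
by the contraction for [tau], the other one by the contraction for its associate. *)
Lemma bilinear_bound tau q h q' h' : seq_norm tau ->
  (2 <= q)%N -> 0 <= h < 1 -> dilation_contracts tau q h ->
  (2 <= q')%N -> 0 <= h' < 1 ->
  dilation_contracts (associate_norm (Zcount R) tau) q' h' ->
  exists2 C : R, 0 < C & forall k M (S T : seq int) a b x y,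
    hilbert_bounded k M -> 0 <= M -> uniq S -> uniq T ->
    (forall j, 0 <= a j) -> (forall j, 0 <= b j) -> 0 < x -> 0 < y ->
    (tau a <= x%:E)%E -> (associate_norm (Zcount R) tau b <= y%:E)%E ->
    `|\sum_(m <- T) \sum_(j <- S) k m j * (a j * b m)| <= C * M * (x * y).
Proof.
move=> ht q2 h01 hq q'2 h'01 hq'.
have ht' := associate_seq_norm ht.
pose c1 := q%:R / (1 - h) * 2; pose c2 := q'%:R / (1 - h') * 2.
have c10 : 0 < c1.
  by move: h01 => /andP[_ ?]; rewrite /c1 mulr_gt0// divr_gt0 ?ltr0n ?subr_gt0//; lia.
have c20 : 0 < c2.
  by move: h'01 => /andP[_ ?]; rewrite /c2 mulr_gt0// divr_gt0 ?ltr0n ?subr_gt0//; lia.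
exists (c1 + c2); first exact: addr_gt0.
move=> k M S T a b x y kM M0 uS uT a0 b0 x0 y0 ax bY.
have [S' []] := sort_place ht uS a0 ax; set v := map a S'.
move=> pS sv v0 vx.
have [T' []] := sort_place ht' uT b0 bY; set u := map b T'.
move=> pT su u0 uy.
have uS' : uniq S' by rewrite (perm_uniq pS).
have uT' : uniq T' by rewrite (perm_uniq pT).
have szv : size v = size S' by rewrite size_map.
have szu : size u = size T' by rewrite size_map.
pose F i l := k (nth 0 T' l) (nth 0 S' i).
have FE : \sum_(m <- T) \sum_(j <- S) k m j * (a j * b m) =
    \sum_(i < size v) \sum_(l < size u) F i l * (nth 0 v i * nth 0 u l).
  rewrite -(perm_big _ pT)/=; under eq_bigr do rewrite -(perm_big _ pS)/=.
  rewrite (big_nth 0) big_mkord szv szu exchange_big/=.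
  rewrite [RHS]exchange_big/=; rewrite exchange_big/=; apply: eq_bigr => l _.
  rewrite (big_nth 0) big_mkord; apply: eq_bigr => i _.
  by rewrite /F (nth_map 0)// (nth_map 0).
have tot : \sum_(i < size v) \sum_(l < size u)
    (M * (i + l).+1%:R^-1) * (nth 0 v i * nth 0 u l) <= (c1 + c2) * M * (x * y).
  rewrite [(c1 + c2) * M]mulrC -mulrA.
  under eq_bigr do under eq_bigr do rewrite -mulrA.
  under eq_bigr do rewrite -mulr_sumr.
  rewrite -mulr_sumr ler_wpM2l//; apply: le_trans (hilbert_sum_le_tails v0 u0) _.
  apply: (tails_le ht) => //.
    have -> : c1 * x = q%:R / (1 - h) * (2 * x) by rewrite /c1 [RHS]mulrA.
    by apply: (tail_sum_bounded ht q2 h01 hq) => //; exact: decreasing_place.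
  have -> : c2 * y = q'%:R / (1 - h') * (2 * y) by rewrite /c2 [RHS]mulrA.
  by apply: (tail_sum_bounded ht' q'2 h'01 hq') => //; exact: decreasing_place.
have sorted_nth (w : seq R) : sorted (fun x y => y <= x) w ->
    forall i, (i.+1 < size w)%N -> nth 0 w i.+1 <= nth 0 w i.
  move=> sw i iw; have := sortedP 0 sw; exact.
have part m m' : (m <= size v)%N -> (m' <= size u)%N ->
    `|\sum_(i < m) \sum_(l < m') F i l| <= \sum_(i < m) \sum_(l < m') M * (i + l).+1%:R^-1.
  move=> mv mu; have := kM (take m S') (take m' T') (take_uniq _ uS') (take_uniq _ uT').
  rewrite !size_takel -?szv -?szu// /hilbert_sum mulr_sumr.
  under [X in _ -> _ <= X]eq_bigr do rewrite -mulr_sumr.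
  rewrite (big_nth 0) big_mkord size_takel -?szu//.
  under [X in `|X| <= _ -> _]eq_bigr do rewrite (big_nth 0) big_mkord size_takel -?szv//.
  rewrite exchange_big/= => H; apply: le_trans H; rewrite le_eqVlt; apply/orP; left; apply/eqP.
  congr `|_|; apply: eq_bigr => i _; apply: eq_bigr => l _.
  by rewrite /F !nth_take.
rewrite FE ler_norml; apply/andP; split; last first.
  apply: le_trans tot; apply: (@abel_le2 _ _ _ F (fun i l => M * (i + l).+1%:R^-1)
    (nth 0 v) (nth 0 u)).
  - by move=> m m' mv mu; apply: le_trans (part _ _ mv mu); exact: ler_norm.
  - by move=> i iv; apply: (allP v0); exact: mem_nth.
  - exact: sorted_nth.
  - by move=> i iv; apply: (allP u0); exact: mem_nth.
  - exact: sorted_nth.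
rewrite lerNl -sumrN; under eq_bigr do rewrite -sumrN.
under eq_bigr do under eq_bigr do rewrite -mulNr.
apply: le_trans tot; apply: (@abel_le2 _ _ _ (fun i l => - F i l) (fun i l => M * (i + l).+1%:R^-1)
    (nth 0 v) (nth 0 u)).
- move=> m m' mv mu; apply: le_trans (part _ _ mv mu).
  under eq_bigr do rewrite sumrN.
  by rewrite sumrN -normrN ler_norm.
- by move=> i iv; apply: (allP v0); exact: mem_nth.
- exact: sorted_nth.
- by move=> i iv; apply: (allP u0); exact: mem_nth.
- exact: sorted_nth.
Qed.

End BilinearBound.

(** * Averages over unit intervals *)

Section Averaging.
Context (R : realType).
Local Notation mu := (@lebesgue_measure R).
Local Notation cell := (Num.ceil : measurableTypeR R -> int).
Local Notation Mp := (@Mplus _ (measurableTypeR R) R).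

(** A decreasing predicate on integers holds exactly below its count. *)
Lemma count_decreasing (P : nat -> bool) n i : (forall i, P i.+1 -> P i) -> (i < n)%N ->
  P i = (i < \sum_(l < n) P l)%N.
Proof.
move=> Pd; have Pm k l : (k <= l)%N -> P l -> P k.
  by move=> kl; rewrite -(subnK kl); elim: (l - k)%N => // m IH; rewrite addSn => /Pd.
move=> iN; apply/idP/idP => [Pi|]; last first.
  apply: contraTT => nPi; rewrite -leqNgt -(subnKC (ltnW iN)) big_split_ord/=.
  rewrite [X in (_ + X)%N]big1 ?addn0; last first.
    move=> l _; apply/eqP; rewrite eqb0; apply: contra nPi; apply: Pm; exact: leq_addr.
  rewrite -[leqRHS]card_ord -sum1_card; apply: leq_sum => l _; exact: leq_b1.
rewrite -(subnKC iN) big_split_ord/=; apply: leq_trans (leq_addr _ _).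
rewrite -[leqLHS]card_ord -sum1_card; apply: leq_sum => l _.
by rewrite (Pm l i)// -ltnS.
Qed.

(** The integers are enumerated through [pickle] to use countable additivity. *)
Lemma mu_eq_cells (A B : set (measurableTypeR R)) : measurable A -> measurable B ->
  (forall j, mu (A `&` cell @^-1` [set j]) = mu (B `&` cell @^-1` [set j])) ->
  mu A = mu B.
Proof.
move=> mA mB AB.
pose F (D : set (measurableTypeR R)) (k : nat) :=
  if (@choice.unpickle int k) is Some j then
    if @choice.pickle int j == k then D `&` cell @^-1` [set j] else set0 else set0.
have DE D : D = \bigcup_k F D k.
  apply/seteqP; split=> [x Dx|x [k _]]; last first.
    by rewrite /F; case: choice.unpickle => // j; case: ifP => // _ [].
  by exists (@choice.pickle int (cell x)) => //; rewrite /F choice.pickleK eqxx.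
have mF D k : measurable D -> measurable (F D k).
  move=> mD; rewrite /F; case: choice.unpickle => // j; case: ifP => // _.
  by apply: measurableI => //; exact: measurable_preimage_cell.
have tF D : trivIset setT (F D).
  move=> k l _ _ [x []]; rewrite /F.
  case: choice.unpickle => // j; case: eqP => // <- [_ /= <-].
  by case: choice.unpickle => // j'; case: eqP => // <- [_ /= <-].
rewrite (DE A) (DE B) !measure_semi_bigcup//; first last.
- by rewrite -DE.
- by move=> i; exact: mF.
- by rewrite -DE.
- by move=> i; exact: mF.
apply: eq_eseriesr => k _; rewrite /F.
by case: choice.unpickle => // j; case: ifP => // _; exact: AB.
Qed.

(** An interval of length [m] contains at least [n * m - 1] points of any translate of
the lattice of mesh [1 / n]. *)
Lemma lattice_count (n : nat) (y m : R) : (0 < n)%N -> 0 < y <= 1 -> 0 <= m <= 1 ->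
  n%:R * m - 1 <= \sum_(r <- int_window n) (nat_of_bool (0 < y + r%:~R / n%:R < m)%R)%:R.
Proof.
move=> n0 /andP[y0 y1] /andP[m0 m1].
have n0' : 0 < n%:R :> R by rewrite ltr0n.
pose p := Num.floor (- (n%:R * y)); pose q := Num.ceil (n%:R * (m - y)).
have /andP[p1 p2] : p%:~R <= - (n%:R * y) < (p + 1)%:~R by exact: floor_itv.
have /andP[q1 q2] : (q - 1)%:~R < n%:R * (m - y) <= q%:~R by exact: ceil_itv.
have [h|h] := leP (q - 1 - p) 0.
  apply: (@le_trans _ _ 0); last exact: sumr_ge0.
  move: h; rewrite -(ler_int R) !rmorphB/= => h; lra.
have [K KE] : exists K : nat, q - 1 - p = K%:Z by exists `|(q - 1 - p)%R|%N; lia.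
pose s := [seq p + 1 + i%:Z | i <- iota 0 K].
apply: (@le_trans _ _ (\sum_(r <- s) (nat_of_bool (0 < y + r%:~R / n%:R < m)%R)%:R)); last first.
  apply: sum_subset_le => //; first by rewrite map_inj_uniq ?iota_uniq// => i j; lia.
  move=> _ /mapP[i + ->]; rewrite mem_iota add0n => iK; rewrite mem_int_window.
  have hp : - n%:Z <= p.
    rewrite -ltzD1 -(ltr_int R) rmorphN/= -pmulrn.
    by apply: le_lt_trans p2; rewrite lerN2 ger_pMr.
  have hq : q <= n%:Z.
    rewrite -ltzD1 -ltrBlDr -(ltr_int R) -pmulrn; apply: lt_le_trans q1 _.
    by rewrite -[leRHS]mulr1 ler_wpM2l//; lra.
  lia.
rewrite big_seq (eq_bigr (fun=> 1)); last first.
  move=> _ /mapP[i + ->]; rewrite mem_iota add0n => iK.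
  rewrite (_ : _ && _ = true)//; set r := p + 1 + i%:Z.
  have r1 : (p + 1)%:~R <= r%:~R :> R by rewrite ler_int; lia.
  have r2 : r%:~R <= (q - 1)%:~R :> R by rewrite ler_int /r; lia.
  apply/andP; split.
    by rewrite -ltrBlDl sub0r ltr_pdivlMr// mulNr mulrC; lra.
  by rewrite -ltrBrDl ltr_pdivrMr// mulrC; lra.
rewrite -big_seq big_const_seq count_predT iter_addr_0 size_map size_iota.
have : K%:R = (q - 1 - p)%:~R :> R by rewrite KE.
rewrite !rmorphB/= rmorphD/= in p2 q1 * => ->; lra.
Qed.

End Averaging.

Section Layers.
Context (R : realType).
Local Notation mu := (@lebesgue_measure R).
Local Notation cell := (Num.ceil : measurableTypeR R -> int).
Local Notation Mp := (@Mplus _ (measurableTypeR R) R).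
Implicit Types (A B : nat -> set (measurableTypeR R)).

(** A function taking multiples of [d] as values, as a sum of indicators of nested
sets. *)
Definition layer_sum (d : R) A (n : nat) (x : measurableTypeR R) : R :=
  d * (\sum_(i < n) (x \in A i))%:R.

Lemma Mplus_layer_sum d A n : 0 <= d -> (forall i, measurable (A i)) ->
  Mp (layer_sum d A n).
Proof.
move=> d0 mA; apply: MplusZ => //.
have -> : (fun x => (\sum_(i < n) (x \in A i))%:R) = (fun x => \sum_(i < n) \1_(A i) x :> R).
  by apply/funext => x; rewrite natr_sum; apply: eq_bigr => i _; rewrite indicE.
by apply: Mplus_sum => i; split => //; exact: measurable_indic.
Qed.

Lemma layer_sum_level d A n s : 0 < d -> 0 <= s ->
  (forall i, A i.+1 `<=` A i) ->
  [set x | s < layer_sum d A n x] =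
  if (Num.truncn (s / d) < n)%N then A (Num.truncn (s / d)) else set0.
Proof.
move=> d0 s0 dA; set r := Num.truncn _; apply/seteqP; split=> x /=.
  rewrite /layer_sum mulrC -ltr_pdivrMr// => h.
  have hr : (r < \sum_(i < n) (x \in A i))%N.
    have r0 : 0 <= s / d by rewrite divr_ge0// ltW.
    rewrite -(ltr_nat R); apply: le_lt_trans h.
    by have /andP[] := truncn_itv r0.
  have rn : (r < n)%N.
    apply: (leq_trans hr); rewrite -[leqRHS]card_ord -sum1_card.
    by apply: leq_sum => l _; exact: leq_b1.
  rewrite rn; apply: set_mem.
  rewrite (@count_decreasing (fun i => x \in A i) n r)// => i /set_mem h'.
  by apply: mem_set; exact: dA.
case: ifPn => [rn Ax|//].
have xr : x \in A r by exact: mem_set.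
have : (r < \sum_(i < n) (x \in A i))%N.
  rewrite -(@count_decreasing (fun i => x \in A i) n r)// => i /set_mem h'.
  by apply: mem_set; exact: dA.
move=> h; rewrite /layer_sum mulrC -ltr_pdivrMr//; apply: lt_le_trans (truncnS_gt _) _.
by rewrite ler_nat.
Qed.

Lemma layer_sum_level_eq d A B n s : 0 < d -> 0 < s ->
  (forall i, A i.+1 `<=` A i) -> (forall i, B i.+1 `<=` B i) ->
  (forall i, mu (A i) = mu (B i)) ->
  mu [set x | s < layer_sum d A n x] = mu [set x | s < layer_sum d B n x].
Proof.
by move=> d0 /ltW s0 dA dB AB; rewrite !layer_sum_level//; case: ifP.
Qed.

Variable f : R -> R.
Hypothesis mf : Mp f.
Variables (d : R) (n : nat).
Hypotheses (d0 : 0 < d) (n0 : (0 < n)%N) (fd : forall x, f x <= d * n%:R).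

Definition level_set (i : nat) : set (measurableTypeR R) := [set x | d * i.+1%:R < f x].

Lemma measurable_level_set i : measurable (level_set i).
Proof.
have -> : level_set i = f @^-1` `]d * i.+1%:R, +oo[%classic.
  by apply/seteqP; split=> x /=; rewrite in_itv/= andbT.
by rewrite -[X in measurable X]setTI; apply: mf.1 => //; exact: measurable_itv.
Qed.

Lemma level_set_sub i : level_set i.+1 `<=` level_set i.
Proof. by move=> x /=; apply: le_lt_trans; rewrite ler_pM2l// ler_nat. Qed.

Definition level_mass (i : nat) (j : int) : R :=
  fine (mu (level_set i `&` cell @^-1` [set j])).

Lemma level_cell_le1 i j : (mu (level_set i `&` cell @^-1` [set j]) <= 1)%E.
Proof.
rewrite -(mu_cell R j); apply: le_measure; [apply: mem_set|apply: mem_set|].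
- apply: measurableI; [exact: measurable_level_set|exact: measurable_preimage_cell].
- exact: measurable_preimage_cell.
- exact: subIsetr.
Qed.

Lemma level_massE i j : mu (level_set i `&` cell @^-1` [set j]) = (level_mass i j)%:E.
Proof.
rewrite fineK// ge0_fin_numE//; apply: le_lt_trans (level_cell_le1 i j) _.
by rewrite ltry.
Qed.

Lemma level_mass_itv i j : 0 <= level_mass i j <= 1.
Proof. by rewrite fine_ge0//= -lee_fin -level_massE level_cell_le1. Qed.

Lemma level_mass_sub i j : level_mass i.+1 j <= level_mass i j.
Proof.
rewrite -lee_fin -!level_massE; apply: le_measure; [apply: mem_set|apply: mem_set|].
- apply: measurableI; [exact: measurable_level_set|exact: measurable_preimage_cell].
- apply: measurableI; [exact: measurable_level_set|exact: measurable_preimage_cell].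
- by apply: setSI; exact: level_set_sub.
Qed.

(** In each unit interval the level set is replaced by an interval of the same measure
at its left end. This does not change the distribution of the function, but the
translates by [r / n] now meet the set in the right proportion. *)
Definition packed_set (i : nat) : set (measurableTypeR R) :=
  [set x | 0 < x - ((cell x)%:~R - 1) < level_mass i (cell x)].

Lemma cell_pos (x : R) : 0 < x - ((cell x)%:~R - 1) <= 1.
Proof.
have /andP[] := ceil_itv x; rewrite rmorphB/= => h1 h2.
by apply/andP; split; lra.
Qed.

Lemma packed_set_cell i j : packed_set i `&` cell @^-1` [set j] =
  `](j%:~R - 1), (j%:~R - 1 + level_mass i j)[%classic.
Proof.
have /andP[m0 m1] := level_mass_itv i j.
apply/seteqP; split=> x /=; rewrite /packed_set/= in_itv/=.
  by move=> [+ <-]; lra.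
move=> /andP[h1 h2]; have cx : cell x = j.
  by apply/eqP; rewrite ceil_eq rmorphB/=; apply/andP; split; lra.
by rewrite cx; split => //; apply/andP; split; lra.
Qed.

Lemma measurable_packed_set i : measurable (packed_set i).
Proof.
have -> : packed_set i = \bigcup_j (packed_set i `&` cell @^-1` [set j]).
  by apply/seteqP; split=> [x px|x [j _ []]//]; exists (cell x).
apply: countable_bigcupT_measurable => // j.
by rewrite packed_set_cell; exact: measurable_itv.
Qed.

Lemma packed_set_sub i : packed_set i.+1 `<=` packed_set i.
Proof.
move=> x /= /andP[h1 h2]; apply/andP; split => //.
exact: lt_le_trans h2 (level_mass_sub _ _).
Qed.

Lemma mu_packed_set i : mu (level_set i) = mu (packed_set i).
Proof.
apply: mu_eq_cells; [exact: measurable_level_set|exact: measurable_packed_set|].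
move=> j; rewrite level_massE packed_set_cell.
rewrite lebesgue_measure_itv/= lte_fin ltrDl.
have /andP[m0 m1] := level_mass_itv i j.
case: ifPn => [_|]; first by rewrite -EFinD; congr (_%:E); lra.
by rewrite -leNgt => h; congr (_%:E); apply/eqP; rewrite eq_le h m0.
Qed.

(** Discretizing the values of [f] from below, with an error of at most [d]. *)
Lemma layer_sum_le x : layer_sum d level_set n x <= f x.
Proof.
rewrite leNgt; apply/negP => h.
have : [set y | f x < layer_sum d level_set n y] x by [].
rewrite layer_sum_level//; last exact: level_set_sub; last exact: mf.2.
case: ifP => // _; rewrite /level_set/= ltNge => /negP; apply.
by have := truncnS_gt (f x / d); rewrite ltr_pdivrMr// mulrC; exact: ltW.
Qed.

Lemma le_layer_sum x : f x <= layer_sum d level_set n x + d.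
Proof.
rewrite leNgt; apply/negP => h.
set s := layer_sum d level_set n x in h.
have s0 : 0 <= s by exact: (Mplus_layer_sum n (ltW d0) measurable_level_set).2.
have : ~ [set y | s < layer_sum d level_set n y] x by rewrite /= /s ltxx.
rewrite layer_sum_level//; last exact: level_set_sub.
have /andP[h1 _] := truncn_itv (divr_ge0 s0 (ltW d0)).
rewrite ler_pdivlMr// mulrC in h1.
case: ifPn => [_|]; first apply.
  by rewrite /level_set/= -natr1 mulrDr mulr1; lra.
rewrite -leqNgt => h2 _; have := fd x; rewrite leNgt => /negP; apply.
apply: (@le_lt_trans _ _ s); last by apply: lt_trans h; rewrite ltrDl.
by apply: le_trans h1; rewrite ler_pM2l// ler_nat.
Qed.

End Layers.

Section CellAverage.
Context (R : realType).
Local Notation mu := (@lebesgue_measure R).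
Local Notation cell := (Num.ceil : measurableTypeR R -> int).
Local Notation Mp := (@Mplus _ (measurableTypeR R) R).

Definition cell_integral (f : R -> R) (j : int) : R :=
  (\int[mu]_(x in cell @^-1` [set j]) f x)%R.

Section Bounded.
Variable f : R -> R.
Hypothesis mf : Mp f.
Variables (d : R) (n : nat).
Hypotheses (d0 : 0 < d) (n0 : (0 < n)%N) (fd : forall x, f x <= d * n%:R).
Local Notation level := (level_set f d).
Local Notation mass := (level_mass f d).
Local Notation packed := (packed_set f d).

(** At every point the sum of the translates dominates the sum of the masses over the
unit interval containing the point, up to [d] for each of the [n] layers. *)
Lemma packed_count (x : R) : d * \sum_(i < n) (n%:R * mass i (cell x) - 1) <=
  \sum_(r <- int_window n) layer_sum d packed n (x + r%:~R / n%:R).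
Proof.
rewrite /layer_sum -mulr_sumr ler_pM2l//.
under [leRHS]eq_bigr do rewrite natr_sum.
rewrite [leRHS]exchange_big/=; apply: ler_sum => i _.
apply: le_trans (lattice_count n0 (cell_pos x) (level_mass_itv mf d i (cell x))) _.
apply: ler_sum => r _; rewrite ler_nat; case: ltP => //= h1; case: ltP => //= h2.
rewrite lt0b; apply: mem_set.
suff : (packed i `&` cell @^-1` [set cell x]) (x + r%:~R / n%:R) by case.
rewrite packed_set_cell//= in_itv/=; apply/andP; split; lra.
Qed.

Lemma cell_integral_le_mass j :
  (\int[mu]_(x in cell @^-1` [set j]) (f x)%:E <= (d * \sum_(i < n) mass i j + d)%:E)%E.
Proof.
have mc := @measurable_preimage_cell R [set j].
have ml := measurable_level_set mf d.
have lM := Mplus_layer_sum n (ltW d0) ml.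
have mT (g : R -> R) : Mp g -> measurable_fun (cell @^-1` [set j]) (fun x => (g x)%:E).
  by move=> mg; apply: measurable_funTS; apply/measurable_EFinP; case: mg.
apply: (@le_trans _ _ (\int[mu]_(x in cell @^-1` [set j]) (layer_sum d level n x + d)%:E)%E).
  apply: ge0_le_integral => //.
  - by move=> x _; rewrite lee_fin; exact: mf.2.
  - exact: mT.
  - apply: mT; apply: MplusD => //; split => [|x]; [exact: measurable_cst|exact: ltW].
  - by move=> x _; rewrite lee_fin; exact: le_layer_sum.
under eq_integral do rewrite EFinD.
rewrite ge0_integralD//; first last.
- by move=> x _; rewrite lee_fin ltW.
- exact: mT.
- by move=> x _; rewrite lee_fin; exact: lM.2.
rewrite integral_cst//. rewrite [X in (d%:E * X)%E](mu_cell R j) mule1 EFinD; apply: leeD => //.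
have -> : (\int[mu]_(x in cell @^-1` [set j]) (layer_sum d level n x)%:E =
  \int[mu]_(x in cell @^-1` [set j]) (d%:E * \sum_(i < n) (\1_(level i) x)%:E))%E.
  apply: eq_integral => x _; rewrite /layer_sum natr_sum EFinM sumEFin.
  by congr (_ * _%:E)%E; apply: eq_bigr => i _; rewrite indicE.
have mi i : measurable_fun (cell @^-1` [set j]) (fun x => (\1_(level i) x : R)%:E).
  by apply: mT; split => //; exact: measurable_indic.
rewrite ge0_integralZl//; first last.
- exact: ltW.
- by move=> x _; apply: sume_ge0 => i _; rewrite lee_fin.
- by apply: emeasurable_sum => i.
rewrite EFinM lee_wpmul2l ?lee_fin ?(ltW d0)//.
rewrite ge0_integral_sum//.
rewrite -sumEFin; apply: lee_sum => i _.
by rewrite integral_indic// [leLHS](level_massE mf d (nat_of_ord i) j).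
Qed.

End Bounded.

Context (K : scalars) (rho : (R -> R) -> \bar R).
Hypothesis X_ri : rearrangement_invariant (@lebesgue_measure R) K rho.

Definition window_average (N : nat) (f : R -> R) (k : int) : R :=
  (k \in int_window N)%:R * cell_integral f k.

Definition window_indicator (N : nat) (k : int) : R := (k \in int_window N)%:R.

Lemma window_indicator_fin N : (rho (window_indicator N \o cell) < +oo)%E.
Proof.
have -> : window_indicator N \o cell = \1_(cell @^-1` [set` int_window N]).
  apply/funext => x; rewrite indicE /window_indicator/=; congr ((nat_of_bool _)%:R).
  by apply/idP/idP => [h|/set_mem//]; exact: mem_set.
apply: (bfn_indic X_ri.1); first exact: measurable_preimage_cell.
by rewrite [ltLHS](mu_preimage_cell R) Zcount_seq ?int_window_uniq// ltry.
Qed.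

Lemma cell_integral_ge0 f j : (forall x, 0 <= f x) -> 0 <= cell_integral f j.
Proof. by move=> f0; apply: Rintegral_ge0. Qed.

Lemma window_average_ge0 N f k : (forall x, 0 <= f x) -> 0 <= window_average N f k.
Proof. by move=> f0; rewrite mulr_ge0// cell_integral_ge0. Qed.

(** The average of [f] over unit intervals need not be dominated by translates of [f],
but it is dominated by [1 / n] times the sum of the [2 n] translates by [r / n] of
the packed rearrangement, whose norms are at most that of [f]; the translations
have to go both ways, whence the factor 2. The error of the discretization tends
to 0 with [1 / n]. *)
Lemma rho_average_bounded f (M s : R) N : Mp f -> 0 < M -> (forall x, f x <= M) ->
  (rho f <= s%:E)%E -> (rho (window_average N f \o cell) <= (2 * s)%:E)%E.
Proof.
move=> mf M0 fM fs.
have f0 := mf.2.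
have cW : exists2 c : R, 0 <= c & (rho (window_indicator N \o cell) <= c%:E)%E.
  have h := window_indicator_fin N.
  have Mw : Mp (window_indicator N \o cell) by apply: Mplus_cell.
  have r0 := rho_ge0 X_ri Mw.
  exists (fine (rho (window_indicator N \o cell))); first exact: fine_ge0.
  by rewrite fineK// ge0_fin_numE.
have [c c0 hc] := cW.
suff step n : (0 < n)%N -> (rho (window_average N f \o cell) <= (2 * s + 2 * (M / n%:R) * c)%:E)%E.
  apply/lee_addgt0Pr => e e0.
  pose n := (Num.truncn (2 * M * c / e)).+1.
  apply: le_trans (step n isT) _; rewrite -EFinD lee_fin lerD2l.
  have -> : 2 * (M / n%:R) * c = (2 * M * c) / n%:R by ring.
  rewrite ler_pdivrMr ?ltr0n// [leRHS]mulrC -ler_pdivrMr//.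
  exact: ltW (truncnS_gt _).
move=> n0; pose d := M / n%:R.
have n0' : 0 < n%:R :> R by rewrite ltr0n.
have d0 : 0 < d by exact: divr_gt0.
have dn : d * n%:R = M by rewrite /d divfK// gt_eqF.
have fd x : f x <= d * n%:R by rewrite dn.
pose g := layer_sum d (packed_set f d) n.
have mp := measurable_packed_set mf d.
have mg : Mp g by apply: Mplus_layer_sum => //; exact: ltW.
have ml := measurable_level_set mf d.
have gs : (rho g <= s%:E)%E.
  apply: le_trans fs.
  have -> : rho g = rho (layer_sum d (level_set f d) n).
    apply: (rho_equimeasurable X_ri) => //; first exact: (Mplus_layer_sum n (ltW d0) ml).
    move=> t t0; apply: layer_sum_level_eq => //.
    - exact: packed_set_sub.
    - exact: level_set_sub.
    - by move=> i; rewrite mu_packed_set.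
  apply: (rho_mono X_ri) => //; first exact: (Mplus_layer_sum n (ltW d0) ml).
  by move=> x; exact: layer_sum_le.
pose S (x : R) := n%:R^-1 * \sum_(r <- int_window n) g (x + r%:~R / n%:R).
have mS : Mp S.
  apply: MplusZ; first by rewrite invr_ge0.
  by apply: Mplus_sum => r; exact: Mplus_shift.
pose W := (window_indicator N \o cell).
have mW : Mp W by apply: Mplus_cell.
have mWd : Mp (fun x => (2 * d) * W x) by apply: MplusZ => //; rewrite mulr_ge0// ltW.
apply: (@le_trans _ _ (rho (fun x => S x + (2 * d) * W x))).
  apply: (rho_mono X_ri); first by apply: Mplus_cell => k; exact: window_average_ge0.
    exact: MplusD.
  move=> x; rewrite /window_average /W /window_indicator/=.
  case: (_ \in _); last by rewrite !mul0r mulr0 addr0; exact: mS.2.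
  rewrite mul1r mulr1.
  have h1 : cell_integral f (cell x) <= d * \sum_(i < n) level_mass f d i (cell x) + d.
    rewrite /cell_integral /Rintegral -lee_fin.
    have h := cell_integral_le_mass mf d0 fd (cell x).
    rewrite fineK// ge0_fin_numE; first by apply: le_lt_trans h _; rewrite ltry.
    by apply: integral_ge0 => y _; rewrite lee_fin.
  apply: le_trans h1 _.
  have h2 := packed_count mf d0 n0 x.
  have h3 : n%:R^-1 * (d * \sum_(i < n) (n%:R * level_mass f d i (cell x) - 1)) <= S x.
    by rewrite /S ler_wpM2l// invr_ge0.
  have E : n%:R^-1 * (d * \sum_(i < n) (n%:R * level_mass f d i (cell x) - 1)) =
      d * \sum_(i < n) level_mass f d i (cell x) - d.
    rewrite sumrB sumr_const card_ord -mulr_sumr.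
    by field; rewrite gt_eqF.
  rewrite E in h3; lra.
apply: (rhoD_le X_ri) => //; last first.
  by apply: (rhoZ_le X_ri (c := 2 * d)) => //; rewrite mulr_ge0// ltW.
have -> : 2 * s = n%:R^-1 * (\sum_(r <- int_window n) s).
  rewrite big_const_seq count_predT iter_addr_0 size_map size_iota -[s *+ _]mulr_natr natrM.
  by field; rewrite gt_eqF.
apply: (rhoZ_le X_ri); first by rewrite invr_ge0.
  by apply: Mplus_sum => r; exact: Mplus_shift.
apply: (@rho_sum_le _ _ _ X_ri _ _ (fun (r : int) x => g (x + r%:~R / n%:R))) => r; first exact: Mplus_shift.
by rewrite (rho_shift X_ri).
Qed.

End CellAverage.

Section AverageBound.
Context (R : realType).
Local Notation mu := (@lebesgue_measure R).
Local Notation cell := (Num.ceil : measurableTypeR R -> int).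
Local Notation Mp := (@Mplus _ (measurableTypeR R) R).
Local Notation mR := (measurable_fun [set: measurableTypeR R]).
Context (K : scalars) (rho : (R -> R) -> \bar R).
Hypothesis X_ri : rearrangement_invariant (@lebesgue_measure R) K rho.
Implicit Types (f : R -> R) (s : R).

Lemma cell_integral_fin f s j : Mp f -> (rho f <= s%:E)%E ->
  (\int[mu]_(x in cell @^-1` [set j]) (f x)%:E < +oo)%E.
Proof.
move=> mf fs.
have mc := @measurable_preimage_cell R [set j].
have [|C C0 hC] := bfn_local X_ri.1 mc.
  by rewrite [ltLHS](mu_cell R j) ltry.
apply: le_lt_trans (hC _ mf) _.
by apply: (@le_lt_trans _ _ (C%:E * s%:E)%E); [rewrite lee_wpmul2l// lee_fin ltW|rewrite -EFinM ltry].
Qed.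

Lemma cell_integrable f s j : mR f -> (rho (fun x => `|f x|)%R <= s%:E)%E ->
  mu.-integrable (cell @^-1` [set j]) (EFin \o f).
Proof.
move=> mf fs; apply/integrableP; split.
  by apply: measurable_funTS; exact/measurable_EFinP.
under eq_integral do rewrite abse_EFin.
exact: cell_integral_fin (Mplus_abs mf) fs.
Qed.

Lemma measurable_cell_fun f j : Mp f ->
  measurable_fun (cell @^-1` [set j]) (fun x => (f x)%:E).
Proof. by move=> mf; apply: measurable_funTS; apply/measurable_EFinP; case: mf. Qed.

Lemma cell_integralE f s j : Mp f -> (rho f <= s%:E)%E ->
  (cell_integral f j)%:E = (\int[mu]_(x in cell @^-1` [set j]) (f x)%:E)%E.
Proof.
move=> mf fs; rewrite fineK// ge0_fin_numE; first exact: cell_integral_fin mf fs.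
by apply: integral_ge0 => y _; rewrite lee_fin; exact: mf.2.
Qed.

Lemma cell_integral_le f g s j : Mp f -> Mp g -> (forall x, f x <= g x) ->
  (rho g <= s%:E)%E -> cell_integral f j <= cell_integral g j.
Proof.
move=> mf mg fg gs; have fs : (rho f <= s%:E)%E.
  by apply: le_trans gs; exact: (rho_mono X_ri).
rewrite -lee_fin (cell_integralE _ mf fs) (cell_integralE _ mg gs).
apply: ge0_le_integral; [exact: measurable_preimage_cell| | | |].
- by move=> y _; rewrite lee_fin; exact: mf.2.
- exact: measurable_cell_fun.
- exact: measurable_cell_fun.
- by move=> y _; rewrite lee_fin.
Qed.

(** Truncate [f] and pass to the limit by monotone convergence. *)
Lemma rho_average f s N : Mp f -> (rho f <= s%:E)%E ->
  (rho (window_average N f \o cell) <= (2 * s)%:E)%E.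
Proof.
move=> mf fs; have f0 := mf.2.
pose F (M : nat) (x : R) := Num.min (f x) M.+1%:R.
have mF M : Mp (F M).
  split => [|x]; first by apply: measurable_minr; [exact: mf.1|exact: measurable_cst].
  by rewrite le_min f0/=.
have Ff M x : F M x <= f x by rewrite ge_min lexx.
have Fs M : (rho (F M) <= s%:E)%E.
  by apply: le_trans fs; apply: (rho_mono X_ri).
have ndF x : nondecreasing_seq (F^~ x).
  move=> m n mn; rewrite le_min ge_min lexx/= ge_min.
  by apply/orP; right; rewrite ler_nat.
have cvF x : F M x @[M --> \oo] --> f x.
  apply: cvg_near_cst; exists (Num.truncn (f x)) => // M /= hM.
  apply/min_idPl; apply: ltW; apply: lt_le_trans (truncnS_gt _) _.
  by rewrite ler_nat ltnS.
have cvc k : cell_integral (F M) k @[M --> \oo] --> cell_integral f k.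
  have cv := @cvg_monotone_convergence _ _ _ mu (cell @^-1` [set k])
    (@measurable_preimage_cell R [set k]) (fun M x => (F M x)%:E)
    (fun M => @measurable_cell_fun (F M) k (mF M)) (fun M x _ => (mF M).2 x : (0 <= (F M x)%:E)%E)
    (fun x _ m n mn => ndF x m n mn : ((F m x)%:E <= (F n x)%:E)%E).
  apply: fine_cvg; rewrite (cell_integralE _ mf fs).
  have -> : (\int[mu]_(x in cell @^-1` [set k]) (f x)%:E =
      \int[mu]_(x in cell @^-1` [set k]) limn (fun M => (F M x)%:E))%E; last exact: cv.
  apply: eq_integral => x _; apply/esym/cvg_lim => //.
  by apply: cvg_EFin; [exact: nearW|exact: cvF].
apply: (rho_limit X_ri (F := fun M => window_average N (F M) \o cell)).
- by move=> M; apply: Mplus_cell => k; apply: window_average_ge0; exact: (mF M).2.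
- by apply: Mplus_cell => k; exact: window_average_ge0.
- move=> x m n mn /=; rewrite /window_average ler_wpM2l//.
  by apply: cell_integral_le (mF m) (mF n) _ (Fs n) => y; exact: ndF.
- by move=> x; apply: cvgMr; exact: cvc.
- move=> M; apply: (rho_average_bounded X_ri (M := M.+1%:R)) => //.
  by move=> x; rewrite ge_min lexx orbT.
Qed.

End AverageBound.

(** * Norming sequences *)

Section Norming.
Context (R : realType).
Variable tau : (int -> R) -> \bar R.
Hypothesis ht : seq_norm tau.
Variable W : seq int.
Hypotheses (uW : uniq W) (finW : (tau (fun k => (k \in W)%:R) < +oo)%E).
Local Notation m := (size W).

(** The sequence on [W] with values [`|v 0 i|], so that [tau] becomes a sublinear
functional on a finite-dimensional space. *)
Definition spread (v : 'rV[R]_m) (k : int) : R :=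
  \sum_(i < m) `|v 0 i| * (k == nth 0 W i)%:R.

Lemma spread_ge0 v k : 0 <= spread v k.
Proof. by apply: sumr_ge0 => i _; rewrite mulr_ge0. Qed.

Lemma spread_notin v k : k \notin W -> spread v k = 0.
Proof.
move=> kW; rewrite /spread big1// => i _; case: eqP => [kE|_]; last by rewrite mulr0.
by rewrite kE mem_nth in kW.
Qed.

Lemma sum_delta_nth (x : 'I_m -> R) (j : 'I_m) :
  \sum_(i < m) x i * (nth 0 W j == nth 0 W i)%:R = x j.
Proof.
rewrite (bigD1 j)//= eqxx mulr1 big1 ?addr0// => i ij.
rewrite nth_uniq// (_ : (j : nat) == i = false) ?mulr0//.
by apply/negbTE; rewrite eq_sym.
Qed.

Lemma spread_nth v (j : 'I_m) : spread v (nth 0 W j) = `|v 0 j|.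
Proof. exact: (sum_delta_nth (fun i => `|v 0 i|)). Qed.

Lemma mem_nthW k : k \in W -> exists j : 'I_m, k = nth 0 W j.
Proof.
move=> kW; have h : (index k W < m)%N by rewrite index_mem.
by exists (Ordinal h); rewrite /= nth_index.
Qed.

Lemma spread_fin v : tau (spread v) \is a fin_num.
Proof.
have s0 := spread_ge0 v; rewrite ge0_fin_numE ?(sn_ge0 ht)//.
pose c := \sum_(i < m) `|v 0 i|; have c0 : 0 <= c by exact: sumr_ge0.
have w0 (k : int) : 0 <= (k \in W)%:R :> R by [].
apply: (@le_lt_trans _ _ (c%:E * tau (fun k => (k \in W)%:R))%E).
  apply: le_trans (sn_scale ht c0 w0); apply: (sn_mono ht) => // k.
  have [/mem_nthW[j ->]|/spread_notin->] := boolP (k \in W); last by rewrite mulr0.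
  rewrite spread_nth mulr1 /c (bigD1 j)//= lerDl; exact: sumr_ge0.
by rewrite lte_mul_pinfty// ge0_fin_numE ?(sn_ge0 ht).
Qed.

Definition spread_norm v := fine (tau (spread v)).

Lemma spread_normE v : (spread_norm v)%:E = tau (spread v).
Proof. by rewrite fineK// spread_fin. Qed.

Lemma sublinear_spread_norm : sublinear (V := 'rV[R]_m) spread_norm.
Proof.
have sZ c v : 0 <= c -> spread_norm (c *: v) <= c * spread_norm v.
  move=> c0; rewrite -lee_fin EFinM !spread_normE.
  apply: le_trans (sn_scale ht c0 (spread_ge0 v)).
  apply: (sn_mono ht) => k; first exact: spread_ge0.
  rewrite /spread mulr_sumr; apply: ler_sum => i _.
  by rewrite mxE normrM ger0_norm// mulrA.
split=> [v w|c v c0].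
  rewrite -lee_fin EFinD !spread_normE.
  apply: le_trans (sn_add ht (spread_ge0 v) (spread_ge0 w)).
  apply: (sn_mono ht) => k; first exact: spread_ge0.
  rewrite /spread -big_split/=; apply: ler_sum => i _.
  by rewrite -mulrDl mxE ler_wpM2r// ler_normD.
apply/eqP; rewrite eq_le sZ//=; have [->|cn] := eqVneq c 0.
  by rewrite mul0r -lee_fin spread_normE (sn_ge0 ht)//; exact: spread_ge0.
have cp : 0 < c by rewrite lt_def cn.
have ci : 0 <= c^-1 by rewrite invr_ge0.
have := sZ _ (c *: v) ci; rewrite scalerA mulVf ?gt_eqF// scale1r.
by rewrite -ler_pdivlMl// invrK.
Qed.

(** This replaces the equality of a space with its second associate space, for
finitely supported sequences: [b] is given by a linear functional that is
dominated by the norm and attains it at [a]. *)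
Lemma norming (a : int -> R) : exists b : int -> R,
  [/\ forall k, k \notin W -> b k = 0,
      (associate_norm (Zcount R) tau (fun k => `|b k|)%R <= 1)%E &
      (tau (fun k => (k \in W)%:R * `|a k|)%R <= (\sum_(k <- W) a k * b k)%R%:E)%E].
Proof.
have [beta [hb he]] := @hahn_banach_fin R 'rV[R]_m spread_norm 'I_m (index_enum _)
  (fun i => delta_mx 0 i) (fun i => a (nth 0 W i)) sublinear_spread_norm.
have rowE (x : 'I_m -> R) : \sum_i x i *: delta_mx 0 i = \row_i x i :> 'rV[R]_m.
  by rewrite [RHS]row_sum_delta; apply: eq_bigr => i _; rewrite mxE.
pose b (k : int) := \sum_(i < m) beta i * (k == nth 0 W i)%:R.
have bW (j : 'I_m) : b (nth 0 W j) = beta j :> R by exact: sum_delta_nth.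
have bN k : k \notin W -> b k = 0.
  move=> kW; rewrite /b big1// => i _; case: eqP => [kE|_]; last by rewrite mulr0.
  by rewrite kE mem_nth in kW.
have sumW (f : int -> R) : \sum_(k <- W) f k = \sum_(i < m) f (nth 0 W i).
  by rewrite (big_nth 0) big_mkord.
exists b; split => //.
- apply: associate_norm_lub => g g0 tg.
  rewrite (@ge0_integral_Zcount_seq _ W)//; last 2 first.
  + by move=> k; rewrite lee_fin mulr_ge0.
  + by move=> k /bN ->; rewrite normr0 mul0r.
  rewrite sumEFin sumW.
  pose x i := Num.sg (beta i) * g (nth 0 W i).
  have -> : \sum_(i < m) `|b (nth 0 W i)| * g (nth 0 W i) = \sum_(i < m) x i * beta i.
    by apply: eq_bigr => i _; rewrite bW normrEsg /x mulrAC.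
  apply: (@le_trans _ _ (spread_norm (\sum_i x i *: delta_mx 0 i))%:E).
    by rewrite lee_fin hb.
  rewrite spread_normE; apply: le_trans tg; apply: (sn_mono ht) => k; first exact: spread_ge0.
  have [/mem_nthW[j ->]|/spread_notin->//] := boolP (k \in W).
  rewrite spread_nth rowE mxE normrM normr_sg ger0_norm//.
  by case: (beta j != 0); rewrite ?mul1r// mul0r.
- rewrite sumW; under eq_bigr do rewrite bW.
  rewrite he spread_normE le_eqVlt; apply/orP; left; apply/eqP; congr tau.
  apply/funext => k; have [/mem_nthW[j ->]|kW] := boolP (k \in W).
    by rewrite mul1r spread_nth rowE mxE.
  by rewrite mul0r spread_notin.
Qed.

End Norming.

(** * Integrals as limits over bounded sets *)

Section Windows.
Context (R : realType).
Local Notation mu := (@lebesgue_measure R).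
Local Notation cell := (Num.ceil : measurableTypeR R -> int).
Local Notation mR := (measurable_fun [set: measurableTypeR R]).
Implicit Types (h : R -> R).

Definition window_set (N : nat) : set (measurableTypeR R) := cell @^-1` [set` int_window N].

Lemma measurable_window_set N : measurable (window_set N).
Proof. exact: measurable_preimage_cell. Qed.

Lemma window_setE N : window_set N = \big[setU/set0]_(j <- int_window N) cell @^-1` [set j].
Proof. by rewrite /window_set preimage_cell bigcup_seq. Qed.

Lemma integral_window_set h N : mR h ->
  (\int[mu]_(x in window_set N) (h x)%:E =
   \sum_(j <- int_window N) \int[mu]_(x in cell @^-1` [set j]) (h x)%:E)%E.
Proof.
move=> mh; rewrite window_setE integral_bigsetU_EFin//.
- by move=> j; exact: measurable_preimage_cell.
- exact: int_window_uniq.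
- by move=> i j _ _ [x [/= -> ->]].
- by apply: measurable_funTS; exact/measurable_EFinP.
Qed.

Lemma sub_window_set N M : (N <= M)%N -> window_set N `<=` window_set M.
Proof. by move=> NM x; rewrite /window_set/= !mem_int_window => /andP[h1 h2]; apply/andP; lia. Qed.

Lemma window_set_near (x : R) : \forall N \near \oo, window_set N x.
Proof.
exists `|cell x|.+1%N => // N /= hN; rewrite /window_set/= mem_int_window.
by apply/andP; lia.
Qed.

(** Monotone convergence. *)
Lemma ge0_integral_le_windows h (c : R) : mR h -> (forall x, 0 <= h x) ->
  (forall N, (\sum_(j <- int_window N) \int[mu]_(x in cell @^-1` [set j]) (h x)%:E <= c%:E)%E) ->
  (\int[mu]_x (h x)%:E <= c%:E)%E.
Proof.
move=> mh h0 hc.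
pose F (N : nat) (x : measurableTypeR R) := (((EFin \o h) \_ (window_set N)) x).
have mF N : measurable_fun [set: measurableTypeR R] (F N).
  apply/(measurable_restrictT _ (measurable_window_set N)).
  by apply: measurable_funTS; exact/measurable_EFinP.
have F0 N x : (0 <= F N x)%E by rewrite /F patchE; case: ifP => // _; rewrite lee_fin.
have ndF x : nondecreasing_seq (F^~ x).
  move=> N M NM; rewrite /F !patchE; case: ifPn => [xN|_].
    by rewrite ifT//; apply: mem_set; apply: (sub_window_set NM); exact: set_mem.
  by case: ifP => // _; rewrite lee_fin.
have cvF x : F N x @[N --> \oo] --> (h x)%:E.
  apply: cvg_near_cst; apply: filterS (window_set_near x) => N xN.
  by rewrite /F patchE mem_set.
have cvI := @cvg_monotone_convergence _ _ _ mu setT measurableT F mF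
  (fun N x _ => F0 N x) (fun x _ => @ndF x).
have E : (\int[mu]_x (h x)%:E = \int[mu]_x limn (F^~ x))%E.
  by apply: eq_integral => x _; apply/esym/cvg_lim.
rewrite E -(cvg_lim _ cvI)//; apply: lime_le; first exact: (cvgP _ cvI).
apply: nearW => N; apply: le_trans (hc N).
by rewrite -integral_window_set// [leRHS]integral_mkcond.
Qed.

Lemma cvg_window_integral h : mu.-integrable setT (EFin \o h) ->
  (\int[mu]_(x in window_set N) h x)%R @[N --> \oo] --> (\int[mu]_x h x)%R.
Proof.
move=> ih; have mh := measurable_int _ ih.
pose F (N : nat) (x : measurableTypeR R) := (((EFin \o h) \_ (window_set N)) x).
have mF N : measurable_fun [set: measurableTypeR R] (F N).
  apply/(measurable_restrictT _ (measurable_window_set N)).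
  exact: measurable_funTS.
have cvF x : F N x @[N --> \oo] --> (EFin \o h) x.
  apply: cvg_near_cst; apply: filterS (window_set_near x) => N xN.
  by rewrite /F patchE mem_set.
have [|||_ _ cv] := @dominated_convergence _ _ _ mu setT measurableT F (EFin \o h)
  (fun x => `|(EFin \o h) x|%E) mF mh.
- by apply: nearW => x _; exact: cvF.
- exact: integrable_abse.
- apply: nearW => x N _; rewrite /F patchE; case: ifP => // _.
  by rewrite abse0.
rewrite /Rintegral; apply: fine_cvg; rewrite fineK; last exact: integrable_fin_num.
apply: cvg_trans cv; apply: near_eq_cvg; apply: nearW => N.
by rewrite [RHS]integral_mkcond.
Qed.

End Windows.

Lemma cvg_sum_seq (R : realType) (I : Type) (s : seq I) (F : I -> nat -> R) (G : I -> R) :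
  (forall i, F i L @[L --> \oo] --> G i) ->
  (\sum_(i <- s) F i L)%R @[L --> \oo] --> (\sum_(i <- s) G i)%R.
Proof.
move=> FG; elim: s => [|i s IH].
  rewrite big_nil; apply: cvg_near_cst; apply: nearW => L; exact: big_nil.
rewrite big_cons; under eq_fun do rewrite big_cons.
exact: cvgD.
Qed.

(** * From bilinear estimates to integral operators *)

Section Core.
Context (R : realType).
Local Notation mu := (@lebesgue_measure R).
Local Notation cell := (Num.ceil : measurableTypeR R -> int).
Local Notation Mp := (@Mplus _ (measurableTypeR R) R).
Local Notation mR := (measurable_fun [set: measurableTypeR R]).
Context (K : scalars) (rho : (R -> R) -> \bar R).
Hypothesis X_ri : rearrangement_invariant (@lebesgue_measure R) K rho.
Local Notation sigma := (discretized_norm rho).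
Local Notation sigma' := (associate_norm (Zcount R) (discretized_norm rho)).
Implicit Types (k : int -> int -> R) (f : R -> R) (a b : int -> R).

(** The only consequence of the conditions on the indices that is used to bound the
three operators. *)
Definition bilinear_bounded (C : R) := forall k M (S T : seq int) a b x y,
  hilbert_bounded k M -> 0 <= M -> uniq S -> uniq T ->
  (forall j, 0 <= a j) -> (forall j, 0 <= b j) -> 0 < x -> 0 < y ->
  (sigma a <= x%:E)%E -> (sigma' b <= y%:E)%E ->
  `|\sum_(m <- T) \sum_(j <- S) k m j * (a j * b m)| <= C * M * (x * y).

Variable C : R.
Hypotheses (C0 : 0 < C) (BB : bilinear_bounded C).

(** Functions in the space are locally integrable, hence point evaluations are bounded
on sequences. *)
Lemma associate_unit n : exists2 y : R, 0 < y & (sigma' (fun j => (j == n)%:R) <= y%:E)%E.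
Proof.
have [|y y0 hy] := bfn_local X_ri.1 (@measurable_preimage_cell R [set n]).
  by rewrite [ltLHS](mu_cell R n) ltry.
exists y => //; apply: associate_norm_lub => g g0 tg.
have mg := Mplus_cell g0.
rewrite (@ge0_integral_Zcount_seq _ [:: n])//; last 2 first.
- by move=> j; rewrite lee_fin mulr_ge0.
- by move=> j; rewrite inE => /negbTE ->; rewrite mul0r.
rewrite big_seq1 eqxx mul1r.
have := hy _ mg; have -> : (\int[mu]_(x in cell @^-1` [set n]) ((g \o cell) x)%:E = (g n)%:E)%E.
  rewrite (eq_integral (cst (g n)%:E)); last by move=> x /set_mem /= ->.
  by rewrite integral_cst ?[X in (_ * X)%E](mu_cell R n) ?mule1//; exact: measurable_preimage_cell.
move=> /le_trans; apply; rewrite -[leRHS]mule1 lee_wpmul2l ?lee_fin ?(ltW y0)//.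
by rewrite -(discretized_normE X_ri).
Qed.

(** The cell averages of [f] on finitely many cells form a sequence to which the
bilinear estimate applies. *)
Lemma window_average_bound (f : R -> R) s N a : Mp f -> (rho f <= s%:E)%E ->
  (forall j, 0 <= a j) -> (forall j, a j <= window_average N f j) ->
  (sigma a <= (2 * s)%:E)%E.
Proof.
move=> mf fs a0 aw; have w0 j : 0 <= window_average N f j.
  by apply: window_average_ge0; exact: mf.2.
rewrite (discretized_normE X_ri)//; apply: le_trans (rho_average X_ri N mf fs).
apply: (rho_mono X_ri); [exact: Mplus_cell|exact: Mplus_cell|].
by move=> x; exact: aw.
Qed.

(** Testing the bilinear estimate against the unit sequence at [n]; the selection [J]
of cells on which the kernel is nonnegative turns it into absolute convergence. *)
Lemma kernel_integral_bound k M (J : pred int) n f s : hilbert_bounded k M -> 0 <= M ->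
  (forall j, J j -> 0 <= k n j) -> Mp f -> 0 < s -> (rho f <= s%:E)%E ->
  exists c : R, forall N, \sum_(j <- int_window N) (J j)%:R * (k n j * cell_integral f j) <= c.
Proof.
move=> hk M0 kJ mf s0 fs; have [y y0 hy] := associate_unit n.
exists (C * M * ((2 * s) * y)) => N.
pose a j := (J j)%:R * window_average N f j.
have w0 j : 0 <= window_average N f j.
  by apply: window_average_ge0; exact: mf.2.
have a0 j : 0 <= a j by exact: mulr_ge0.
have aw j : a j <= window_average N f j.
  by rewrite /a; case: (J j); rewrite ?mul1r ?mul0r.
have as_ := window_average_bound mf fs a0 aw.
have s20 : 0 < 2 * s by rewrite mulr_gt0.
have e0 j : 0 <= (j == n)%:R :> R by [].
have := BB hk M0 (int_window_uniq N) (isT : uniq [:: n]) a0 e0 s20 y0 as_ hy.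
rewrite big_seq1 eqxx; apply: le_trans; apply: le_trans (ler_norm _).
rewrite big_seq [leRHS]big_seq; apply: ler_sum => j jN.
by rewrite /a /window_average jN; case: (J j); rewrite ?mul1r ?mul0r ?mulr1 ?mulr0.
Qed.

Lemma measurable_kernel_mul k n f : mR f -> mR (fun y => k n (cell y) * f y).
Proof.
by move=> mf; apply: measurable_funM => //; exact: (@measurable_comp_cell R _ _ (k n)).
Qed.

Lemma Rintegral_cell_kernel k n f s j : mR f -> (rho (fun x => `|f x|)%R <= s%:E)%E ->
  (\int[mu]_(y in cell @^-1` [set j]) (k n (cell y) * f y))%R = k n j * cell_integral f j.
Proof.
move=> mf fs.
rewrite (@eq_Rintegral _ _ _ mu _ (fun y => k n j * f y)); last by move=> y /set_mem /= ->.
rewrite RintegralZl//; first exact: measurable_preimage_cell.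
exact: (cell_integrable X_ri j mf fs).
Qed.

Lemma kernel_part_integrable k M (J : pred int) n f s : hilbert_bounded k M -> 0 <= M ->
  (forall j, J j -> 0 <= k n j) -> mR f -> 0 < s -> (rho (fun x => `|f x|)%R <= s%:E)%E ->
  (\int[mu]_y ((J (cell y))%:R * (k n (cell y) * `|f y|))%:E < +oo)%E.
Proof.
move=> hk M0 kJ mf s0 fs.
have ma := Mplus_abs mf.
have [c hc] := kernel_integral_bound hk M0 kJ ma s0 fs.
pose k' (i j : int) := (J j)%:R * k n j.
have k'0 j : 0 <= k' n j by rewrite /k'; case: (boolP (J j)) => [/kJ ?|_]; rewrite ?mul1r ?mul0r.
apply: (@le_lt_trans _ _ c%:E); last exact: ltry.
under eq_integral do rewrite mulrA.
apply: (@ge0_integral_le_windows R (fun y => k' n (cell y) * `|f y|)).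
- by apply: measurable_kernel_mul; exact: ma.1.
- by move=> y; apply: mulr_ge0.
move=> N; apply: le_trans (hc N : (_%:E <= c%:E)%E).
rewrite -sumEFin; apply: lee_sum => j _.
rewrite mulrA -/(k' n j) -(@Rintegral_cell_kernel k' n _ s j ma.1); last first.
  by under [X in rho X]eq_fun do rewrite normr_id.
rewrite /Rintegral fineK//.
have ic : mu.-integrable (cell @^-1` [set j]) (EFin \o (fun y => k' n (cell y) * `|f y|)).
  have := @cell_integrable R K rho X_ri _ s j ma.1.
  under [X in rho X]eq_fun do rewrite normr_id.
  move=> /(_ fs) ic; apply: (eq_integrable (measurable_preimage_cell _)
    (fun y => (k' n j)%:E * (`|f y|)%:E)%E); last by apply: integrableZl => //; exact: measurable_preimage_cell.
  by move=> y /set_mem /= yj; rewrite yj EFinM.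
by apply: integrable_fin_num; [exact: measurable_preimage_cell|exact: ic].
Qed.

(** Absolute convergence, obtained separately on the cells where the kernel is
nonnegative and on those where it is not. *)
Lemma kernel_integrable k M (J : pred int) n f s : hilbert_bounded k M -> 0 <= M ->
  (forall j, J j -> 0 <= k n j) -> (forall j, ~~ J j -> k n j <= 0) ->
  mR f -> 0 < s -> (rho (fun x => `|f x|)%R <= s%:E)%E ->
  mu.-integrable setT (fun y => (k n (cell y) * f y)%:E).
Proof.
move=> hk M0 kJ kJ' mf s0 fs; apply/integrableP; split.
  by apply/measurable_EFinP; exact: measurable_kernel_mul.
have hkN : hilbert_bounded (fun i j => - k i j) M.
  move=> E F uE uF; under eq_bigr do rewrite sumrN.
  by rewrite sumrN normrN; exact: hk.
have ma := Mplus_abs mf.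
have h1 := kernel_part_integrable hk M0 kJ mf s0 fs.
have kJN j : ~~ J j -> 0 <= - k n j by move=> /kJ'; rewrite oppr_ge0.
have h2 := @kernel_part_integrable (fun i j => - k i j) M (predC J) n f s hkN M0 kJN mf s0 fs.
have E y : `|k n (cell y) * f y| = (J (cell y))%:R * (k n (cell y) * `|f y|) +
   (predC J (cell y))%:R * (- k n (cell y) * `|f y|).
  rewrite normrM /=; case: (boolP (J (cell y))) => [/kJ h|/kJ' h]/=.
    by rewrite ger0_norm// mul1r mul0r addr0.
  by rewrite ler0_norm// mul1r mul0r add0r.
under eq_integral do rewrite abse_EFin E EFinD.
rewrite ge0_integralD//.
- by rewrite lte_add_pinfty.
- move=> y _; rewrite lee_fin; case: (boolP (J (cell y))) => [/kJ h|_]; last by rewrite mul0r.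
  by rewrite mul1r mulr_ge0.
- apply/measurable_EFinP; apply: measurable_funM.
    exact: (@measurable_comp_cell R _ _ (fun j => (J j)%:R : R)).
  by apply: measurable_kernel_mul; exact: ma.1.
- move=> y _; rewrite lee_fin /=; case: (boolP (J (cell y))) => [_|/kJ' h]; first by rewrite mul0r.
  by rewrite mul1r mulr_ge0// oppr_ge0.
- apply/measurable_EFinP; apply: measurable_funM.
    exact: (@measurable_comp_cell R _ _ (fun j => (~~ J j)%:R : R)).
  by apply: (@measurable_kernel_mul (fun i j => - k i j)); exact: ma.1.
Qed.

(** Splitting both sequences into positive and negative parts costs a factor 4. *)
Lemma bilinear_signed k M S T a b x y : hilbert_bounded k M -> 0 <= M -> uniq S -> uniq T ->
  0 < x -> 0 < y -> (sigma (fun j => `|a j|)%R <= x%:E)%E ->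
  (sigma' (fun j => `|b j|)%R <= y%:E)%E ->
  `|\sum_(m <- T) \sum_(j <- S) k m j * (a j * b m)| <= 4 * (C * M * (x * y)).
Proof.
move=> hk M0 uS uT x0 y0 ax bY.
have ht := discretized_seq_norm X_ri; have ht' := associate_seq_norm ht.
pose p (z : int -> R) j := Num.max (z j) 0; pose n (z : int -> R) j := Num.max (- z j) 0.
have p0 z j : 0 <= p z j by rewrite le_max lexx orbT.
have n0 z j : 0 <= n z j by rewrite le_max lexx orbT.
have pa z j : p z j <= `|z j| by rewrite ge_max ler_norm normr_ge0.
have na z j : n z j <= `|z j| by rewrite ge_max -normrN ler_norm normr_ge0.
have pnE z j : z j = p z j - n z j.
  by rewrite /p /n; case: (leP (z j) 0) => h; rewrite maxEle; case: leP; lra.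
have sp := le_trans (sn_mono ht (p0 a) (pa a)) ax.
have sn := le_trans (sn_mono ht (n0 a) (na a)) ax.
have tp := le_trans (sn_mono ht' (p0 b) (pa b)) bY.
have tn := le_trans (sn_mono ht' (n0 b) (na b)) bY.
pose B a b := \sum_(m <- T) \sum_(j <- S) k m j * (a j * b m).
have -> : \sum_(m <- T) \sum_(j <- S) k m j * (a j * b m) =
   B (p a) (p b) - B (p a) (n b) - B (n a) (p b) + B (n a) (n b).
  rewrite /B -!sumrB -big_split/=; apply: eq_bigr => m _.
  rewrite -!sumrB -big_split/=; apply: eq_bigr => j _.
  by rewrite {1}(pnE a) {1}(pnE b); ring.
pose Z := C * M * (x * y); rewrite -/Z.
have h1 : `|B (p a) (p b)| <= Z := BB hk M0 uS uT (p0 a) (p0 b) x0 y0 sp tp.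
have h2 : `|B (p a) (n b)| <= Z := BB hk M0 uS uT (p0 a) (n0 b) x0 y0 sp tn.
have h3 : `|B (n a) (p b)| <= Z := BB hk M0 uS uT (n0 a) (p0 b) x0 y0 sn tp.
have h4 : `|B (n a) (n b)| <= Z := BB hk M0 uS uT (n0 a) (n0 b) x0 y0 sn tn.
move: h1 h2 h3 h4; rewrite !ler_norml.
move: (B _ _) (B (p a) (n b)) (B (n a) (p b)) (B (n a) (n b)) Z => B1 B2 B3 B4 Z.
by move=> /andP[? ?] /andP[? ?] /andP[? ?] /andP[? ?]; apply/andP; split; lra.
Qed.

(** The values of the integral depend only on the cell of [x], so the norm can be
computed by duality: on a window of cells a norming sequence [b] reduces it to the
bilinear form of the kernel at [b] and the cell averages of [f]. The constant 8 is
4 for the signs times 2 for the averages. *)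
Lemma kernel_bounded k M f s : hilbert_bounded k M -> 0 <= M ->
  mR f -> 0 < s -> (rho (fun x => `|f x|)%R <= s%:E)%E ->
  (forall n, mu.-integrable setT (fun y => (k n (cell y) * f y)%:E)) ->
  (rho (fun x => `|\int[mu]_y (k (cell x) (cell y) * f y)|)%R <= (8 * C * M * s)%:E)%E.
Proof.
move=> hk M0 mf s0 fs ik.
have ht := discretized_seq_norm X_ri; have ht' := associate_seq_norm ht.
pose t n := (\int[mu]_y (k n (cell y) * f y))%R.
have mw N : Mp (fun x => (cell x \in int_window N)%:R * `|t (cell x)|).
  by apply: (@Mplus_cell R (fun j => (j \in int_window N)%:R * `|t j|)) => j; exact: mulr_ge0.
apply: (rho_limit X_ri (F := fun N x => (cell x \in int_window N)%:R * `|t (cell x)|)) => //.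
- exact: (@Mplus_cell R (fun j => `|t j|)).
- move=> x N N' NN /=; rewrite ler_wpM2r// ler_nat.
  by case: (boolP (cell x \in int_window N)) => // h; rewrite lt0b; exact: (@sub_window_set R _ _ NN x h).
- move=> x; apply: cvg_near_cst; apply: filterS (window_set_near x) => N xN.
  by rewrite (_ : cell x \in _) ?mul1r.
move=> N.
have finW : (sigma (fun j => (j \in int_window N)%:R) < +oo)%E.
  by rewrite (discretized_normE X_ri)//; exact: (window_indicator_fin X_ri N).
have [b [bN b1 hb]] := norming ht (int_window_uniq N) finW t.
rewrite (discretized_normE X_ri) in hb; last by move=> j; exact: mulr_ge0.
apply: le_trans hb _; rewrite lee_fin.
have cv : (\sum_(n <- int_window N) (\sum_(j <- int_window L) k n j * (cell_integral f j * b n)))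
   @[L --> \oo] --> \sum_(n <- int_window N) t n * b n.
  apply: cvg_sum_seq => n.
  have cvt := cvg_window_integral (ik n).
  have -> : (fun L => \sum_(j <- int_window L) k n j * (cell_integral f j * b n)) =
     (fun L => (\int[mu]_(y in window_set L) (k n (cell y) * f y))%R * b n).
    apply/funext => L; rewrite [in RHS]/Rintegral integral_window_set; last exact: measurable_kernel_mul.
    rewrite -sum_fine; last first.
      move=> j _; apply: integrable_fin_num; first exact: measurable_preimage_cell.
      apply: integrableS (ik n) => //; exact: measurable_preimage_cell.
    rewrite mulr_suml; apply: eq_bigr => j _.
    by rewrite mulrA; congr (_ * _); rewrite -(@Rintegral_cell_kernel k n f s j mf fs).
  exact: cvgMl.
rewrite -(cvg_lim _ cv)//; apply: limr_le; first exact: (cvgP _ cv).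
apply: nearW => L.
pose c j := (j \in int_window L)%:R * cell_integral f j.
have -> : \sum_(n <- int_window N) \sum_(j <- int_window L) k n j * (cell_integral f j * b n) =
    \sum_(n <- int_window N) \sum_(j <- int_window L) k n j * (c j * b n).
  apply: eq_bigr => n _; rewrite big_seq [RHS]big_seq; apply: eq_bigr => j jL.
  by rewrite /c jL mul1r.
have s20 : 0 < 2 * s by rewrite mulr_gt0.
have cs : (sigma (fun j => `|c j|)%R <= (2 * s)%:E)%E.
  apply: (window_average_bound (N := L) (Mplus_abs mf) fs) => // j.
  rewrite /c /window_average normrM normr_nat ler_wpM2l//.
  apply: le_normr_Rintegral; first exact: measurable_preimage_cell.
  exact: (cell_integrable X_ri j mf fs).
have := bilinear_signed hk M0 (int_window_uniq L) (int_window_uniq N) s20 ltr01 cs b1.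
by move=> /(le_trans (ler_norm _)) /le_trans; apply; lra.
Qed.

End Core.

(** * Complex-valued functions *)

Section FromRealScalars.
Context d (T : measurableType d) (R : realType) (mu : {measure set T -> \bar R}).
Variable nu : (T -> R) -> \bar R.
Local Notation Mp := (@Mplus _ T R).
Hypothesis nu_mono : forall f g, Mp f -> Mp g -> (forall x, f x <= g x) -> (nu f <= nu g)%E.
Hypothesis nu_add : forall f g, Mp f -> Mp g ->
  (nu (fun x => f x + g x)%R <= nu f + nu g)%E.
Hypothesis nu_ge0 : forall f, Mp f -> (0 <= nu f)%E.

Definition real_operator (D : T -> set T) (k : T -> T -> R) (g : T -> R) (x : T) : R :=
  (\int[mu]_(y in D x) (k x y * g y))%R.

(** Stated for all [s] above the norm of [g], so that nothing is divided by a norm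
that may be 0. *)
Definition real_bounded (D : T -> set T) (k : T -> T -> R) (C : R) :=
  forall (g : T -> R) s, measurable_fun setT g -> 0 < s ->
    (nu (fun x => `|g x|)%R <= s%:E)%E ->
    [/\ forall x, mu.-integrable (D x) (EFin \o (fun y => k x y * g y)),
        measurable_fun setT (real_operator D k g) &
        (nu (fun x => `|real_operator D k g x|)%R <= (C * s)%:E)%E].

Lemma Re_realM (a : R) (z : R[i]) : complex.Re (a%:C%C * z) = a * complex.Re z.
Proof. by case: z => b c; rewrite /= mul0r subr0. Qed.

Lemma Im_realM (a : R) (z : R[i]) : complex.Im (a%:C%C * z) = a * complex.Im z.
Proof. by case: z => b c; rewrite /= mul0r addr0. Qed.

Lemma Re_integral_operator D k f x :
  complex.Re (integral_operator mu D k f x) = real_operator D k (fun y => complex.Re (f y)) x.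
Proof. by rewrite /=; apply: eq_Rintegral => y _; exact: Re_realM. Qed.

Lemma Im_integral_operator D k f x :
  complex.Im (integral_operator mu D k f x) = real_operator D k (fun y => complex.Im (f y)) x.
Proof. by rewrite /=; apply: eq_Rintegral => y _; exact: Im_realM. Qed.

Lemma Mplus_cabs (f : T -> R[i]) :
  measurable_fun setT (fun x => complex.Re (f x) : R) ->
  measurable_fun setT (fun x => complex.Im (f x) : R) -> Mp (fun x => cabs (f x)).
Proof.
move=> mr mi; split => [|x]; last exact: cabs_ge0.
have -> : (fun x => cabs (f x)) =
    (fun x => Num.sqrt (complex.Re (f x) ^+ 2 + complex.Im (f x) ^+ 2)).
  by apply/funext => x; rewrite /cabs; case: (f x).
apply: (@measurableT_comp _ _ _ _ _ _ (@Num.sqrt R)).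
  by apply: continuous_measurable_fun; exact: sqrt_continuous.
by apply: measurable_funD; exact: measurable_funX.
Qed.

Lemma Mplus_norm (g : T -> R) : measurable_fun setT g -> Mp (fun x => `|g x|).
Proof. by move=> mg; split => [|x]; [exact: measurableT_comp|]. Qed.

(** The kernel is real, so it acts on real and imaginary parts separately. The slack
[e] covers functions of norm 0. *)
Lemma bounded_of_real K D k C : 0 <= C -> real_bounded D k C ->
  bounded_integral_operator mu K nu D k.
Proof.
move=> C0 hC; exists (2 * C) => f [[mr mi mK] fin].
have ma := Mplus_cabs mr mi.
have bound s : 0 < s -> (bfs_norm nu f <= s%:E)%E ->
    [/\ forall x, cintegrable mu (D x) (fun y => (k x y)%:C%C * f y),
        measurable_fun setT (fun x => complex.Re (integral_operator mu D k f x) : R),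
        measurable_fun setT (fun x => complex.Im (integral_operator mu D k f x) : R) &
        (bfs_norm nu (integral_operator mu D k f) <= (2 * C * s)%:E)%E].
  move=> s0 fs.
  have [ir or br] := hC _ s mr s0 (le_trans (nu_mono (Mplus_norm mr) ma (fun x => normRe_le_cabs (f x))) fs).
  have [ii oi bi] := hC _ s mi s0 (le_trans (nu_mono (Mplus_norm mi) ma (fun x => normIm_le_cabs (f x))) fs).
  have ER : (fun x => complex.Re (integral_operator mu D k f x)) = real_operator D k (fun y => complex.Re (f y)).
    by apply/funext => x; exact: Re_integral_operator.
  have EI : (fun x => complex.Im (integral_operator mu D k f x)) = real_operator D k (fun y => complex.Im (f y)).
    by apply/funext => x; exact: Im_integral_operator.
  have mR' : measurable_fun setT (fun x => complex.Re (integral_operator mu D k f x) : R) by rewrite ER.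
  have mI' : measurable_fun setT (fun x => complex.Im (integral_operator mu D k f x) : R) by rewrite EI.
  split => //.
    move=> x; split.
      by have := ir x; congr (mu.-integrable _ _); apply/funext => y; rewrite /= -Re_realM.
    by have := ii x; congr (mu.-integrable _ _); apply/funext => y; rewrite /= -Im_realM.
  have m1 := Mplus_norm or; have m2 := Mplus_norm oi.
  have m12 : Mp (fun x => `|real_operator D k (fun y => complex.Re (f y)) x| +
      `|real_operator D k (fun y => complex.Im (f y)) x|).
    split => [|x]; last exact: addr_ge0.
    by apply: measurable_funD; [exact: m1.1|exact: m2.1].
  apply: le_trans (nu_mono (Mplus_cabs mR' mI') m12 _) _.
    by move=> x; rewrite -Re_integral_operator -Im_integral_operator; exact: cabs_le.
  apply: le_trans (nu_add m1 m2) _.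
  have -> : 2 * C * s = C * s + C * s by ring.
  by rewrite EFinD leeD.
have n0 := nu_ge0 ma.
pose r := fine (bfs_norm nu f).
have rE : bfs_norm nu f = r%:E by rewrite fineK// ge0_fin_numE.
have r0 : 0 <= r by exact: fine_ge0.
have b1 e : 0 < e -> (bfs_norm nu f <= (r + e)%:E)%E by move=> e0; rewrite rE lee_fin; lra.
have r1 : 0 < r + 1 by lra.
have [i1 i2 i3 i4] := bound _ r1 (b1 _ ltr01).
split.
- exact: aeW.
- split; last by apply: le_lt_trans i4 _; rewrite ltry.
  split => // KR x; rewrite Im_integral_operator /real_operator.
  under eq_Rintegral do rewrite mK// mulr0.
  by rewrite /Rintegral integral0.
- rewrite rE; apply/lee_addgt0Pr => e e0.
  pose e' := e / (2 * C + 1).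
  have e'0 : 0 < e' by apply: divr_gt0; lra.
  have re0 : 0 < r + e' by lra.
  have [_ _ _ h] := bound _ re0 (b1 _ e'0).
  apply: le_trans h _; rewrite -EFinM -EFinD lee_fin mulrDr lerD2l.
  rewrite /e' mulrCA ger_pMr// ler_pdivrMr; lra.
Qed.

End FromRealScalars.

(** * Comparison with the half kernel *)

Section Transfer.
Context (R : realType).
Local Notation mu := (@lebesgue_measure R).
Local Notation mT := (measurableTypeR R).
Local Notation cell := (Num.ceil : measurableTypeR R -> int).
Local Notation Mp := (@Mplus _ (measurableTypeR R) R).
Local Notation mR := (measurable_fun [set: measurableTypeR R]).
Local Notation hk := (@half_kernel R).

Lemma measurable_invr : mR (fun x : R => x^-1).
Proof.
have m0 : measurable ([set 0] : set mT) by exact: measurable_set1.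
rewrite -(setUv [set 0 : mT]) measurable_funU//; last exact: measurableC.
split; first exact: measurable_fun_set1.
apply: open_continuous_measurable_fun; first by apply: closed_openC; exact: (@closed_eq R 0).
by move=> x /set_mem /eqP x0; exact: inv_continuous.
Qed.

(** The theorem of Tonelli, for the positive and the negative part. *)
Lemma measurable_Rintegral_param (Kr : R -> R -> R) (g : R -> R) :
  measurable_fun [set: mT * mT] (fun z : mT * mT => Kr z.1 z.2) -> mR g ->
  mR (fun x => \int[mu]_y (Kr x y * g y))%R.
Proof.
move=> mK mg.
pose F (z : mT * mT) : \bar R := (Kr z.1 z.2 * g z.2)%:E.
have mF : measurable_fun [set: mT * mT] F.
  apply/measurable_EFinP; apply: measurable_funM => //.
  exact: (measurableT_comp mg measurable_snd).
have -> : (fun x => \int[mu]_y (Kr x y * g y))%R =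
    fine \o (fun x => fubini_F mu (F^\+)%E x - fubini_F mu (F^\-)%E x)%E.
  apply/funext => x; rewrite /= /Rintegral; congr fine.
  rewrite integralE /fubini_F; congr (_ - _)%E; apply: eq_integral => y _.
    by rewrite !funeposE.
  by rewrite !funenegE.
apply: (measurableT_comp (@fine_measurable R setT measurableT)).
apply: emeasurable_funB.
  apply: measurable_fun_fubini_tonelli_F => [|z]; last exact: funepos_ge0.
  exact: measurable_funepos.
apply: measurable_fun_fubini_tonelli_F => [|z]; last exact: funeneg_ge0.
exact: measurable_funeneg.
Qed.

(** When the cells of [x] and [y] coincide or touch, the square of the half kernel is
bounded below, so any bounded kernel is absorbed by the error term. *)
Lemma half_kernel_near (n : int) : (`|n| <= 1)%N -> 1 + `|hk n| <= 12 * hk n ^+ 2.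
Proof.
move=> n1; have [->|[->|->]] : n = 0 \/ n = 1 \/ n = -1 by lia.
- have -> : hk 0 = - 2 by rewrite /half_kernel sub0r invrN invrK.
  by rewrite normrN ger0_norm//; nra.
- have -> : hk 1 = 2.
    rewrite /half_kernel; have -> : 1%:~R - 2^-1 = 2^-1 :> R by rewrite rmorph1; lra.
    by rewrite invrK.
  by rewrite ger0_norm//; nra.
- have -> : hk (-1) = - (2 / 3).
    rewrite /half_kernel; have -> : (-1)%:~R - 2^-1 = - (3 / 2) :> R by rewrite rmorphN/=; lra.
    by rewrite invrN invf_div.
  by rewrite normrN ger0_norm; nra.
Qed.

Lemma cell_diff (x y : R) : (cell x - cell y - 1)%:~R < x - y < (cell x - cell y + 1)%:~R.
Proof.
have /andP[] := ceil_itv x; have /andP[] := ceil_itv y.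
rewrite !rmorphD/= !rmorphN/= => h1 h2 h3 h4; apply/andP; split; lra.
Qed.

(** The difference of the two kernels is [O(1 / n ^ 2)]. *)
Lemma half_kernel_far (x y : R) : (2 <= `|(cell x - cell y)%R|)%N ->
  `|(x - y)^-1 - hk (cell x - cell y)| <= 12 * hk (cell x - cell y) ^+ 2.
Proof.
have := cell_diff x y; move: (cell x - cell y) (x - y) => n u.
rewrite rmorphB rmorphD/= => /andP[u1 u2] n2.
have zz : (2 : R) <= n%:~R \/ n%:~R <= (-2 : R).
  have : (2 <= n) || (n <= -2) by lia.
  by case/orP; rewrite -(ler_int R) ?rmorphN/= => h; [left|right].
rewrite /half_kernel; move: (n%:~R) u1 u2 zz => z u1 u2 zz.
have h0 : z - 2^-1 != 0 by case: zz => h; [rewrite gt_eqF|rewrite lt_eqF]; lra.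
have u0 : u != 0 by case: zz => h; [rewrite gt_eqF|rewrite lt_eqF]; lra.
have -> : u^-1 - (z - 2^-1)^-1 = (z - 2^-1 - u) * u^-1 * (z - 2^-1)^-1.
  by move: h0; move: (2^-1) => c h0; field; rewrite u0 h0.
rewrite exprVn.
have -> : 12 * ((z - 2^-1) ^+ 2)^-1 = (12 * `|z - 2^-1|^-1) * `|z - 2^-1|^-1.
  by rewrite -mulrA -expr2 exprVn real_normK ?num_real.
rewrite !normrM !normfV ler_wpM2r ?invr_ge0//.
rewrite ler_pdivrMr ?normr_gt0// mulrAC ler_pdivlMr ?normr_gt0//.
have hd : `|z - 2^-1 - u| <= 3 / 2 by rewrite ler_norml; apply/andP; split; lra.
apply: (@le_trans _ _ (3 / 2 * `|z - 2^-1|)); first by rewrite ler_wpM2r.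
case: zz => h; first by rewrite !ger0_norm; lra.
by rewrite !ler0_norm; lra.
Qed.

End Transfer.

Section TransferPrinciple.
Context (R : realType).
Local Notation mu := (@lebesgue_measure R).
Local Notation mT := (measurableTypeR R).
Local Notation cell := (Num.ceil : measurableTypeR R -> int).
Local Notation Mp := (@Mplus _ (measurableTypeR R) R).
Local Notation mR := (measurable_fun [set: measurableTypeR R]).
Local Notation hk := (@half_kernel R).
Context (K : scalars) (rho : (R -> R) -> \bar R).
Hypothesis X_ri : rearrangement_invariant (@lebesgue_measure R) K rho.
Variable C : R.
Hypotheses (C0 : 0 < C) (BB : bilinear_bounded rho C).

Lemma half_kernel_integrable n (f : R -> R) s : mR f -> 0 < s ->
  (rho (fun x => `|f x|)%R <= s%:E)%E ->
  mu.-integrable setT (fun y => (hk (n - cell y) * f y)%:E).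
Proof.
move=> mf s0 fs.
apply: (@kernel_integrable R K rho X_ri C BB (fun i j => hk (i - j)) 26
  (fun j => j < n) n f s (@half_kernel_hilbert_bounded R)) => //.
  move=> j jn; rewrite /half_kernel invr_ge0 subr_ge0.
  have : 1 <= n - j by lia.
  by rewrite -(ler_int R) => h; apply: le_trans h; lra.
move=> j; rewrite -leNgt => nj; rewrite /half_kernel invr_le0 subr_le0.
have : n - j <= 0 by lia.
by rewrite -(ler_int R) => h; apply: le_trans h _; lra.
Qed.

Lemma half_kernel_sqr_integrable n (f : R -> R) s : mR f -> 0 < s ->
  (rho (fun x => `|f x|)%R <= s%:E)%E ->
  mu.-integrable setT (fun y => (hk (n - cell y) ^+ 2 * f y)%:E).
Proof.
move=> mf s0 fs.
apply: (@kernel_integrable R K rho X_ri C BB (fun i j => hk (i - j) ^+ 2) 20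
  predT n f s (@half_kernel_sqr_hilbert_bounded R)) => // j _.
exact: sqr_ge0.
Qed.

Definition transfer_constant : R := 8 * C * 26 + 8 * C * 26 + 12 * (8 * C * 20).

(** The main part of the kernel is the half kernel between two bounded multipliers,
and the error has a kernel dominated by the square of the half kernel; both
kernels are [hilbert_bounded]. *)
Lemma transfer (D : R -> set R) (k : R -> R -> R) (u1 u2 v1 v2 : R -> R) :
  (forall x, measurable (D x : set mT)) ->
  measurable_fun [set: mT * mT] (fun z : mT * mT => (k z.1 \_ (D z.1)) z.2) ->
  mR v1 -> mR v2 ->
  (forall x, `|u1 x| <= 1) -> (forall x, `|u2 x| <= 1) ->
  (forall x, `|v1 x| <= 1) -> (forall x, `|v2 x| <= 1) ->
  (forall x y, `|(k x \_ (D x)) y - (u1 x * v1 y + u2 x * v2 y) * hk (cell x - cell y)| <=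
     12 * hk (cell x - cell y) ^+ 2) ->
  @real_bounded _ mT R mu rho D k transfer_constant.
Proof.
move=> mD mk mv1 mv2 u11 u21 v11 v21 near g s mg s0 gs.
have small (v : R -> R) : mR v -> (forall x, `|v x| <= 1) ->
    mR (fun y => v y * g y) /\ (rho (fun y => `|v y * g y|)%R <= s%:E)%E.
  move=> mv v1'; have mvg : mR (fun y => v y * g y) by exact: measurable_funM.
  split => //; apply: le_trans gs; apply: (rho_mono X_ri); [exact: Mplus_abs|exact: Mplus_abs|].
  by move=> x; rewrite normrM ler_piMl.
have [m1 s1] := small _ mv1 v11; have [m2 s2] := small _ mv2 v21.
have ma : mR (fun y => `|g y|) by exact: measurableT_comp.
have sa : (rho (fun y => `| `|g y| |)%R <= s%:E)%E.
  by under [X in rho X]eq_fun do rewrite normr_id.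
have i1 n := half_kernel_integrable n m1 s0 s1.
have i2 n := half_kernel_integrable n m2 s0 s2.
have i3 n := half_kernel_sqr_integrable n ma s0 sa.
pose kr x y := (k x \_ (D x)) y.
pose H1 x := (\int[mu]_y (hk (cell x - cell y) * (v1 y * g y)))%R.
pose H2 x := (\int[mu]_y (hk (cell x - cell y) * (v2 y * g y)))%R.
pose H3 x := (\int[mu]_y (hk (cell x - cell y) ^+ 2 * `|g y|))%R.
have mkr x : mR (kr x).
  exact: (measurableT_comp mk (pair1_measurable x)).
pose main x y := u1 x * (hk (cell x - cell y) * (v1 y * g y)) + u2 x * (hk (cell x - cell y) * (v2 y * g y)).
have imain x : mu.-integrable setT (EFin \o main x).
  have -> : EFin \o main x = (fun y => (u1 x)%:E * (hk (cell x - cell y) * (v1 y * g y))%:E +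
     (u2 x)%:E * (hk (cell x - cell y) * (v2 y * g y))%:E)%E by [].
  by apply: integrableD => //; apply: integrableZl.
pose err x y := kr x y * g y - main x y.
have merr x : mR (err x).
  apply: measurable_funB; first by apply: measurable_funM.
  by have /measurable_int/measurable_EFinP := imain x.
have errle x y : `|err x y| <= 12 * (hk (cell x - cell y) ^+ 2 * `|g y|).
  rewrite mulrA; have := near x y => h.
  have -> : err x y = (kr x y - (u1 x * v1 y + u2 x * v2 y) * hk (cell x - cell y)) * g y.
    by rewrite /err /main; ring.
  by rewrite normrM ler_wpM2r.
have i3' x : mu.-integrable setT (EFin \o (fun y => 12 * (hk (cell x - cell y) ^+ 2 * `|g y|))).
  have -> : EFin \o (fun y => 12 * (hk (cell x - cell y) ^+ 2 * `|g y|)) =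
    (fun y => 12%:E * (hk (cell x - cell y) ^+ 2 * `|g y|)%:E)%E by [].
  exact: integrableZl.
have ierr x : mu.-integrable setT (EFin \o err x).
  apply: (le_integrable _ _ _ (i3' x)) => //; first exact/measurable_EFinP.
  by move=> y _; rewrite lee_fin; apply: le_trans (errle x y) (ler_norm _).
have krE x : (fun y => kr x y * g y) = (fun y => main x y + err x y).
  by apply/funext => y; rewrite /err addrC subrK.
have ikr x : mu.-integrable setT (EFin \o (fun y => kr x y * g y)).
  have -> : EFin \o (fun y => kr x y * g y) = (fun y => (EFin \o main x) y + (EFin \o err x) y)%E.
    by rewrite krE.
  exact: integrableD.
have patchM x : (fun y => k x y * g y) \_ (D x) = (fun y => kr x y * g y).
  by apply/funext => y; rewrite /kr !patchE; case: ifP => // _; rewrite mul0r.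
have opE x : real_operator mu D k g x = (\int[mu]_y (kr x y * g y))%R.
  by rewrite /real_operator Rintegral_mkcond patchM.
have ptw x : `|real_operator mu D k g x| <= `|H1 x| + `|H2 x| + 12 * H3 x.
  rewrite opE krE RintegralD//.
  have -> : (\int[mu]_y main x y)%R = u1 x * H1 x + u2 x * H2 x.
    have j1 : mu.-integrable setT (EFin \o (fun y => u1 x * (hk (cell x - cell y) * (v1 y * g y)))).
      exact: (integrableZl measurableT (u1 x) (i1 (cell x))).
    have j2 : mu.-integrable setT (EFin \o (fun y => u2 x * (hk (cell x - cell y) * (v2 y * g y)))).
      exact: (integrableZl measurableT (u2 x) (i2 (cell x))).
    rewrite /main RintegralD// (RintegralZl (u1 x) measurableT (i1 (cell x))).
    by rewrite (RintegralZl (u2 x) measurableT (i2 (cell x))).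
  apply: le_trans (ler_normD _ _) (lerD _ _).
    by apply: le_trans (ler_normD _ _) (lerD _ _); rewrite normrM ler_piMl.
  apply: le_trans (le_normr_Rintegral _ (ierr x)) _ => //.
  rewrite -RintegralZl//; last exact: i3.
  apply: le_Rintegral => //.
  by apply: (le_integrable _ _ _ (i3' x)) => //; [apply/measurable_EFinP; exact: measurableT_comp|move=> y _; rewrite lee_fin normr_id; exact: le_trans (errle x y) (ler_norm _)].
have kb := @kernel_bounded R K rho X_ri C BB.
have b1 := kb (fun i j => hk (i - j)) 26 _ s (@half_kernel_hilbert_bounded R) ltac:(lra) m1 s0 s1 i1.
have b2 := kb (fun i j => hk (i - j)) 26 _ s (@half_kernel_hilbert_bounded R) ltac:(lra) m2 s0 s2 i2.
have b3 := kb (fun i j => hk (i - j) ^+ 2) 20 _ s (@half_kernel_sqr_hilbert_bounded R) ltac:(lra) ma s0 sa i3.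
have mop : mR (real_operator mu D k g).
  have -> : real_operator mu D k g = (fun x => \int[mu]_y (kr x y * g y))%R by apply/funext.
  exact: measurable_Rintegral_param.
split => //.
  move=> x; apply/(integrable_mkcond _ (mD x)); have := ikr x.
  congr (mu.-integrable _ _); apply/funext => y.
  by rewrite /= !patchE /kr patchE; case: ifP => // _; rewrite mul0r.
have M1 : Mp (fun x => `|H1 x|) by exact: (@Mplus_cell R (fun n => `|(\int[mu]_y (hk (n - cell y) * (v1 y * g y)))%R|)).
have M2 : Mp (fun x => `|H2 x|) by exact: (@Mplus_cell R (fun n => `|(\int[mu]_y (hk (n - cell y) * (v2 y * g y)))%R|)).
have M3 : Mp (fun x => `|H3 x|) by exact: (@Mplus_cell R (fun n => `|(\int[mu]_y (hk (n - cell y) ^+ 2 * `|g y|))%R|)).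
have M3' : Mp (fun x => 12 * `|H3 x|) by exact: MplusZ.
have M12 := MplusD M1 M2; have M123 := MplusD M12 M3'.
apply: le_trans (rho_mono X_ri (Mplus_abs mop) M123 _) _.
  by move=> x; apply: le_trans (ptw x) _; rewrite lerD2l ler_wpM2l// ler_norm.
have b12 := rhoD_le X_ri M1 M2 b1 b2.
have b3' := rhoZ_le X_ri (ler0n R 12) M3 b3.
apply: le_trans (rhoD_le X_ri M12 M3' b12 b3') _; rewrite lee_fin /transfer_constant; lra.
Qed.

End TransferPrinciple.

(** * The three operators under a bilinear estimate *)

Section Sufficiency.
Context (R : realType).
Local Notation mu := (@lebesgue_measure R).
Local Notation mT := (measurableTypeR R).
Local Notation cell := (Num.ceil : measurableTypeR R -> int).
Local Notation Mp := (@Mplus _ (measurableTypeR R) R).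
Local Notation mR := (measurable_fun [set: measurableTypeR R]).
Local Notation hk := (@half_kernel R).
Context (K : scalars) (rho : (R -> R) -> \bar R).
Hypothesis X_ri : rearrangement_invariant (@lebesgue_measure R) K rho.

Lemma norm_sin_le (t : R) : `|sin t| <= `|t|.
Proof.
wlog t0 : t / 0 < t.
  move=> wl; have [t0|t0|<-] := ltgtP 0 t; first exact: wl.
    by rewrite -normrN -sinN -(normrN t); apply: wl; rewrite oppr_gt0.
  by rewrite sin0.
have [|c _] := @MVT R sin cos 0 t t0.
  by apply: continuous_subspaceT => x; exact: continuous_sin.
rewrite sin0 !subr0 => ->; rewrite normrM ler_piMl//.
exact: cos_max.
Qed.

Lemma sinc_le1 (t : R) : `|sin t / t| <= 1.
Proof.
rewrite normrM normfV; have [->|t0] := eqVneq t 0; first by rewrite sin0 normr0 mul0r.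
by rewrite ler_pdivrMr ?normr_gt0// mul1r norm_sin_le.
Qed.

Lemma measurable_diff : measurable_fun [set: mT * mT] (fun z : mT * mT => z.1 - z.2 : R).
Proof.
by apply: measurable_funB; [exact: measurable_fst|exact: measurable_snd].
Qed.

Lemma measurable_sin : mR (@sin R).
Proof. by apply: continuous_measurable_fun => x; exact: continuous_sin. Qed.

Lemma measurable_cos : mR (@cos R).
Proof. by apply: continuous_measurable_fun => x; exact: continuous_cos. Qed.

(** The form in which the hypothesis of [transfer] is checked: a bounded kernel that
is [q / (x - y)] for cells that do not touch. *)
Lemma near_or_far (x y : R) (c q : R) : `|q| <= 1 ->
  ((`|(cell x - cell y)%R| <= 1)%N -> `|c| <= 1) ->
  ((2 <= `|(cell x - cell y)%R|)%N -> c = q * (x - y)^-1) ->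
  `|c - q * hk (cell x - cell y)| <= 12 * hk (cell x - cell y) ^+ 2.
Proof.
move=> q1 near far; have [n1|n2] := leqP `|(cell x - cell y)%R|%N 1.
  apply: le_trans (half_kernel_near R n1); apply: le_trans (ler_normB _ _) (lerD (near n1) _).
  by rewrite normrM ler_piMl.
rewrite (far n2) -mulrBr normrM; apply: le_trans (half_kernel_far n2).
by rewrite ler_piMl.
Qed.

Section WithBilinear.
Variable C : R.
Hypotheses (C0 : 0 < C) (BB : bilinear_bounded rho C).

Let C'0 : 0 <= transfer_constant C.
Proof. by rewrite /transfer_constant; move: C0 => ?; lra. Qed.

(** The numerator [sin (x - y)] is a sum of two products of bounded functions of [x]
and of [y]. *)
Lemma segment_multiplier_of_bilinear : segment_multiplier_bounded K rho.
Proof.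
apply: (@bounded_of_real _ mT R mu rho (rho_mono X_ri) (rhoD X_ri) (rho_ge0 X_ri)
  K _ _ (transfer_constant C) C'0).
apply: (@transfer R K rho X_ri C C0 BB _ _ sin (fun x => - cos x) cos sin) => //.
- rewrite (_ : (fun z : mT * mT => _) = (fun z : mT * mT => sin (z.1 - z.2) * (z.1 - z.2)^-1)); last first.
    by apply/funext => z; rewrite patch_setT.
  apply: measurable_funM; first exact: (measurableT_comp measurable_sin measurable_diff).
  exact: (measurableT_comp (@measurable_invr R) measurable_diff).
- exact: measurable_cos.
- exact: measurable_sin.
- by move=> x; exact: sin_max.
- by move=> x; rewrite normrN; exact: cos_max.
- by move=> x; exact: cos_max.
- by move=> x; exact: sin_max.
move=> x y; rewrite patch_setT.
have -> : sin x * cos y + - cos x * sin y = sin (x - y) by rewrite sinB mulNr.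
apply: near_or_far => [|_|_]; [exact: sin_max|exact: sinc_le1|by []].
Qed.

Lemma truncated_hilbert_of_bilinear : truncated_hilbert_bounded K rho.
Proof.
apply: (@bounded_of_real _ mT R mu rho (rho_mono X_ri) (rhoD X_ri) (rho_ge0 X_ri)
  K _ _ (transfer_constant C) C'0).
have n0 (x : R) : `|0 : R| <= 1 by rewrite normr0.
have n1 (x : R) : `|1 : R| <= 1 by rewrite normr1.
pose E : set (mT * mT) := [set z | 1 <= `|z.1 - z.2|].
have mE : measurable E.
  have -> : E = (fun z : mT * mT => `|z.1 - z.2|) @^-1` `[1, +oo[%classic.
    by apply/seteqP; split=> z /=; rewrite in_itv/= andbT.
  rewrite -[X in measurable X]setTI.
  by apply: (measurableT_comp (@normr_measurable R setT) measurable_diff) => //; exact: measurable_itv.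
have patchE' (x y : R) : ((fun y => (x - y)^-1) \_ [set y : R | 1 <= `|x - y|]) y = \1_E (x, y) * (x - y)^-1.
  rewrite patchE indicE; have [h|h] := boolP (1 <= `|x - y|).
    by rewrite !mem_set// mul1r.
  by rewrite !memNset ?mul0r//=; exact/negP.
apply: (@transfer R K rho X_ri C C0 BB _ _ (fun=> 1) (fun=> 0) (fun=> 1) (fun=> 0)) => //.
- move=> x; have -> : [set y : R | 1 <= `|x - y|] = (fun y : mT => `|x - y|) @^-1` `[1, +oo[%classic.
    by apply/seteqP; split=> z /=; rewrite in_itv/= andbT.
  rewrite -[X in measurable X]setTI.
  have md : mR (fun y : mT => x - y) by exact: measurable_funB.
  by apply: (measurableT_comp (@normr_measurable R setT) md) => //; exact: measurable_itv.
- rewrite (_ : (fun z : mT * mT => _) = (fun z : mT * mT => \1_E z * (z.1 - z.2)^-1)); last first.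
    by apply/funext => -[x y]; rewrite patchE'.
  apply: measurable_funM; first exact: measurable_indic.
  exact: (measurableT_comp (@measurable_invr R) measurable_diff).
move=> x y; rewrite patchE' mulr1 mulr0 addr0.
apply: near_or_far => [|_|n2]; first by rewrite normr1.
  rewrite indicE; have [/set_mem/= h|_] := boolP (_ \in E); last by rewrite mul0r normr0.
  by rewrite mul1r normfV invf_le1//; apply: lt_le_trans h.
suff hE : E (x, y) by rewrite indicE mem_set.
rewrite /E/=.
have := cell_diff x y; move: (cell x - cell y) (x - y) n2 => n u n2.
rewrite rmorphB rmorphD/= => /andP[u1 u2].
clear mE patchE' E n0 n1.
have : (2 <= n) || (n <= -2) by lia.
case/orP; rewrite -(ler_int R) ?rmorphN/= => h.
  by rewrite ger0_norm; lra.
by rewrite ler0_norm; lra.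
Qed.

(** The value at equal indices is the inverse of 0, which is 0: the excluded diagonal
needs no special treatment. *)
Definition hilbert_kernel (i j : int) : R := (i - j)%:~R^-1.

Lemma hilbert_kernel_bounded : hilbert_bounded hilbert_kernel (26 + 20).
Proof.
apply: (@hilbert_bounded_le R _ (fun i j => hk (i - j)) 26 20 (fun i j => hk (i - j) ^+ 2)).
- move=> i j; rewrite /hilbert_kernel; have [n0|n0] := eqVneq (i - j) 0.
    rewrite n0 invr0 sub0r normrN /half_kernel sub0r invrN invrK normrN ger0_norm//.
    by rewrite sqrrN; nra.
  have : (1 <= i - j) || (i - j <= -1) by lia.
  rewrite -!(ler_int R) rmorphN/= /half_kernel; move: ((i - j)%:~R) => z zz.
  have h0 : z - 2^-1 != 0 by case/orP: zz => h; [rewrite gt_eqF|rewrite lt_eqF]; lra.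
  have z0 : z != 0 by case/orP: zz => h; [rewrite gt_eqF|rewrite lt_eqF]; lra.
  have -> : z^-1 - (z - 2^-1)^-1 = - 2^-1 * z^-1 * (z - 2^-1)^-1.
    by move: h0; move: (2^-1) => c h0; field; rewrite z0 h0.
  rewrite exprVn; have -> : ((z - 2^-1) ^+ 2)^-1 = `|z - 2^-1|^-1 * `|z - 2^-1|^-1.
    by rewrite -expr2 exprVn real_normK ?num_real.
  rewrite !normrM !normfV ler_wpM2r ?invr_ge0//.
  rewrite ler_pdivrMr ?normr_gt0// mulrC ler_pdivlMr ?normr_gt0// normrN.
  case/orP: zz => h; first by rewrite !ger0_norm; lra.
  by rewrite (ger0_norm (_ : 0 <= 2^-1)) ?ler0_norm; lra.
- exact: half_kernel_hilbert_bounded.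
- exact: half_kernel_sqr_hilbert_bounded.
Qed.

(** A sequence is the function [g \o cell], and sums over the integers are integrals
of functions that are constant on cells. *)
Lemma discrete_hilbert_of_bilinear : discrete_hilbert_bounded K (discretized_norm rho).
Proof.
have hs := discretized_seq_norm X_ri.
pose C' := 8 * C * (26 + 20).
have C0' : 0 <= C' by rewrite /C'; move: C0 => ?; lra.
apply: (@bounded_of_real _ int R (Zcount R) (discretized_norm rho) _ _ _ K _ _ C' C0').
- by move=> f g [_ f0] [_ g0] fg; exact: (sn_mono hs).
- by move=> f g [_ f0] [_ g0]; exact: (sn_add hs).
- by move=> f [_ f0]; exact: (sn_ge0 hs).
move=> g s _ s0 gs.
pose f := g \o cell.
have mf : mR f by exact: measurable_comp_cell.
have fs : (rho (fun x => `|f x|)%R <= s%:E)%E.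
  by move: gs; rewrite (discretized_normE X_ri).
have ik n : mu.-integrable setT (fun y => (hilbert_kernel n (cell y) * f y)%:E).
  apply: (@kernel_integrable R K rho X_ri C BB hilbert_kernel (26 + 20) (fun j => j < n) n f s hilbert_kernel_bounded) => //.
    by move=> j jn; rewrite invr_ge0 ler0z; lia.
  by move=> j; rewrite -leNgt => nj; rewrite invr_le0 lerz0; lia.
have patchE' n (h : int -> R) : (fun j => hilbert_kernel n j * h j) \_ [set j | j <> n] = (fun j => hilbert_kernel n j * h j).
  apply/funext => j; rewrite patchE; have [->|jn] := eqVneq j n.
    by rewrite /hilbert_kernel subrr invr0 mul0r; case: ifP.
  by rewrite mem_set//=; exact/eqP.
have opE n : real_operator (Zcount R) (fun k => [set j | j <> k]) (fun k j => (k - j)%:~R^-1) g n =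
   (\int[mu]_y (hilbert_kernel n (cell y) * f y))%R.
  rewrite /real_operator Rintegral_mkcond.
  have := patchE' n g; rewrite /hilbert_kernel => ->.
  by rewrite Rintegral_Zcount.
split => //.
- move=> n; apply/(integrable_mkcond _ _) => //.
  have := ik n; rewrite -[X in mu.-integrable _ X]/((fun j => (hilbert_kernel n j * g j)%:E) \o cell).
  move/integrable_Zcount; congr ((Zcount R).-integrable _ _); apply/funext => j.
  by have /(congr1 (@^~ j)) := patchE' n g; rewrite !patchE /=; case: ifP => // _ <-.
- rewrite (discretized_normE X_ri)//.
  have := @kernel_bounded R K rho X_ri C BB hilbert_kernel (26 + 20) f s hilbert_kernel_bounded ltac:(lra) mf s0 fs ik.
  congr (_ <= _)%E; congr rho; apply/funext => x /=.
  by rewrite opE.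
Qed.

End WithBilinear.

Lemma boyd_bilinear : (0 < lower_discrete_boyd rho)%E -> (upper_discrete_boyd rho < 1)%E ->
  exists2 C : R, 0 < C & bilinear_bounded rho C.
Proof.
move=> l0 u1; have hs := discretized_seq_norm X_ri; have hs' := associate_seq_norm hs.
have [q [h [q2 h01 hq]]] := lower_boyd_gt0_contracts hs l0.
have l0' : (0 < lower_boyd (associate_norm (Zcount R) (discretized_norm rho)))%E.
  move: u1; rewrite /upper_discrete_boyd /upper_boyd.
  case: (lower_boyd _) => [r| |] /=; [|by rewrite ltry|by []].
  by rewrite -EFinB !lte_fin; lra.
have [q' [h' [q'2 h'01 hq']]] := lower_boyd_gt0_contracts hs' l0'.
have [C C0 hC] := bilinear_bound hs q2 h01 hq q'2 h'01 hq'.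
exists C => // k M S T a b x y; exact: hC.
Qed.

End Sufficiency.

(** * The Hilbert matrix and the lower index *)

Section Hardy.
Context (R : realType).
Implicit Types (tau : (int -> R) -> \bar R) (a b g : int -> R).

(** The Hilbert matrix on sequences supported in [1, .., N]; the truncation avoids all
questions of convergence. *)
Definition hilbert_hardy (N : nat) a (k : int) : R :=
  if 1 <= k then \sum_(1 <= j < N.+1) a j%:Z / (`|k|%N + j)%:R else 0.

Definition hardy_bounded tau (C : R) := forall N a, (forall k, 0 <= a k) ->
  (forall k, k \notin pos_range N -> a k = 0) -> (tau a <= 1)%E ->
  (tau (hilbert_hardy N a) <= C%:E)%E.

Lemma hilbert_hardy_ge0 N a k : (forall k, 0 <= a k) -> 0 <= hilbert_hardy N a k.
Proof.
move=> a0; rewrite /hilbert_hardy; case: ifP => // _.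
by apply: sumr_ge0 => j _; exact: divr_ge0.
Qed.

(** A bound on all windows bounds the whole sequence; it compensates for the
truncations. *)
Definition sn_fatou tau := forall a (c : R), (forall k, 0 <= a k) ->
  (forall N, (tau (fun k => (k \in int_window N)%:R * a k)%R <= c%:E)%E) -> (tau a <= c%:E)%E.

Lemma associate_sn_fatou tau : sn_fatou (associate_norm (Zcount R) tau).
Proof.
move=> b c b0 h; apply: associate_norm_le => // g g0 tg N.
have wb0 k : 0 <= (k \in int_window N)%:R * b k by exact: mulr_ge0.
have := le_trans (associate_norm_ub (fun k => (k \in int_window N)%:R * b k)%R g0 tg) (h N).
rewrite (@ge0_integral_Zcount_seq _ (int_window N)) ?int_window_uniq//; last 2 first.
- by move=> k; rewrite lee_fin mulr_ge0.
- by move=> k /negbTE kN; rewrite kN !mul0r.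
rewrite sumEFin lee_fin; apply: le_trans.
by rewrite big_seq [leRHS]big_seq; apply: ler_sum => k kN; rewrite kN mul1r.
Qed.

Lemma discretized_sn_fatou K (rho : (R -> R) -> \bar R) :
  rearrangement_invariant (@lebesgue_measure R) K rho -> sn_fatou (discretized_norm rho).
Proof.
move=> X_ri a c a0 h; rewrite (discretized_normE X_ri)//.
apply: (rho_limit X_ri (F := fun N x => (Num.ceil x \in int_window N)%:R * a (Num.ceil x))).
- move=> N; apply: (@Mplus_cell R (fun k => (k \in int_window N)%:R * a k)) => k.
  exact: mulr_ge0.
- exact: Mplus_cell.
- move=> x N N' NN /=; rewrite ler_wpM2r// ler_nat.
  by case: (boolP (Num.ceil x \in int_window N)) => // hN; rewrite lt0b; exact: (@sub_window_set R _ _ NN x hN).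
- move=> x; apply: cvg_near_cst; apply: filterS (window_set_near x) => N xN.
  by rewrite (_ : Num.ceil x \in _) ?mul1r.
- by move=> N; have := h N; rewrite (discretized_normE X_ri)// => k; exact: mulr_ge0.
Qed.

Lemma sum_pos_range N (f : int -> R) : \sum_(k <- pos_range N) f k = \sum_(1 <= j < N.+1) f j%:Z.
Proof. by rewrite big_map big_add1/= /index_iota subn0. Qed.

(** The Hilbert matrix is symmetric. *)
Lemma hardy_bounded_dual tau C : seq_norm tau -> 0 < C -> hardy_bounded tau C ->
  hardy_bounded (associate_norm (Zcount R) tau) C.
Proof.
move=> ht C0 hC N b b0 bN bs; apply: associate_norm_le => [k|g g0 tg M].
  exact: hilbert_hardy_ge0.
pose g' k := (k \in pos_range M)%:R * g k.
have g'0 k : 0 <= g' k by exact: mulr_ge0.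
have tg' : (tau g' <= 1)%E.
  apply: le_trans tg; apply: (sn_mono ht) => // k.
  by rewrite /g'; case: (_ \in _); rewrite ?mul1r ?mul0r.
have g'N k : k \notin pos_range M -> g' k = 0 by rewrite /g' => /negbTE ->; rewrite mul0r.
have := associate_hoelder ht (fun k => hilbert_hardy_ge0 M k g'0) b0 (pos_range_uniq N) C0
  (hC M g' g'0 g'N tg') bs.
rewrite mulr1; apply: le_trans.
apply: (@le_trans _ _ (\sum_(k <- pos_range M) hilbert_hardy N b k * g k)).
  rewrite [leLHS](bigID (fun k => 1 <= k))/= [X in _ + X]big1 ?addr0; last first.
    by move=> k /negbTE k1; rewrite /hilbert_hardy k1 mul0r.
  rewrite -big_filter; apply: sum_subset_le; first by rewrite filter_uniq// int_window_uniq.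
    by move=> k; rewrite mem_filter mem_int_window mem_pos_range => /andP[? /andP[? ?]]; lia.
  by move=> k; rewrite mulr_ge0// hilbert_hardy_ge0.
rewrite !sum_pos_range.
under eq_big_nat => k /andP[k1 kM].
  rewrite /hilbert_hardy (_ : 1 <= k%:Z = true); last by lia.
  rewrite absz_nat mulr_suml.
  over.
under [leRHS]eq_big_nat => k /andP[k1 kM].
  rewrite /hilbert_hardy (_ : 1 <= k%:Z = true); last by lia.
  rewrite absz_nat mulr_suml.
  over.
rewrite exchange_big_nat/= le_eqVlt; apply/orP; left; apply/eqP.
apply: eq_bigr => j _; apply: eq_big_nat => k /andP[k1 kM].
rewrite /g' mem_pos_range (_ : _ <= _ <= _ = true) ?mul1r; last by lia.
by rewrite addnC; ring.
Qed.

Lemma sum_inv_dyadic k L : (0 < k)%N ->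
  L%:R / 2 <= \sum_(k <= j < 2 ^ L * k) j%:R^-1 :> R.
Proof.
move=> k0; elim: L => [|L IH].
  by rewrite mul0r; apply: sumr_ge0.
have p0 : (0 < 2 ^ L)%N by rewrite expn_gt0.
rewrite (@big_cat_nat _ _ _ (2 ^ L * k))/=; [|by rewrite leq_pmull|by rewrite leq_mul2r expnS leq_pmull ?orbT].
rewrite -natr1 mulrDl mul1r; apply: lerD => //.
apply: (@le_trans _ _ (\sum_(2 ^ L * k <= j < 2 ^ L.+1 * k) (2 ^ L.+1 * k)%:R^-1 :> R)); last first.
  apply: ler_sum_nat => j /andP[j1 j2].
  by rewrite lef_pV2 ?posrE ?ltr0n ?ler_nat; have := leq_pmull k p0; lia.
rewrite sumr_const_nat -[_ *+ (_ - _)]mulr_natr expnS -mulnA mulSn mul1n addnK.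
set m := (2 ^ L * k)%N; have m0 : 0 < m%:R :> R by rewrite ltr0n muln_gt0 p0.
have -> : (m + m)%:R = 2 * m%:R :> R by rewrite natrD; ring.
by rewrite invfM -mulrA mulVf ?mulr1// gt_eqF.
Qed.

(** The terms with [k <= j < 2 ^ L * k] have [a j >= a (2 ^ L * k)], and the sum of [1
/ (k + j)] over them is at least [L / 4]. *)
Lemma dilation_le_hardy L N a (k : nat) : decreasing_sequences a -> (0 < k)%N ->
  (2 ^ L * k <= N)%N ->
  (L%:R / 4) * dilation (2 ^ L) a k%:Z <= hilbert_hardy N a k%:Z.
Proof.
move=> [_ a0 ad] k0 kN; rewrite /hilbert_hardy (_ : 1 <= k%:Z = true); last by lia.
rewrite absz_nat.
have p0 : (0 < 2 ^ L)%N by rewrite expn_gt0.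
have kk := leq_pmull k p0.
apply: (@le_trans _ _ (\sum_(k <= j < 2 ^ L * k) a j%:Z / (k + j)%:R)); last first.
  rewrite [leRHS](@big_cat_nat _ _ _ k)/=; [|by []|by lia].
  apply: ler_wpDl; first by apply: sumr_ge0 => j _; exact: divr_ge0.
  rewrite [leRHS](@big_cat_nat _ _ _ (2 ^ L * k))/=; [|by []|by lia].
  by apply: ler_wpDr => //; apply: sumr_ge0 => j _; exact: divr_ge0.
apply: (@le_trans _ _ (\sum_(k <= j < 2 ^ L * k) (dilation (2 ^ L) a k%:Z / 2) * j%:R^-1)).
  rewrite -mulr_sumr; have := sum_inv_dyadic L k0; have : 0 <= dilation (2 ^ L) a k%:Z by exact: a0.
  move: (dilation _ _ _) (\sum_(_ <= _ < _) _) (L%:R) => x y z; nra.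
apply: ler_sum_nat => j /andP[j1 j2].
rewrite -mulrA -invfM; apply: ler_pM => //.
- exact: a0.
- by rewrite /dilation; apply: ad; [lia|rewrite -PoszM; lia].
rewrite lef_pV2 ?posrE ?mulr_gt0 ?ltr0n//; [|lia|lia].
by rewrite -[2]/(2%:R) -natrM ler_nat; lia.
Qed.

Lemma hardy_dilation_norm tau C L : seq_norm tau -> sn_fatou tau -> 0 < C ->
  hardy_bounded tau C -> (0 < L)%N ->
  (dilation_norm tau (2 ^ L) <= (4 / L%:R * C)%:E)%E.
Proof.
move=> ht hf C0 hC L0; apply: ge_ereal_sup => _ [a [Da ta] <-].
have [an a0 ad] := Da.
apply: hf => [k|n]; first exact: a0.
pose N := (2 ^ L * n)%N; pose a' k := (k \in pos_range N)%:R * a k.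
have a'0 k : 0 <= a' k by exact: mulr_ge0.
have ta' : (tau a' <= 1)%E.
  apply: le_trans ta; apply: (sn_mono ht) => // k.
  by rewrite /a'; case: (_ \in _); rewrite ?mul1r ?mul0r.
have a'N k : k \notin pos_range N -> a' k = 0 by rewrite /a' => /negbTE ->; rewrite mul0r.
have c0 : 0 <= 4 / L%:R :> R by exact: divr_ge0.
apply: le_trans (sn_scale_le ht c0 (fun k => hilbert_hardy_ge0 N k a'0) (hC N a' a'0 a'N ta')).
apply: (sn_mono ht) => k; first by apply: mulr_ge0 => //; exact: a0.
have H0 : 0 <= 4 / L%:R * hilbert_hardy N a' k by apply: mulr_ge0 => //; exact: hilbert_hardy_ge0.
case: (boolP (k \in int_window n)) => [kn|_]; last by rewrite mul0r.
rewrite mul1r; have [k1|k0] := leP 1 k; last first.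
  by rewrite /dilation an//; nia.
move: kn k1; rewrite mem_int_window => /andP[_ kn] k1.
have [m mE] : exists m : nat, k = m%:Z by exists `|k|%N; lia.
rewrite {}mE in kn k1 *.
have h := @dilation_le_hardy L N a m Da ltac:(lia) ltac:(rewrite /N leq_mul2l; lia).
have <- : hilbert_hardy N a m%:Z = hilbert_hardy N a' m%:Z.
  rewrite /hilbert_hardy; case: ifP => // _; apply: eq_big_nat => j /andP[j1 jN].
  by rewrite /a' mem_pos_range (_ : _ <= _ <= _ = true) ?mul1r//; lia.
have L0' : 0 < L%:R :> R by rewrite ltr0n.
rewrite -(ler_pM2l (_ : 0 < L%:R / 4 :> R)); last by rewrite divr_gt0.
apply: le_trans h _; rewrite le_eqVlt; apply/orP; left; apply/eqP.
by field; rewrite gt_eqF.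
Qed.

Lemma lower_boyd_gt0 tau m : seq_norm tau -> (2 <= m)%N -> (dilation_norm tau m < 1)%E ->
  (0 < lower_boyd tau)%E.
Proof.
move=> ht m2 h1.
apply: (@lt_le_trans _ _ (- (lne (dilation_norm tau m) / (ln m%:R)%:E))%E); last first.
  by apply: ereal_sup_ubound; exists m.
rewrite oppe_gt0 inver gt_eqF ?ln_nat_gt0//.
by rewrite pmule_llt0 ?lte_fin ?invr_gt0 ?ln_nat_gt0// lne_lt0.
Qed.

(** Choose [L > 4 * C] in [hardy_dilation_norm]. *)
Lemma hardy_lower_boyd tau C : seq_norm tau -> sn_fatou tau -> 0 < C ->
  hardy_bounded tau C -> (0 < lower_boyd tau)%E.
Proof.
move=> ht hf C0 hC; pose L := (Num.truncn (4 * C)).+1.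
apply: (@lower_boyd_gt0 _ (2 ^ L)) => //.
  by rewrite -[X in (X <= _)%N](expn1 2) leq_exp2l.
apply: le_lt_trans (hardy_dilation_norm ht hf C0 hC (isT : (0 < L)%N)) _.
rewrite lte_fin mulrAC ltr_pdivrMr ?ltr0n// mul1r.
exact: truncnS_gt.
Qed.

End Hardy.

(** * The lower index is at most the upper index *)

Section Indices.
Context (R : realType).
Implicit Types (tau : (int -> R) -> \bar R) (a b g : int -> R).

Definition interval_indicator (N : nat) (k : int) : R := (k \in pos_range N)%:R.

Local Notation chi := interval_indicator.

Lemma interval_indicator_ge0 N k : 0 <= chi N k.
Proof. by []. Qed.

Lemma decreasing_interval_indicator N : decreasing_sequences (chi N).
Proof.
split=> [n n0|//|m n m1 mn]; rewrite /chi.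
  by rewrite mem_pos_range; case: andP => // h; lia.
by rewrite ler_nat !mem_pos_range; case: andP => // h; rewrite lt0b; lia.
Qed.

Lemma le_interval_indicator M N k : (M <= N)%N -> chi M k <= chi N k.
Proof.
move=> MN; rewrite ler_nat !mem_pos_range; case: andP => // h.
by rewrite lt0b; lia.
Qed.

Lemma dilation_interval_indicator m N : (0 < m)%N -> dilation m (chi (m * N)) = chi N.
Proof.
move=> m0; apply/funext => k; rewrite /dilation /chi !mem_pos_range.
by congr ((nat_of_bool _)%:R); apply/idP/idP; nia.
Qed.

Lemma dilation_norm_le1 tau m : seq_norm tau -> (0 < m)%N -> (dilation_norm tau m <= 1)%E.
Proof.
move=> ht m0; apply: ge_ereal_sup => _ [a [[an a0 ad] ta] <-].
apply: le_trans ta; apply: (sn_mono ht) => k; first exact: a0.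
rewrite /dilation; have [k0|k1] := leP k 0.
  by rewrite [a k]an// an//; nia.
by apply: ad; nia.
Qed.

(** Dilating the indicator of [1, .., m] by [m] gives the indicator of 1, of positive
norm. *)
Lemma dilation_norm_fin_gt0 tau m : seq_norm tau -> (0 < tau (chi 1))%E ->
  (tau (chi m) < +oo)%E -> (0 < m)%N ->
  exists2 h : R, 0 < h & dilation_norm tau m = h%:E.
Proof.
move=> ht t1 tm m0.
have hfin : dilation_norm tau m \is a fin_num.
  rewrite ge0_fin_numE ?dilation_norm_ge0//.
  by rewrite (le_lt_trans (dilation_norm_le1 ht m0)) ?ltry.
have mfin : tau (chi m) \is a fin_num.
  by rewrite ge0_fin_numE// (sn_ge0 ht).
exists (fine (dilation_norm tau m)); last by rewrite fineK.
rewrite lt0r fine_ge0 ?dilation_norm_ge0// andbT; apply/eqP => h0.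
have := @dilation_norm_contracts _ tau m (fine (dilation_norm tau m)) ht.
rewrite fineK// => /(_ (lexx _) m0); rewrite h0.
have tm0 : (0 < tau (chi m))%E.
  apply: lt_le_trans t1 _; apply: (sn_mono ht) => // k; exact: le_interval_indicator.
move=> /(_ (chi m) (fine (tau (chi m))) (decreasing_interval_indicator m)).
rewrite fineK// mul0r fine_gt0 ?tm0 -?ge0_fin_numE ?(ltW tm0)// => /(_ isT (lexx _)).
by rewrite -{1}[m in chi m]muln1 dilation_interval_indicator// leNgt t1.
Qed.

Lemma interval_indicator_contracts tau m (h : R) l s : seq_norm tau -> (0 < m)%N -> 0 < h ->
  dilation_contracts tau m h -> 0 < s -> (tau (chi (m ^ l)) <= s%:E)%E ->
  (tau (chi 1) <= (h ^+ l * s)%:E)%E.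
Proof.
move=> ht m0 h0 hm; elim: l s => [|l IH] s s0 ts; first by rewrite expr0 mul1r.
have hs : 0 < h * s by exact: mulr_gt0.
rewrite (_ : h ^+ l.+1 * s = h ^+ l * (h * s)); last by rewrite exprS; ring.
apply: IH => //.
rewrite -(dilation_interval_indicator _ m0) -expnS.
exact: (hm _ _ (decreasing_interval_indicator _) s0 ts).
Qed.

(** Adding up the translates of [g] by [- N <= r < N] gives a sequence of norm at most
[2 N] that is at least the sum of [g] over [1, .., N] at every point of this
interval. *)
Lemma associate_interval_indicator tau N : seq_norm tau ->
  (forall (r : int) a, (forall k, 0 <= a k) -> tau (fun k => a (k + r)) = tau a) ->
  (0 < tau (chi N))%E -> (tau (chi N) < +oo)%E ->
  (associate_norm (Zcount R) tau (chi N) <= (2 * N%:R / fine (tau (chi N)))%:E)%E.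
Proof.
move=> ht sh t0 toy.
have tfin : tau (chi N) \is a fin_num by rewrite ge0_fin_numE ?ltW.
have S0 : 0 < fine (tau (chi N)) by rewrite fine_gt0 ?t0.
have g0N g : (forall k, 0 <= g k) -> 0 <= \sum_(k <- pos_range N) g k.
  by move=> g0; apply: sumr_ge0.
apply: associate_norm_le => // g g0 tg M.
apply: (@le_trans _ _ (\sum_(k <- pos_range N) g k)).
  rewrite [leLHS](bigID (fun k => k \in pos_range N))/= [X in _ + X]big1 ?addr0; last first.
    by move=> k /negbTE kN; rewrite /chi kN mul0r.
  rewrite (eq_bigr g); last by move=> k kN; rewrite /chi kN mul1r.
  rewrite -big_filter; apply: sum_subset_le; first by rewrite filter_uniq// int_window_uniq.
    by move=> k; rewrite mem_filter => /andP[].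
  by [].
set c := \sum_(k <- _) g k.
have [c0|c0] := leP c 0.
  by apply: le_trans c0 _; rewrite divr_ge0 ?mulr_ge0 ?(ltW S0).
have ci : 0 <= c^-1 by rewrite invr_ge0 ltW.
pose G k := \sum_(r <- int_window N) g (k + r).
have G0 k : 0 <= G k by apply: sumr_ge0.
have cG k : k \in pos_range N -> c <= G k.
  rewrite mem_pos_range => /andP[k1 kN].
  rewrite /c (eq_bigr (fun j => g (k + (j - k)))); last by move=> j _; rewrite addrC subrK.
  rewrite -(big_map (fun j => j - k) xpredT (fun r => g (k + r))).
  apply: sum_subset_le => //.
    by rewrite map_inj_uniq ?pos_range_uniq//; exact: addIr.
  move=> _ /mapP[j jN ->]; move: jN; rewrite mem_pos_range mem_int_window; lia.
have tG : (tau G <= (\sum_(r <- int_window N) 1)%:E)%E.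
  apply: (sn_sum_le (F := fun r k => g (k + r)) _ ht) => // r.
  by rewrite sh.
rewrite ler_pdivlMr// mulrC -ler_pdivlMr// mulrC -lee_fin fineK//.
apply: (@le_trans _ _ (tau (fun k => c^-1 * G k))).
  apply: (sn_mono ht) => // k; rewrite /chi; case: (boolP (k \in _)) => kN.
    by rewrite mulrC ler_pdivlMr// mul1r cG.
  by apply: mulr_ge0.
apply: le_trans (sn_scale_le ht ci G0 tG) _.
by rewrite big_const_seq count_predT size_map size_iota iter_addr_0 natrM.
Qed.

(** The norms of the indicator of 1 in the space and in its associate have product at
least 1; compare each with the norm of the indicator of [1, .., n ^ k], in which
[1, .., m ^ l] is contained. *)
Lemma interval_indicator_growth tau m n (h h' : R) l k : seq_norm tau ->
  (forall (r : int) a, (forall k, 0 <= a k) -> tau (fun k => a (k + r)) = tau a) ->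
  (0 < tau (chi 1))%E -> (forall N, tau (chi N) < +oo)%E ->
  (0 < m)%N -> (0 < n)%N -> 0 < h -> 0 < h' ->
  dilation_contracts tau m h ->
  dilation_contracts (associate_norm (Zcount R) tau) n h' ->
  (m ^ l <= n ^ k)%N -> 1 <= 2 * h ^+ l * h' ^+ k * (n ^ k)%:R.
Proof.
move=> ht sh t1 toy m0 n0 h0 h'0 hm hn mn.
have ht' := associate_seq_norm ht.
have mono M N : (M <= N)%N -> (tau (chi M) <= tau (chi N))%E.
  by move=> MN; apply: (sn_mono ht) => // j; exact: le_interval_indicator.
have nk : (0 < n ^ k)%N by rewrite expn_gt0 n0.
have tpos N : (0 < N)%N -> (0 < tau (chi N))%E.
  by move=> N0; exact: lt_le_trans t1 (mono _ _ N0).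
have tfin N : (0 < N)%N -> tau (chi N) = (fine (tau (chi N)))%:E.
  by move=> N0; rewrite fineK// ge0_fin_numE ?ltW// tpos.
have fpos N : (0 < N)%N -> 0 < fine (tau (chi N)) by move=> N0; rewrite fine_gt0// tpos// toy.
have A0 := fpos 1%N isT; have S0 := fpos _ nk.
have hA : fine (tau (chi 1)) <= h ^+ l * fine (tau (chi (n ^ k))).
  rewrite -lee_fin -tfin//; apply: (interval_indicator_contracts ht m0 h0 hm S0).
  by rewrite -tfin//; exact: mono.
have hB : (fine (tau (chi 1)))^-1 <= h' ^+ k * (2 * (n ^ k)%:R / fine (tau (chi (n ^ k)))).
  have p0 : 0 < 2 * (n ^ k)%:R / fine (tau (chi (n ^ k))).
    by rewrite divr_gt0// mulr_gt0// ltr0n.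
  have hS := associate_interval_indicator ht sh (tpos _ nk) (toy _).
  rewrite -lee_fin.
  refine (le_trans _ (interval_indicator_contracts ht' n0 h'0 hn p0 hS)).
  have Ai : 0 <= (fine (tau (chi 1)))^-1 by rewrite invr_ge0 ltW.
  refine (le_trans _ (associate_norm_ub (g := fun j => (fine (tau (chi 1)))^-1 * chi 1 j) (chi 1) _ _)).
  - rewrite (@ge0_integral_Zcount_seq _ (pos_range 1)) ?pos_range_uniq//.
    + by rewrite big_seq1 /chi mem_pos_range mul1r mulr1.
    + by move=> j; rewrite lee_fin !mulr_ge0.
    + by move=> j /negbTE jN; rewrite /chi jN mul0r.
  - by move=> j; exact: mulr_ge0.
  - have := sn_scale_le (s := fine (tau (chi 1))) ht Ai (fun j => interval_indicator_ge0 1 j).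
    by rewrite mulVf ?gt_eqF// -tfin//; apply.
have := ler_pM (ltW A0) _ hA hB; rewrite mulfV ?gt_eqF// invr_ge0 (ltW A0) => /(_ isT).
move/le_trans; apply; rewrite le_eqVlt; apply/orP; left; apply/eqP.
by field; rewrite gt_eqF.
Qed.

(** Taking logarithms in [interval_indicator_growth] with [m ^ l] as close to [n ^ k]
as possible gives [k * ln n * (x + y - 1) <= ln 2 + x * ln m] for all [k], where
[x] and [y] are the terms of the two suprema at [m] and [n]. Hence [x + y <= 1]. *)
Lemma lower_boyd_le_upper tau : seq_norm tau ->
  (forall (r : int) a, (forall k, 0 <= a k) -> tau (fun k => a (k + r)) = tau a) ->
  (0 < tau (chi 1))%E -> (forall N, tau (chi N) < +oo)%E ->
  (lower_boyd tau <= upper_boyd tau)%E.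
Proof.
move=> ht sh t1 toy; have ht' := associate_seq_norm ht.
have mono M N : (M <= N)%N -> (tau (chi M) <= tau (chi N))%E.
  by move=> MN; apply: (sn_mono ht) => // j; exact: le_interval_indicator.
have tpos N : (0 < N)%N -> (0 < tau (chi N))%E.
  by move=> N0; exact: lt_le_trans t1 (mono _ _ N0).
pose tau' := associate_norm (Zcount R) tau.
have toy' N : (0 < N)%N -> (tau' (chi N) < +oo)%E.
  move=> N0; apply: le_lt_trans (associate_interval_indicator ht sh (tpos _ N0) (toy _)) _.
  by rewrite ltry.
have t1' : (0 < tau' (chi 1))%E.
  rewrite lt_neqAle (sn_ge0 ht')// andbT; apply/eqP => t0.
  have tfin : tau (chi 1) = (fine (tau (chi 1)))%:E by rewrite fineK// ge0_fin_numE// ltW.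
  have A0 : 0 < fine (tau (chi 1)) by rewrite fine_gt0// t1 toy.
  have := @associate_hoelder _ tau ht (chi 1) (chi 1) _ 0 [:: 1]
    (interval_indicator_ge0 1) (interval_indicator_ge0 1) isT A0; rewrite -tfin => /(_ (lexx _)).
  rewrite -/tau' -t0 => /(_ (lexx _)).
  by rewrite mulr0 big_seq1 /chi mem_pos_range mul1r ler10.
have index sigma p : seq_norm sigma -> (0 < sigma (chi 1))%E ->
    (forall N, (0 < N)%N -> sigma (chi N) < +oo)%E -> (2 <= p)%N ->
    exists h : R, [/\ 0 < h, h <= 1, dilation_contracts sigma p h &
      (- (lne (dilation_norm sigma p) / (ln p%:R)%:E))%E = (- (ln h / ln p%:R))%:E].
  move=> hs s1 soy p2; have p0 : (0 < p)%N by lia.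
  have [h h0 hE] := dilation_norm_fin_gt0 hs s1 (soy _ p0) p0.
  exists h; split => //.
  - by rewrite -lee_fin -hE; exact: dilation_norm_le1.
  - by apply: dilation_norm_contracts => //; rewrite hE.
  - by rewrite hE lne_EFin// inver gt_eqF ?ln_nat_gt0.
have key m n : (2 <= m)%N -> (2 <= n)%N ->
    (- (lne (dilation_norm tau m) / (ln m%:R)%:E) +
     - (lne (dilation_norm tau' n) / (ln n%:R)%:E) <= 1)%E.
  move=> m2 n2.
  have [h [h0 h1 hm ->]] := index tau m ht t1 (fun N _ => toy N) m2.
  have [h' [h'0 h'1 hn ->]] := index tau' n ht' t1' toy' n2.
  have lm := ln_nat_gt0 R m2; have ln_ := ln_nat_gt0 R n2.
  have m0 : (0 < m)%N by lia.
  have n0 : (0 < n)%N by lia.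
  rewrite -EFinD lee_fin leNgt; apply/negP.
  set x := - (ln h / ln m%:R); set y := - (ln h' / ln n%:R) => xy.
  have x0 : 0 <= x by rewrite oppr_ge0 pmulr_lle0 ?invr_gt0// ln_le0.
  (* large enough to contradict the inequality in the limit *)
  pose k := (Num.truncn ((ln 2 + ln m%:R * x) / (ln n%:R * (x + y - 1)))).+1.
  pose l := trunc_log m (n ^ k).
  have nk : (0 < n ^ k)%N by rewrite expn_gt0 n0.
  have := interval_indicator_growth (l := l) (k := k) ht sh t1 toy m0 n0 h0 h'0 hm hn (trunc_logP m2 nk).
  have := trunc_log_ltn (n ^ k) m2; rewrite -/l => mlk.
  have : k%:R * ln n%:R < (l%:R + 1) * ln (m%:R : R).
    rewrite -[l%:R + 1](natrD _ l 1) addn1 !mulr_natl -!lnXn ?ltr0n// -!natrX.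
    by rewrite ltr_ln ?posrE ?ltr0n ?ltr_nat// expn_gt0 m0.
  rewrite -ler_ln ?posrE ?mulr_gt0 ?exprn_gt0 ?ltr0n// ln1 natrX.
  rewrite !lnM ?posrE ?mulr_gt0 ?exprn_gt0 ?ltr0n// !lnXn ?ltr0n// -(mulr_natl (ln h)) -(mulr_natl (ln h')) -(mulr_natl (ln n%:R)).
  have -> : ln h = - x * ln m%:R by rewrite /x opprK divfK ?gt_eqF.
  have -> : ln h' = - y * ln n%:R by rewrite /y opprK divfK ?gt_eqF.
  have p0 : 0 < ln n%:R * (x + y - 1) by rewrite mulr_gt0// subr_gt0.
  have : (ln 2 + ln m%:R * x) / (ln n%:R * (x + y - 1)) < k%:R by exact: truncnS_gt.
  rewrite ltr_pdivrMr//.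
  clearbody l; clearbody k; clearbody x y; move: {p0 lm ln_} (k%:R : R) (l%:R : R) (ln m%:R : R) (ln n%:R : R) (ln 2 : R).
  move=> k' l' M N c2 h2 h3 h4.
  have : 0 <= x * ((l' + 1) * M - k' * N) by rewrite mulr_ge0// subr_ge0 ltW.
  by nra.
apply: ge_ereal_sup => _ [m /= m2 <-].
have [h [h0 h1 hm hE]] := index tau m ht t1 (fun N _ => toy N) m2.
rewrite hE /upper_boyd -/tau'.
have : (lower_boyd tau' <= (1 - - (ln h / ln m%:R))%:E)%E.
  apply: ge_ereal_sup => _ [n /= n2 <-].
  have := key m n m2 n2; rewrite hE.
  have [h' [h'0 h'1 hn ->]] := index tau' n ht' t1' toy' n2.
  by rewrite -EFinD !lee_fin => ?; lra.
case: (lower_boyd tau') => [r| |] //=; last by rewrite leey.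
by rewrite -EFinB !lee_fin => ?; lra.
Qed.

End Indices.

Section DiscreteIndices.
Context (R : realType) (K : scalars) (rho : (R -> R) -> \bar R).
Hypothesis X_ri : rearrangement_invariant (@lebesgue_measure R) K rho.
Local Notation mu := (@lebesgue_measure R).
Local Notation cell := (Num.ceil : measurableTypeR R -> int).
Local Notation sigma := (discretized_norm rho).

Lemma discretized_shift (r : int) a : (forall k, 0 <= a k) ->
  sigma (fun k => a (k + r)) = sigma a.
Proof.
move=> a0; rewrite !(discretized_normE X_ri)//.
rewrite -[RHS](rho_shift X_ri r%:~R (Mplus_cell a0)); congr rho; apply/funext => x /=.
by rewrite ceilDrz ?intr_int// intrKceil.
Qed.

Lemma discretized_interval_fin N : (sigma (interval_indicator R N) < +oo)%E.
Proof.
apply: le_lt_trans (window_indicator_fin X_ri N.+1).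
rewrite -(discretized_normE X_ri)//; apply: (sn_mono (discretized_seq_norm X_ri)) => // k.
rewrite ler_nat mem_pos_range mem_int_window; case: andP => // h; rewrite lt0b; lia.
Qed.

Lemma discretized_interval_gt0 : (0 < sigma (interval_indicator R 1))%E.
Proof.
have ht := discretized_seq_norm X_ri.
rewrite lt_neqAle (sn_ge0 ht)// andbT; apply/eqP => h.
have M := Mplus_cell (interval_indicator_ge0 R 1).
have : rho (interval_indicator R 1 \o cell) = 0%E by rewrite -(discretized_normE X_ri).
move=> /(bfn_eq0 X_ri.1 M) [A [mA A0 sA]].
have : (mu (cell @^-1` [set 1%:Z]) <= mu A)%E.
  apply: le_measure; first by apply: mem_set; exact: measurable_preimage_cell.
    exact: mem_set.
  move=> x /= x1; apply: sA => /= /eqP.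
  by rewrite /interval_indicator x1 mem_pos_range oner_eq0.
by rewrite A0 [leLHS](mu_cell R 1) leNgt lte01.
Qed.

Lemma lower_discrete_boyd_le_upper : (lower_discrete_boyd rho <= upper_discrete_boyd rho)%E.
Proof.
apply: lower_boyd_le_upper.
- exact: discretized_seq_norm X_ri.
- exact: discretized_shift.
- exact: discretized_interval_gt0.
- exact: discretized_interval_fin.
Qed.

End DiscreteIndices.

(** * The three operators dominate the Hilbert matrix *)

Section Reflection.
Context (R : realType).
Implicit Types (tau : (int -> R) -> \bar R) (a b g : int -> R).

Lemma hilbert_hardy_nonpos N a k : k < 1 -> hilbert_hardy N a k = 0.
Proof. by move=> k1; rewrite /hilbert_hardy ifF//; lia. Qed.

(** Norms do not change under [k |-> c - k], so it is enough to dominate the Hilbert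
matrix by the values of [g] on the left of [c]. *)
Lemma hilbert_hardy_reflect tau N a g (c : int) (s : R) : seq_norm tau -> sn_fatou tau ->
  (forall k, 0 <= a k) -> (forall k, 0 <= g k) ->
  (forall k, 1 <= k -> hilbert_hardy N a k <= g (c - k)) ->
  (tau g <= s%:E)%E -> (tau (hilbert_hardy N a) <= s%:E)%E.
Proof.
move=> ht hf a0 g0 hg gs; set h := hilbert_hardy N a.
have h0 k : 0 <= h k by exact: hilbert_hardy_ge0.
apply: hf => // M.
pose s1 := pos_range M; pose s2 := [seq c - k | k <- s1].
have inj : injective (fun k : int => c - k) by move=> i j /addrI /oppr_inj.
have u2 : uniq s2 by rewrite map_inj_uniq// pos_range_uniq.
have E : map h s1 = map (fun j => h (c - j)) s2.
  by rewrite /s2 -[RHS]map_comp; apply: eq_map => k /=; rewrite subKr.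
have v0 : all (fun x => 0 <= x) (map h s1) by apply/allP => _ /mapP[k _ ->].
apply: (@le_trans _ _ (tau (place s1 (map h s1)))).
  apply: (sn_mono ht) => k; first exact: mulr_ge0.
  case: (boolP (k \in int_window M)) => kM; last by rewrite mul0r place_ge0.
  rewrite mul1r; have [k1|k1] := leP 1 k.
    rewrite place_map// mem_pos_range; move: kM; rewrite mem_int_window; lia.
  by rewrite [X in X <= _]hilbert_hardy_nonpos ?place_ge0.
rewrite (sn_place ht _ u2) ?pos_range_uniq ?size_map//.
apply: le_trans gs; apply: (sn_mono ht) => j; first exact: place_ge0.
have [js|js] := boolP (j \in s2); last by rewrite place_notin ?size_map.
rewrite E place_map//; move: js => /mapP[k ks ->]; rewrite subKr hg//.
by move: ks; rewrite mem_pos_range => /andP[].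
Qed.

Lemma integrable_finite_support s (f : int -> R) : uniq s ->
  (forall k, k \notin s -> f k = 0) -> (Zcount R).-integrable setT (EFin \o f).
Proof.
move=> us fs; apply/integrableP; split; first exact: measurable_int_fun.
rewrite (@ge0_integral_Zcount_seq _ s)//.
- by rewrite sumEFin ltry.
- by move=> k ks; rewrite /= fs// normr0.
Qed.

Definition hardy_kernel a (k : nat) (j : int) : R := a j / (k + `|j|)%:R.

Lemma hilbert_hardyE N a (k : nat) : (0 < k)%N -> (forall j, 0 <= a j) ->
  (forall j, j \notin pos_range N -> a j = 0) ->
  hilbert_hardy N a k%:Z = (\int[Zcount R]_j (hardy_kernel a k j))%R.
Proof.
move=> k0 a0 aN.
rewrite /Rintegral (@ge0_integral_Zcount_seq _ (pos_range N)) ?pos_range_uniq//.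
- rewrite sumEFin sum_pos_range /hilbert_hardy (_ : 1 <= k%:Z = true); last by lia.
  by rewrite absz_nat.
- by move=> j; rewrite lee_fin divr_ge0.
- by move=> j jN; rewrite /hardy_kernel aN// mul0r.
Qed.

Lemma integrable_hardy_kernel N a k : (forall j, j \notin pos_range N -> a j = 0) ->
  (Zcount R).-integrable setT (EFin \o hardy_kernel a k).
Proof.
move=> aN; apply: (integrable_finite_support (pos_range_uniq N)) => j jN.
by rewrite /hardy_kernel aN// mul0r.
Qed.

End Reflection.

Section Necessity.
Context (R : realType) (K : scalars) (rho : (R -> R) -> \bar R).
Hypothesis X_ri : rearrangement_invariant (@lebesgue_measure R) K rho.
Local Notation mu := (@lebesgue_measure R).
Local Notation mT := (measurableTypeR R).
Local Notation cell := (Num.ceil : measurableTypeR R -> int).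
Local Notation Mp := (@Mplus _ (measurableTypeR R) R).
Local Notation mR := (measurable_fun [set: measurableTypeR R]).
Local Notation sigma := (discretized_norm rho).

Let hs := discretized_seq_norm X_ri.
Let hf := discretized_sn_fatou X_ri.

Lemma bounded_integral_operator_unit d (T : measurableType d) (m : {measure set T -> \bar R})
    nu D k : (forall f, @Mplus _ T R f -> (0 <= nu f)%E) ->
  bounded_integral_operator m K nu D k ->
  exists2 C : R, 0 < C & forall f, bfs K nu f -> (bfs_norm nu f <= 1)%E ->
    Mfun K (integral_operator m D k f) /\
    (bfs_norm nu (integral_operator m D k f) <= C%:E)%E.
Proof.
move=> nu0 [C hC]; exists (`|C| + 1) => [|f fX f1]; first by rewrite ltr_wpDl.
have [_ [h _] hn] := hC f fX; split => //.
have n0 : (0 <= bfs_norm nu f)%E by apply: nu0; apply: Mplus_cabs; case: fX => [[]].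
apply: le_trans hn _; apply: (@le_trans _ _ ((`|C| + 1)%:E * bfs_norm nu f)%E).
  by apply: lee_wpmul2r => //; rewrite lee_fin (le_trans (ler_norm C))// lerDl.
by rewrite -[leRHS]mule1 lee_wpmul2l// lee_fin addr_ge0.
Qed.

(** At the point [- n] all the terms have the same sign, and the sum is minus the
value of the Hilbert matrix at [n]. *)
Lemma hardy_of_discrete_hilbert : discrete_hilbert_bounded K sigma ->
  exists2 C : R, 0 < C & hardy_bounded sigma C.
Proof.
move=> hH; have [|C C0 hC] := bounded_integral_operator_unit _ hH.
  by move=> f [_ f0]; exact: (sn_ge0 hs).
exists C => // N a a0 aN a1.
have ma : @Mfun _ int R K (fun k => (a k)%:C%C) by split.
have aE : bfs_norm sigma (fun k => (a k)%:C%C) = sigma a.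
  by congr sigma; apply/funext => k; rewrite cabs_real ger0_norm.
have [||_ h] := hC (fun k => (a k)%:C%C).
- by split => //; rewrite aE (le_lt_trans a1)// ltry.
- by rewrite aE.
apply: (hilbert_hardy_reflect (c := 0) hs hf a0 _ _ h) => [k|k k1]; first exact: cabs_ge0.
apply: le_trans (normRe_le_cabs _); rewrite Re_integral_operator /real_operator/=.
have [n nE] : exists n : nat, k = n%:Z by exists `|k|%N; lia.
rewrite {}nE sub0r in k1 *.
rewrite (@hilbert_hardyE _ N a n)//.
rewrite [X in _ <= `|X|](_ : _ = - \int[Zcount R]_j (hardy_kernel a n j)).
  by rewrite normrN ler_norm.
rewrite -[RHS]mulN1r -RintegralZl//; last exact: integrable_hardy_kernel aN.
rewrite [LHS]Rintegral_mkcond; congr Rintegral; apply/funext => j; rewrite patchE /hardy_kernel.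
have [jN|jN] := boolP (j \in pos_range N); last by rewrite aN// !(mulr0, mul0r); case: ifP.
move: jN; rewrite mem_pos_range => /andP[j1 jN].
rewrite mem_set /=; last by move=> jn; lia.
have -> : (n + `|j|)%:R = - (- n%:Z - j)%:~R :> R.
  by rewrite -rmorphN/= pmulrn; congr (_%:~R); lia.
by rewrite invrN mulrN mulN1r opprK mulrC.
Qed.

Lemma integrable_kernel_cell N a (k : R -> R) : mR k -> (forall y, `|k y| <= 1) ->
  (forall j, j \notin pos_range N -> a j = 0) ->
  mu.-integrable setT (EFin \o (fun y => k y * a (cell y))).
Proof.
move=> mk k1 aN.
have i := integrable_finite_support (pos_range_uniq N) aN.
move/integrable_Zcount : i; apply: le_integrable => //.
  apply/measurable_EFinP; apply: measurable_funM => //; exact: measurable_comp_cell.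
by move=> x _; rewrite /= lee_fin normrM ler_piMl.
Qed.

(** Integrals over the line of functions constant on cells are values of the Hilbert
matrix, so kernels can be compared pointwise. *)
Lemma hilbert_hardy_le_Rintegral N a (c : R) (n : nat) (F : R -> R) : 0 <= c ->
  (0 < n)%N -> (forall j, 0 <= a j) -> (forall j, j \notin pos_range N -> a j = 0) ->
  mu.-integrable setT (EFin \o F) ->
  (forall y, c * hardy_kernel a n (cell y) <= F y) ->
  c * hilbert_hardy N a n%:Z <= (\int[mu]_y F y)%R.
Proof.
move=> c0 n0 a0 aN iF cF.
have i := integrable_hardy_kernel n aN.
have i' : mu.-integrable setT (EFin \o (fun y => hardy_kernel a n (cell y))).
  exact/(integrable_Zcount (EFin \o hardy_kernel a n)).
rewrite (@hilbert_hardyE _ N a n)// (Rintegral_Zcount (hardy_kernel a n)) -RintegralZl//.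
apply: le_Rintegral => //.
have -> : EFin \o (fun y => c * hardy_kernel a n (cell y)) =
  (fun y => c%:E * (EFin \o (fun y => hardy_kernel a n (cell y))) y)%E by [].
exact: integrableZl.
Qed.

(** It suffices to bound the Hilbert matrix from above by a function of bounded norm,
with its values placed on the cells to the left of [d]. *)
Lemma hardy_of_lower_bound N a (c C : R) (d : int) (G : R -> R) : 0 < c ->
  (forall j, 0 <= a j) -> Mp G -> (rho G <= C%:E)%E ->
  (forall x (n : nat), (0 < n)%N -> cell x = d - n%:Z -> c * hilbert_hardy N a n%:Z <= G x) ->
  (sigma (hilbert_hardy N a) <= (c^-1 * C)%:E)%E.
Proof.
move=> c0 a0 mG GC hG.
have ci : 0 <= c^-1 by rewrite invr_ge0 ltW.
pose b j := c * hilbert_hardy N a (d - j).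
have b0 j : 0 <= b j by rewrite mulr_ge0 ?(ltW c0)// hilbert_hardy_ge0.
have bC : (sigma b <= C%:E)%E.
  rewrite (discretized_normE X_ri)//; apply: le_trans GC.
  apply: (rho_mono X_ri) => //; first exact: Mplus_cell.
  move=> x /=; rewrite /b; have [h|h] := leP 1 (d - cell x); last first.
    by rewrite hilbert_hardy_nonpos// mulr0; case: mG.
  have [n nE] : exists n : nat, d - cell x = n%:Z by exists `|d - cell x|%N; lia.
  by rewrite nE; apply: hG; lia.
apply: (hilbert_hardy_reflect (c := d) hs hf a0 _ _ (sn_scale_le hs ci b0 bC)) => [k|k k1].
  exact: mulr_ge0.
by rewrite /b mulKf ?gt_eqF// subKr.
Qed.

End Necessity.

Section LowerBounds.
Context (R : realType) (K : scalars) (rho : (R -> R) -> \bar R).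
Hypothesis X_ri : rearrangement_invariant (@lebesgue_measure R) K rho.
Local Notation mu := (@lebesgue_measure R).
Local Notation mT := (measurableTypeR R).
Local Notation cell := (Num.ceil : measurableTypeR R -> int).
Local Notation Mp := (@Mplus _ (measurableTypeR R) R).
Local Notation mR := (measurable_fun [set: measurableTypeR R]).
Local Notation sigma := (discretized_norm rho).

Lemma bfs_dominated (g : R -> R) a : (forall j, 0 <= a j) -> mR g ->
  (forall x, `|g x| <= a (cell x)) -> (sigma a <= 1)%E ->
  @bfs _ mT R K rho (fun x => (g x)%:C%C) /\
  (@bfs_norm _ mT R rho (fun x => (g x)%:C%C) <= 1)%E.
Proof.
move=> a0 mg ga a1.
have h : (@bfs_norm _ mT R rho (fun x => (g x)%:C%C) <= 1)%E.
  apply: le_trans a1; rewrite (discretized_normE X_ri)// /bfs_norm.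
  rewrite (_ : (fun x => cabs _) = (fun x => `|g x|)); last first.
    by apply/funext => x; rewrite cabs_real.
  by apply: (rho_mono X_ri) => //; [exact: Mplus_abs|exact: Mplus_cell].
by split => //; split; [exact: Mfun_real|rewrite (le_lt_trans h)// ltry].
Qed.

(** For [x] in the cell [- n] and [y > 0] the truncation is not active and [0 < y - x
<= 2 * (n + j)], where [j] is the cell of [y]. *)
Lemma hardy_of_truncated_hilbert : truncated_hilbert_bounded K rho ->
  exists2 C : R, 0 < C & hardy_bounded sigma C.
Proof.
move=> hH; have [|C C0 hC] := bounded_integral_operator_unit _ hH.
  exact: (rho_ge0 X_ri).
exists (2 * C) => [|N a a0 aN a1]; first by rewrite mulr_gt0.
have ma : mR (a \o cell) by exact: measurable_comp_cell.
have na x : `|(a \o cell) x| <= a (cell x) by rewrite /= ger0_norm.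
have [fX f1] := bfs_dominated a0 ma na a1.
have [[mre mim _] h] := hC _ fX f1.
have h2 : 0 < 2^-1 :> R by rewrite invr_gt0.
rewrite -(invrK 2).
refine (@hardy_of_lower_bound R K rho X_ri N a 2^-1 C 0 _ h2 a0 (Mplus_cabs mre mim) h _).
move=> x n n0 xn.
apply: le_trans (normRe_le_cabs _); rewrite Re_integral_operator /real_operator/=.
have xle : x <= - n%:R.
  by have /andP[_] := ceil_itv x; rewrite xn sub0r rmorphN/=.
have xge : - n%:R - 1 < x.
  by have /andP[] := ceil_itv x; rewrite xn sub0r rmorphB/= rmorphN/=.
have n1 : 1 <= n%:R :> R by rewrite ler1n.
pose D := [set y : R | 1 <= `|x - y|].
pose k (y : R) := - (\1_D y * (x - y)^-1).
have mD : measurable (D : set mT).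
  have -> : D = (fun y : mT => `|x - y|) @^-1` `[1, +oo[%classic.
    by apply/seteqP; split=> z /=; rewrite in_itv/= andbT.
  rewrite -[X in measurable X]setTI.
  have md : mR (fun y : mT => x - y) by exact: measurable_funB.
  by apply: (measurableT_comp (@normr_measurable R setT) md) => //; exact: measurable_itv.
have mk : mR k.
  apply: measurableT_comp => //; apply: measurable_funM; first exact: measurable_indic.
  apply: (measurableT_comp (@measurable_invr R)); exact: measurable_funB.
have k1 y : `|k y| <= 1.
  rewrite /k normrN indicE; have [/set_mem/= xy|_] := boolP (y \in D); last by rewrite mul0r normr0.
  by rewrite mul1r normfV invf_le1//; apply: lt_le_trans xy.
have ik := integrable_kernel_cell mk k1 aN.
rewrite [X in _ <= `|X|](_ : _ = - (\int[mu]_y (k y * a (cell y)))%R).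
  rewrite normrN; apply: le_trans (ler_norm _).
  apply: hilbert_hardy_le_Rintegral => //.
  move=> y; rewrite /hardy_kernel.
  have [yN|yN] := boolP (cell y \in pos_range N); last by rewrite aN// !(mulr0, mul0r).
  move: yN; rewrite mem_pos_range => /andP[y1 yN].
  have [j jE] : exists j : nat, cell y = j%:Z by exists `|cell y|%N; lia.
  have := ceil_itv y; rewrite jE rmorphB/= => /andP[y2 y3].
  have j1 : 1 <= j%:R :> R by rewrite ler1n; lia.
  have yD : D y by rewrite /D/= ler0_norm; lra.
  rewrite /k indicE mem_set// mul1r -invrN opprB.
  rewrite natrD mulrCA [leRHS]mulrC -invfM.
  rewrite ler_wpM2l// lef_pV2 ?posrE; lra.
rewrite -[RHS]mulN1r -RintegralZl//.
rewrite [LHS]Rintegral_mkcond; congr Rintegral; apply/funext => y; rewrite patchE /k indicE -/D.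
case: ifP => _; first by rewrite mulN1r mulNr opprK (mul1r (x - y)^-1).
by rewrite (mul0r (x - y)^-1) oppr0 mul0r mulr0.
Qed.

(** The sines of [u] and [u + 1] cannot both be small, because their values determine
[sin 1] through [sin (u + 1 - u)]. *)
Lemma sin_sqr_shift_ge (u : R) : sin 1 ^+ 2 / 2 <= sin u ^+ 2 + sin (u + 1) ^+ 2.
Proof.
have e : sin 1 = sin (u + 1) * cos u - cos (u + 1) * sin u :> R.
  by rewrite -sinB addrAC subrr add0r.
have c1 := cos2Dsin2 u; have c2 := cos2Dsin2 (u + 1).
rewrite {}e; move: (sin u) (cos u) (sin (u + 1)) (cos (u + 1)) c1 c2 => s c s' c' c1 c2.
have h1 : 0 <= (s' * c + c' * s) ^+ 2 by exact: sqr_ge0.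
have h2 : s' ^+ 2 * c ^+ 2 <= s' ^+ 2 by rewrite ler_piMr ?sqr_ge0//; have := sqr_ge0 s; lra.
have h3 : c' ^+ 2 * s ^+ 2 <= s ^+ 2 by rewrite ler_piMl ?sqr_ge0//; have := sqr_ge0 s'; lra.
nra.
Qed.

(** The modulated functions [f cos] and [f sin] have the same norm bound as [f], and
[P x = cos x * S (f sin) - sin x * S (f cos)] is the integral of [sin (x - y) ^ 2
/ (y - x) * f y]. For [x + 1 <= 0] the kernels of [P x] and [P (x + 1)] are
nonnegative on the support of [f], and their sum is at least a multiple of the
inverse of [y - x]. *)
Lemma hardy_of_segment_multiplier : segment_multiplier_bounded K rho ->
  exists2 C : R, 0 < C & hardy_bounded sigma C.
Proof.
move=> hH; have [|C C0 hC] := bounded_integral_operator_unit _ hH.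
  exact: (rho_ge0 X_ri).
pose s := sin 1 ^+ 2 / 2 : R.
have s0 : 0 < s by rewrite divr_gt0// exprn_gt0// sin2_gt0// ltr01 ltrDl ltr01.
exists ((s / 2)^-1 * (2 * C + 2 * C)) => [|N a a0 aN a1].
  have c4 : 0 < 2 * C + 2 * C by lra.
  by rewrite mulr_gt0// invr_gt0 divr_gt0.
pose k (x y : R) := sin (x - y) / (x - y).
have mk x : mR (k x).
  have md : mR (fun y : mT => x - y) by exact: measurable_funB.
  apply: measurable_funM; first exact: (measurableT_comp (@measurable_sin R) md).
  exact: (measurableT_comp (@measurable_invr R) md).
have op (u : R -> R) : mR u -> (forall y, `|u y| <= 1) ->
    exists G, [/\ Mp G, (rho G <= C%:E)%E &
      [/\ mR (fun x => \int[mu]_y (k x y * (u y * a (cell y))))%R,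
        forall x, mu.-integrable setT (EFin \o (fun y => k x y * (u y * a (cell y)))) &
      forall x, `|(\int[mu]_y (k x y * (u y * a (cell y))))%R| <= G x]].
  move=> mu_ u1.
  have mf : mR (fun y => u y * a (cell y)) by apply: measurable_funM => //; exact: measurable_comp_cell.
  have fa x : `|u x * a (cell x)| <= a (cell x) by rewrite normrM (ger0_norm (a0 _)) ler_piMl.
  have [fX f1] := bfs_dominated a0 mf fa a1.
  have [[mre mim _] h] := hC _ fX f1.
  have E := Re_integral_operator mu (fun=> setT) k (fun y => (u y * a (cell y))%:C%C).
  exists (fun x => cabs (integral_operator mu (fun=> setT) k (fun y => (u y * a (cell y))%:C%C) x)).
  split; [exact: Mplus_cabs|exact: h|split].
  - by move: mre; congr (measurable_fun _ _); apply/funext => x; exact: (E x).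
  - move=> x.
    rewrite (_ : EFin \o _ = EFin \o (fun y => (k x y * u y) * a (cell y))); last first.
      by apply/funext => y; rewrite /= mulrA.
    refine (@integrable_kernel_cell R N a (fun y => k x y * u y) _ _ aN); first exact: measurable_funM.
    by move=> y; rewrite normrM mulr_ile1//; exact: sinc_le1.
  - by move=> x; rewrite -[X in `|X|](E x); exact: normRe_le_cabs.
have [Gc [mGc Gc1 [mc ic hc]]] := op cos (@measurable_cos R) (@cos_max R).
have [Gs [mGs Gs1 [ms is_ hs']]] := op sin (@measurable_sin R) (@sin_max R).
pose w (x y : R) := sin (x - y) ^+ 2 / (y - x).
pose P (x : R) := (\int[mu]_y (w x y * a (cell y)))%R.
have wE x y : w x y = cos x * (k x y * sin y) + (- sin x) * (k x y * cos y).
  rewrite /w /k -[y - x]opprB invrN.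
  have -> : sin (x - y) ^+ 2 = sin (x - y) * (sin x * cos y - cos x * sin y) by rewrite -sinB.
  by ring.
have PE x : P x = cos x * (\int[mu]_y (k x y * (sin y * a (cell y))))%R +
    (- sin x) * (\int[mu]_y (k x y * (cos y * a (cell y))))%R.
  rewrite -!RintegralZl//; rewrite -RintegralD//.
  - by apply: eq_Rintegral => y _; rewrite wE; ring.
  - rewrite (_ : EFin \o _ = (fun y => (cos x)%:E * (EFin \o (fun y => (k x y * (sin y * a (cell y)))%R)) y)%E)//.
    exact: integrableZl.
  - rewrite (_ : EFin \o _ = (fun y => (- sin x)%:E * (EFin \o (fun y => (k x y * (cos y * a (cell y)))%R)) y)%E)//.
    exact: integrableZl.
have mP : mR P.
  have -> : P = (fun x => cos x * (\int[mu]_y (k x y * (sin y * a (cell y))))%R +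
      (- sin x) * (\int[mu]_y (k x y * (cos y * a (cell y))))%R).
    by apply/funext.
  apply: measurable_funD; apply: measurable_funM => //; first exact: measurable_cos.
  by apply: measurableT_comp => //; exact: measurable_sin.
have PG x : `|P x| <= Gs x + Gc x.
  rewrite PE; apply: le_trans (ler_normD _ _) _; rewrite !normrM normrN.
  apply: lerD; [apply: le_trans (hs' x)|apply: le_trans (hc x)]; rewrite ler_piMl//.
    exact: cos_max.
  exact: sin_max.
have mPn := Mplus_abs mP.
have rP : (rho (fun x => `|P x|)%R <= (2 * C)%:E)%E.
  apply: le_trans (rho_mono X_ri mPn (MplusD mGs mGc) PG) _.
  by rewrite mulr2n mulrDl mul1r; exact: (rhoD_le X_ri).
have iw x : mu.-integrable setT (EFin \o (fun y => w x y * a (cell y))).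
  refine (@integrable_kernel_cell R N a (w x) _ _ aN).
    rewrite (_ : w x = fun y => - (k x y * sin (x - y))); last first.
      by apply/funext => y; rewrite /w /k -[y - x]opprB invrN; ring.
    apply: measurableT_comp => //; apply: measurable_funM => //.
    by apply: (measurableT_comp (@measurable_sin R)); exact: measurable_funB.
  move=> y; rewrite (_ : w x y = - (k x y * sin (x - y))).
    by rewrite normrN normrM mulr_ile1//; [exact: sinc_le1|exact: sin_max].
  by rewrite /w /k -[y - x]opprB invrN; ring.
have s2 : 0 < s / 2 by exact: divr_gt0.
refine (@hardy_of_lower_bound R K rho X_ri N a (s / 2) (2 * C + 2 * C) (-1)
  (fun x => `|P x| + `|P (x + 1)|) s2 a0 _ _ _).
- exact: MplusD (Mplus_shift 1 mPn).
- apply: (rhoD_le X_ri) => //; first exact: (Mplus_shift 1 mPn).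
  by rewrite (rho_shift X_ri 1 mPn).
move=> x n n0 xn.
apply: (@le_trans _ _ (P x + P (x + 1))); last by apply: lerD; exact: ler_norm.
rewrite -RintegralD//.
apply: hilbert_hardy_le_Rintegral => //.
- exact: ltW.
- rewrite (_ : EFin \o _ = (fun y => (EFin \o (fun y => (w x y * a (cell y))%R)) y + (EFin \o (fun y => (w (x + 1) y * a (cell y))%R)) y)%E)//.
  exact: integrableD.
have xle : x <= - 1 - n%:R.
  by have /andP[_] := ceil_itv x; rewrite xn rmorphB/=.
have xge : - 2 - n%:R < x.
  by have /andP[] := ceil_itv x; rewrite xn !rmorphB/= rmorphN/= => ? _; lra.
have n1 : 1 <= n%:R :> R by rewrite ler1n.
move=> y; rewrite /hardy_kernel.
have [yN|yN] := boolP (cell y \in pos_range N); last by rewrite aN// !(mulr0, mul0r) addr0.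
move: yN; rewrite mem_pos_range => /andP[y1 yN].
have [j jE] : exists j : nat, cell y = j%:Z by exists `|cell y|%N; lia.
have := ceil_itv y; rewrite jE rmorphB/= => /andP[y2 y3].
have j1 : 1 <= j%:R :> R by rewrite ler1n; lia.
rewrite -mulrDl mulrCA [leRHS]mulrC ler_wpM2l//.
have := sin_sqr_shift_ge (x - y); rewrite -/s => hsin.
have q1 : 0 <= sin (x - y) ^+ 2 by exact: sqr_ge0.
have q2 : 0 <= sin (x - y + 1) ^+ 2 by exact: sqr_ge0.
rewrite /w (_ : x + 1 - y = x - y + 1); last by ring.
have nj : 0 < 2 * (n + j)%:R :> R by rewrite natrD; lra.
apply: (@le_trans _ _ ((sin (x - y) ^+ 2 + sin (x - y + 1) ^+ 2) / (2 * (n + j)%:R))).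
  by rewrite -mulrA -invfM ler_wpM2r// invr_ge0 ltW.
rewrite mulrDl; apply: lerD; rewrite ler_wpM2l// lef_pV2 ?posrE//; rewrite ?natrD; lra.
Qed.

End LowerBounds.

(** * The equivalence *)

Lemma boyd_of_hardy (R : realType) (K : scalars) (rho : (R -> R) -> \bar R) :
  rearrangement_invariant (@lebesgue_measure R) K rho ->
  (exists2 C : R, 0 < C & hardy_bounded (discretized_norm rho) C) ->
  [/\ (0 < lower_discrete_boyd rho)%E,
      (lower_discrete_boyd rho <= upper_discrete_boyd rho)%E &
      (upper_discrete_boyd rho < 1)%E].
Proof.
move=> X_ri [C C0 hC].
have hs := discretized_seq_norm X_ri.
split; [|exact: lower_discrete_boyd_le_upper X_ri|].
  exact: hardy_lower_boyd hs (discretized_sn_fatou X_ri) C0 hC.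
have := hardy_lower_boyd (associate_seq_norm hs) (@associate_sn_fatou _ _) C0
  (hardy_bounded_dual hs C0 hC).
rewrite /upper_discrete_boyd /upper_boyd.
case: (lower_boyd _) => [r| |] //=; first by rewrite -EFinB !lte_fin; lra.
by rewrite ltNyr.
Qed.

Local Open Scope ereal_scope.
Theorem theorem4p10 (R : realType) (K : scalars) (rho : (R -> R) -> \bar R)
    (X_ri : rearrangement_invariant (@lebesgue_measure R) K rho) :
  [<-> segment_multiplier_bounded K rho;
       truncated_hilbert_bounded K rho;
       discrete_hilbert_bounded K (discretized_norm rho);
       [/\ 0 < lower_discrete_boyd rho,
           lower_discrete_boyd rho <= upper_discrete_boyd rho &
           upper_discrete_boyd rho < 1]].
Proof.
have bilinear : 0 < lower_discrete_boyd rho -> upper_discrete_boyd rho < 1 ->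
  exists2 C : R, (0 < C)%R & bilinear_bounded rho C := boyd_bilinear X_ri.
have boyd := boyd_of_hardy X_ri.
tfae.
- move=> /(hardy_of_segment_multiplier X_ri)/boyd[l0 _ u1].
  have [C C0 hC] := bilinear l0 u1.
  exact (truncated_hilbert_of_bilinear X_ri C0 hC).
- move=> /(hardy_of_truncated_hilbert X_ri)/boyd[l0 _ u1].
  have [C C0 hC] := bilinear l0 u1.
  exact (discrete_hilbert_of_bilinear X_ri C0 hC).
- by move=> /(hardy_of_discrete_hilbert X_ri)/boyd.
- move=> [l0 _ u1]; have [C C0 hC] := bilinear l0 u1.
  exact (segment_multiplier_of_bilinear X_ri C0 hC).
Qed.
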